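(* Let $\psi_1$ be a radiation solution of the Helmholtz equation in $\mathcal{U}$. The coefficients $F_n,G_n$ of its Karp expansion (see context) have the symmetries $$F_n(\phi)=(-1)^nF_n(\phi+\pi),\qquad G_n(\phi)=(-1)^{n+1}G_n(\phi+\pi),\qquad n\in\mathbb{N},$$ for all angles $\phi$.
   Context: $\mathbb{N}$ includes $0$. $\mathcal{U}$ is a region (open connected set) in $\mathbb{R}^2$ consisting of all points outside a closed bounded regular curve $S$. The Helmholtz equation is $\Delta\psi(x)+\kappa^2\psi(x)=0$, $x\in\mathcal{U}$, $\kappa>0$. A radiation solution is a complex-valued solution $\psi_1$ of the Helmholtz equation in $\mathcal{U}$ of class $C^2$ satisfying $\sqrt{|x|}\left(\frac{\partial}{\partial|x|}-i\kappa\right)\psi_1(x)\to0$ as $|x|\to+\infty$, uniformly in $x/|x|$. $(r,\phi)$ are the polar coordinates of $x$, $r=|x|$; functions of $\phi$ are $2\pi$-periodic. $H_0,H_1$ are the Hankel functions of the first kind of orders $0$ and $1$. Let $\rho>0$ be such that $\mathbb{R}^2\setminus B_\rho\subset\mathcal{U}$, where $B_\rho=\{x\in\mathbb{R}^2:|x|<\rho\}$. Karp expansion (a known theorem of Karp): $$\psi_1(x)=H_0(\kappa|x|)\sum_{j=0}^{\infty}\frac{F_j(\phi)}{|x|^j}+H_1(\kappa|x|)\sum_{j=0}^{\infty}\frac{G_j(\phi)}{|x|^j},\quad x\in\mathbb{R}^2\setminus B_\rho,$$ with the series converging absolutely and uniformly for $|x|\ge\rho_1$, for any $\rho_1>\rho$.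 *)

(* Defs.v *)
(* Stdlib's classical reals R, with Coquelicot.

   Points of the plane have type R * R; Coquelicot's [norm] on this type is
   the Euclidean norm |x| (see [prod_norm]). *)
From Stdlib Require Import Reals.
From Coquelicot Require Import Coquelicot.
Open Scope R_scope.

Definition connected (V : R * R -> Prop) : Prop :=
  forall A B : R * R -> Prop,
    open A -> open B ->
    (forall x, V x -> A x \/ B x) ->
    (exists x, V x /\ A x) -> (exists x, V x /\ B x) ->
    exists x, V x /\ A x /\ B x.

Definition unbounded (V : R * R -> Prop) : Prop :=
  forall M : R, exists x, V x /\ M < norm x.

(* A C^1 arc on [0,1] (with one-sided derivatives at the ends) extends to a
   C^1 map on R, so two-sided derivatives are used throughout; only the
   restriction of gamma to [0,1] matters. *)
Definition regular_arc (gamma : R -> R * R) : Prop :=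
  (forall t : R,
     ex_derive (fun s => fst (gamma s)) t /\
     ex_derive (fun s => snd (gamma s)) t /\
     continuous (Derive (fun s => fst (gamma s))) t /\
     continuous (Derive (fun s => snd (gamma s))) t) /\
  (forall t : R, 0 <= t <= 1 ->
     (Derive (fun s => fst (gamma s)) t, Derive (fun s => snd (gamma s)) t)
       <> (0, 0)).

(* Regular arcs joined cyclically end to end, so corners are allowed; one arc
   (m = 1) is permitted.  Self-intersections are not excluded. *)
Definition closed_regular_curve (S : R * R -> Prop) : Prop :=
  exists (m : nat) (gamma : nat -> R -> R * R),
    (0 < m)%nat /\
    (forall i, (i < m)%nat -> regular_arc (gamma i)) /\
    (forall i, (i < m)%nat -> gamma i 1 = gamma (Nat.modulo (i + 1) m) 0) /\
    (forall x, S x <->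
       exists (i : nat) (t : R), (i < m)%nat /\ 0 <= t <= 1 /\ x = gamma i t).

(* The points outside S form the unbounded component of the complement. *)
Definition outside (S : R * R -> Prop) (x : R * R) : Prop :=
  exists V : R * R -> Prop,
    connected V /\ unbounded V /\ V x /\ (forall y, V y -> ~ S y).

Definition exterior_region (S U : R * R -> Prop) : Prop :=
  open U /\ connected U /\ (forall x, U x <-> outside S x).

Definition polar (r phi : R) : R * R := (r * cos phi, r * sin phi).

(* Real and imaginary parts as curried functions, the form used by
   Coquelicot's two-variable calculus. *)
Definition Re2 (psi : R * R -> C) : R -> R -> R := fun a b => Re (psi (a, b)).
Definition Im2 (psi : R * R -> C) : R -> R -> R := fun a b => Im (psi (a, b)).

(* [ex_diff_n f 2] at every point of an open set is class C^2 there. *)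
Definition class_C2 (U : R * R -> Prop) (psi : R * R -> C) : Prop :=
  forall a b : R, U (a, b) ->
    ex_diff_n (Re2 psi) 2 a b /\ ex_diff_n (Im2 psi) 2 a b.

Definition laplacian (psi : R * R -> C) (x : R * R) : C :=
  (partial_derive 2 0 (Re2 psi) (fst x) (snd x)
     + partial_derive 0 2 (Re2 psi) (fst x) (snd x),
   partial_derive 2 0 (Im2 psi) (fst x) (snd x)
     + partial_derive 0 2 (Im2 psi) (fst x) (snd x)).

Definition helmholtz (kappa : R) (U : R * R -> Prop) (psi : R * R -> C) : Prop :=
  forall x, U x ->
    (laplacian psi x + RtoC (kappa ^ 2) * psi x)%C = RtoC 0.

(* The derivative d/d|x| at the point [polar r phi]. *)
Definition radial_derivative (psi : R * R -> C) (r phi : R) : C :=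
  (Derive (fun s => Re (psi (polar s phi))) r,
   Derive (fun s => Im (psi (polar s phi))) r).

Definition radiation_condition (kappa : R) (psi : R * R -> C) : Prop :=
  forall eps : R, 0 < eps ->
    exists M : R, 0 < M /\
      forall r phi : R, M <= r ->
        Cmod (RtoC (sqrt r) *
              (radial_derivative psi r phi
               - Ci * RtoC kappa * psi (polar r phi)))%C < eps.

Definition radiation_solution
    (kappa : R) (U : R * R -> Prop) (psi : R * R -> C) : Prop :=
  class_C2 U psi /\ helmholtz kappa U psi /\ radiation_condition kappa psi.

(* Bessel functions of integer order n at x > 0, by the Bessel and Schlaefli
   integrals (DLMF 10.9.2 and 10.9.7); the values for x <= 0 are not used. *)
Definition bessel_J (n : nat) (x : R) : R :=
  / PI * RInt (fun t => cos (x * sin t - INR n * t)) 0 PI.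

Definition bessel_Y (n : nat) (x : R) : R :=
  / PI * RInt (fun t => sin (x * sin t - INR n * t)) 0 PI
  - / PI * RInt_gen
             (fun t => (exp (INR n * t) + (-1) ^ n * exp (- (INR n * t)))
                       * exp (- (x * sinh t)))
             (at_point 0) (Rbar_locally p_infty).

(* Hankel function of the first kind, H_n = J_n + i Y_n. *)
Definition hankel1 (n : nat) (x : R) : C := (bessel_J n x, bessel_Y n x).

Definition karp_term (F : nat -> R -> C) (r phi : R) (j : nat) : C :=
  (F j phi / RtoC (r ^ j))%C.

(* [s r phi] is the sum of the series; uniformity is in both r and phi. *)
Definition converges_abs_unif
    (F : nat -> R -> C) (rho1 : R) (s : R -> R -> C) : Prop :=
  (forall r phi, rho1 <= r -> ex_series (fun j => Cmod (karp_term F r phi j))) /\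
  (forall eps : R, 0 < eps ->
     exists N : nat, forall (n : nat) (r phi : R),
       (N <= n)%nat -> rho1 <= r ->
       Cmod (sum_n (karp_term F r phi) n - s r phi)%C < eps).

Definition karp_expansion
    (kappa rho : R) (psi : R * R -> C) (F G : nat -> R -> C) : Prop :=
  (forall n phi, F n (phi + 2 * PI) = F n phi /\ G n (phi + 2 * PI) = G n phi) /\
  exists A B : R -> R -> C,
    (forall r phi, rho <= r ->
       is_series (karp_term F r phi) (A r phi) /\
       is_series (karp_term G r phi) (B r phi) /\
       psi (polar r phi) = (hankel1 0 (kappa * r) * A r phi
                            + hankel1 1 (kappa * r) * B r phi)%C) /\
    (forall rho1, rho < rho1 ->
       converges_abs_unif F rho1 A /\ converges_abs_unif G rho1 B).

(* Main.v *)
Require Import Defs.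
From Stdlib Require Import Reals Lra Lia ZArith IndefiniteDescription.
From Coquelicot Require Import Coquelicot.
From mathcomp Require filter.
Open Scope R_scope.

(** Why the symmetry holds.  At a fixed angle, Karp's expansion writes the solution as
    [H0(kappa r) a(1/r) + H1(kappa r) b(1/r)] with convergent power series [a], [b].

    The coefficients are unique: if [H0 a + H1 b = 0] near infinity, then [a = b = 0]
    ([cylinder_independence]).  Differentiating such a relation with the rules
    [H0' = - H1] and [H1' = H0 - H1/x] gives a second one, and as [H0], [H1] have no
    common zero the determinant vanishes: with [k = kappa], as functions of [x = r],
    [a b' - a' b = k (a^2 + b^2) + a b / x].  After division by a common power of [1/x]
    the leading coefficients satisfy [a0^2 + b0^2 = 0], so the series
    [D = Im (a conj b)] is invertible, and [|b|^2 / (x D)] is a convergent series in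
    [1/x].  It solves the third-order equation of the products of Bessel functions, as
    [|H0|^2] does, and the formal solutions of this equation in [1/x] have factorially
    growing coefficients: a contradiction.

    Uniqueness also makes the coefficients regular in the angle.  Along an
    ultrafilter, uniformly bounded coefficients converge, and uniqueness identifies
    their limits ([cylinder_coefficients_continuous]).  Applied to coefficients
    divided by their size, this shows that the coefficients are bounded by [K M^n]
    uniformly in the angle ([cylinder_coefficients_bounded]); applied along the
    neighbourhoods of an angle, it shows that they are continuous.  Hence the
    expansion may be integrated termwise against [cos (m (phi - c))].

    The integral of the solution against this cosine satisfies Bessel's equation of
    order [m] in [r] ([angular_mode_bessel]).  By uniqueness, the integrated
    coefficients [a_n] of [F_n] and [b_n] of [G_n] satisfy [(n^2 - m^2) a_n = 2 kappa
    (n+1) b_(n+1)] and [((n+1)^2 - m^2) b_n = - 2 kappa (n+1) a_(n+1)].  These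
    relations split into two chains.  One of them meets a zero factor and breaks off;
    the other, made of the [a_n] with [n + m] odd and the [b_n] with [n + m] even,
    contains no zero factor and would grow factorially, which is incompatible with
    convergence unless it vanishes ([recurrence_parity]).  Thus [F_n] contains only
    frequencies of the parity of [n] and [G_n] only those of the opposite parity.  A
    continuous function is determined by its cosine moments about each point
    ([trig_moments_determine]), and the symmetries follow ([half_turn_symmetry]). *)

(** * Preliminaries on real functions *)

Lemma ex_RInt_of_continuous (f : R -> R) (a b : R) :
  (forall t, continuous f t) -> ex_RInt f a b.
Proof.
  intros H. apply (ex_RInt_continuous (V := R_CompleteNormedModule)). auto.
Qed.

Lemma continuous_of_ex_derive (f : R -> R) (t : R) : ex_derive f t -> continuous f t.
Proof. apply (ex_derive_continuous (V := R_NormedModule)). Qed.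

Lemma continuous_Rmult (f g : R -> R) (t : R) :
  continuous f t -> continuous g t -> continuous (fun s => f s * g s) t.
Proof. apply (continuous_mult (K := R_AbsRing)). Qed.

Lemma ex_RInt_of_derivable (f : R -> R) (a b : R) :
  (forall t, ex_derive f t) -> ex_RInt f a b.
Proof.
  intros H. apply (ex_RInt_continuous (V := R_CompleteNormedModule)).
  intros t _. apply (ex_derive_continuous (V := R_NormedModule)), H.
Qed.

Lemma continuous_Rplus (f g : R -> R) (t : R) :
  continuous f t -> continuous g t -> continuous (fun s => f s + g s) t.
Proof. apply (continuous_plus (V := R_NormedModule)). Qed.

(** * Expansions in inverse powers *)

Definition geometric (c : nat -> R) : Prop :=
  exists K M : R, 0 < M /\ forall n, Rabs (c n) <= K * M ^ n.

(** Only the germ of [f] at infinity matters, so that the functions with an expansion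
    form a ring closed under differentiation and under division by units. *)
Definition expands (c : nat -> R) (f : R -> R) : Prop :=
  geometric c /\ Rbar_locally p_infty (fun x => f x = PSeries c (/ x)).

Lemma geometric_CV_radius (c : nat -> R) :
  geometric c <-> Rbar_lt 0 (CV_radius c).
Proof.
  split.
  - intros (K & M & HM & H).
    apply Rbar_lt_le_trans with (Finite (/ M)).
    + simpl. now apply Rinv_0_lt_compat.
    + destruct (CV_radius_bounded c) as [Hub _]. apply (Hub (/ M)).
      exists K. intros n.
      rewrite Rabs_mult, pow_inv.
      assert (Hp : 0 < M ^ n) by now apply pow_lt.
      rewrite (Rabs_pos_eq (/ M ^ n)) by (left; now apply Rinv_0_lt_compat).
      apply Rmult_le_reg_r with (M ^ n); [exact Hp|].
      rewrite Rmult_assoc, Rinv_l, Rmult_1_r by lra. apply H.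
  - intros H.
    destruct (CV_radius_bounded c) as [_ Hlub].
    assert (Hr : exists r, 0 < r /\ exists M, forall n, Rabs (c n * r ^ n) <= M).
    { apply Classical_Prop.NNPP. intros Hn.
      apply (Rbar_lt_not_le _ _ H). apply Hlub. intros r [M HM].
      destruct (Rle_lt_dec r 0) as [Hr|Hr]; [exact Hr|].
      exfalso. apply Hn. exists r. split; [exact Hr|]. now exists M. }
    destruct Hr as (r & Hr & M & HM).
    exists M, (/ r). split; [now apply Rinv_0_lt_compat|].
    intros n. specialize (HM n). rewrite Rabs_mult in HM.
    assert (Hp : 0 < r ^ n) by now apply pow_lt.
    rewrite (Rabs_pos_eq (r ^ n)) in HM by lra.
    rewrite pow_inv. apply Rmult_le_reg_r with (r ^ n); [exact Hp|].
    rewrite Rmult_assoc, Rinv_l, Rmult_1_r by lra. exact HM.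
Qed.

Lemma geometric_near (c : nat -> R) :
  geometric c ->
  Rbar_locally p_infty
    (fun x => 0 < x /\ Rbar_lt (Rabs (/ x)) (CV_radius c)).
Proof.
  intros Hc. apply geometric_CV_radius in Hc.
  assert (Hr : exists r, 0 < r /\ Rbar_le r (CV_radius c)).
  { destruct (CV_radius c) as [r| |]; simpl in *.
    - exists r. split; [exact Hc|apply Rle_refl].
    - exists 1. split; [lra|exact I].
    - contradiction. }
  destruct Hr as (r & Hr & Hle).
  assert (Hri : 0 < / r) by now apply Rinv_0_lt_compat.
  exists (/ r). intros x Hx. split; [lra|].
  apply Rbar_lt_le_trans with (2 := Hle). simpl.
  assert (0 < / x) by (apply Rinv_0_lt_compat; lra).
  rewrite Rabs_pos_eq by lra.
  rewrite <- (Rinv_inv r). apply Rinv_lt_contravar; [|exact Hx].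
  apply Rmult_lt_0_compat; lra.
Qed.

Lemma expands_ext (c : nat -> R) (f g : R -> R) :
  Rbar_locally p_infty (fun x => f x = g x) -> expands c f -> expands c g.
Proof.
  intros He [Hc Hf]. split; [exact Hc|].
  generalize (filter_and _ _ He Hf). apply filter_imp.
  intros x [H1 H2]. now rewrite <- H1.
Qed.

Lemma expands_ext_coef (c d : nat -> R) (f : R -> R) :
  (forall n, c n = d n) -> expands c f -> expands d f.
Proof.
  intros He [(K & M & HM & H) Hf]. split.
  - exists K, M. split; [exact HM|]. intros n. now rewrite <- He.
  - revert Hf. apply filter_imp. intros x ->. now apply PSeries_ext.
Qed.

Lemma expands_PSeries (c : nat -> R) :
  geometric c -> expands c (fun x => PSeries c (/ x)).
Proof. intros H. split; [exact H|]. exists 0. reflexivity. Qed.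

Lemma expands_plus (c d : nat -> R) (f g : R -> R) :
  expands c f -> expands d g ->
  expands (fun n => c n + d n) (fun x => f x + g x).
Proof.
  intros [Hc Hf] [Hd Hg]. split.
  - apply geometric_CV_radius.
    apply Rbar_lt_le_trans with (2 := CV_radius_plus c d).
    apply geometric_CV_radius in Hc. apply geometric_CV_radius in Hd.
    now apply Rbar_min_case.
  - generalize (filter_and _ _ (filter_and _ _ (geometric_near c Hc)
      (geometric_near d Hd)) (filter_and _ _ Hf Hg)).
    apply filter_imp. intros x [[[_ H1] [_ H2]] [-> ->]].
    symmetry. apply PSeries_plus; now apply CV_radius_inside.
Qed.

Lemma expands_scal (k : R) (c : nat -> R) (f : R -> R) :
  expands c f -> expands (fun n => k * c n) (fun x => k * f x).
Proof.
  intros [(K & M & HM & H) Hf]. split.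
  - exists (Rabs k * K), M. split; [exact HM|]. intros n.
    rewrite Rabs_mult, Rmult_assoc.
    apply Rmult_le_compat_l; [apply Rabs_pos|apply H].
  - revert Hf. apply filter_imp. intros x ->. symmetry. apply PSeries_scal.
Qed.

Lemma expands_minus (c d : nat -> R) (f g : R -> R) :
  expands c f -> expands d g ->
  expands (fun n => c n - d n) (fun x => f x - g x).
Proof.
  intros Hf Hg.
  apply expands_ext_coef with (fun n => c n + (-1) * d n); [intros n; ring|].
  apply expands_ext with (fun x => f x + (-1) * g x).
  { exists 0. intros x _. ring. }
  apply expands_plus; [exact Hf|]. now apply expands_scal.
Qed.

Lemma expands_mult (c d : nat -> R) (f g : R -> R) :
  expands c f -> expands d g ->
  expands (PS_mult c d) (fun x => f x * g x).
Proof.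
  intros [Hc Hf] [Hd Hg].
  assert (Hn := filter_and _ _ (geometric_near c Hc) (geometric_near d Hd)).
  split.
  - apply geometric_CV_radius. destruct Hn as [X HX].
    destruct (HX (Rmax X 0 + 1)) as [[H0 H1] [_ H2]].
    { generalize (Rmax_l X 0). lra. }
    set (x := Rmax X 0 + 1) in *.
    destruct (Rbar_lt_le_dec 0 (CV_radius (PS_mult c d))) as [H|H]; [exact H|].
    exfalso.
    assert (Hx : 0 < / x) by now apply Rinv_0_lt_compat.
    apply (CV_disk_outside (PS_mult c d) (/ x)).
    + apply Rbar_le_lt_trans with (1 := H). simpl. rewrite Rabs_pos_eq; lra.
    + assert (Hs := ex_pseries_mult c d (/ x) H1 H2).
      apply ex_pseries_R in Hs. now apply ex_series_lim_0.
  - generalize (filter_and _ _ Hn (filter_and _ _ Hf Hg)).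
    apply filter_imp. intros x [[[_ H1] [_ H2]] [-> ->]].
    now rewrite PSeries_mult.
Qed.

Lemma expands_shift (c : nat -> R) (f : R -> R) :
  expands c f -> expands (PS_incr_1 c) (fun x => f x / x).
Proof.
  intros [Hc Hf]. split.
  - apply geometric_CV_radius. rewrite CV_radius_incr_1.
    now apply geometric_CV_radius.
  - revert Hf. apply filter_imp. intros x ->.
    rewrite PSeries_incr_1. unfold Rdiv. ring.
Qed.

Lemma expands_unshift (c : nat -> R) (f : R -> R) :
  c 0%nat = 0 -> expands c f -> expands (PS_decr_1 c) (fun x => x * f x).
Proof.
  intros H0 [Hc Hf]. split.
  - apply geometric_CV_radius. rewrite CV_radius_decr_1.
    now apply geometric_CV_radius.
  - generalize (filter_and _ _ (geometric_near c Hc) Hf).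
    apply filter_imp. intros x [[Hx _] ->].
    rewrite PSeries_decr_1_aux by exact H0. field. lra.
Qed.

Definition deriv_coef (c : nat -> R) (n : nat) : R :=
  match n with O => 0 | S k => - INR k * c k end.

Lemma expands_deriv (c : nat -> R) (f : R -> R) :
  expands c f ->
  exists f' : R -> R,
    expands (deriv_coef c) f' /\
    Rbar_locally p_infty (fun x => is_derive f x (f' x)).
Proof.
  intros [Hc Hf].
  set (g := fun x => - / x ^ 2 * PSeries (PS_derive c) (/ x)).
  exists g. split.
  - apply expands_ext_coef with
      (PS_incr_1 (PS_incr_1 (fun n => -1 * PS_derive c n))).
    { intros [|[|n]]; simpl; unfold zero; simpl; try ring.
      unfold PS_derive. rewrite S_INR. simpl. destruct n; simpl; ring. }
    apply expands_ext with
      (fun x => -1 * PSeries (PS_derive c) (/ x) / x / x).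
    { exists 0. intros x Hx. unfold g. field. lra. }
    apply expands_shift, expands_shift, expands_scal, expands_PSeries.
    apply geometric_CV_radius. rewrite CV_radius_derive.
    now apply geometric_CV_radius.
  - destruct (filter_and _ _ (geometric_near c Hc) Hf) as [X HX].
    exists X. intros x Hx. destruct (HX x Hx) as [[H0 H1] _].
    apply is_derive_ext_loc with (fun x => PSeries c (/ x)).
    + exists (mkposreal (x - X) (proj2 (Rlt_0_minus _ _) Hx)). intros y Hy.
      unfold ball in Hy; simpl in Hy; unfold AbsRing_ball, abs, minus, plus, opp in Hy; simpl in Hy.
      symmetry. apply HX. apply Rabs_def2 in Hy. lra.
    + unfold g.
      evar_last.
      apply (is_derive_comp (PSeries c) (fun x => / x)).
      * now apply is_derive_PSeries.
      * apply is_derive_inv; [apply @is_derive_id|lra].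
      * unfold scal; simpl; unfold mult, one; simpl. field. lra.
Qed.

Lemma expands_lim (c : nat -> R) (f : R -> R) :
  expands c f -> is_lim f p_infty (c 0%nat).
Proof.
  intros [Hc Hf].
  apply is_lim_ext_loc with (fun x => PSeries c (/ x)).
  { revert Hf. apply filter_imp. now intros x ->. }
  apply geometric_CV_radius in Hc.
  assert (Hcont : continuous (PSeries c) 0).
  { apply continuity_pt_filterlim. apply PSeries_continuity.
    now rewrite Rabs_R0. }
  unfold continuous in Hcont. rewrite PSeries_0 in Hcont.
  assert (Hi : is_lim Rinv p_infty 0).
  { replace (Finite 0) with (Rbar_inv p_infty) by reflexivity.
    apply is_lim_inv; [apply is_lim_id|discriminate]. }
  unfold is_lim in *. simpl in *.
  eapply filterlim_comp; [exact Hi|exact Hcont].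
Qed.

(** The values at real points tending to infinity determine the series: the constant
    coefficient is a limit, and multiplication by [x] shifts the others down to it. *)
Lemma expands_zero (c : nat -> R) (f : R -> R) :
  expands c f -> Rbar_locally p_infty (fun x => f x = 0) ->
  forall n, c n = 0.
Proof.
  intros Hf H0 n. revert c f Hf H0.
  assert (Hfirst : forall c f, expands c f ->
    Rbar_locally p_infty (fun x => f x = 0) -> c 0%nat = 0).
  { intros c f Hf H0.
    assert (H1 := expands_lim c f Hf).
    assert (H2 : is_lim f p_infty 0).
    { apply is_lim_ext_loc with (fun _ => 0).
      - revert H0. apply filter_imp. now intros x ->.
      - apply is_lim_const. }
    apply is_lim_unique in H1. apply is_lim_unique in H2.
    rewrite H1 in H2. now injection H2. }
  induction n as [|n IH]; intros c f Hf H0; [now apply Hfirst with f|].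
  change (c (S n)) with (PS_decr_1 c n).
  apply IH with (fun x => x * f x).
  - apply expands_unshift; [now apply Hfirst with f|exact Hf].
  - revert H0. apply filter_imp. intros x ->. ring.
Qed.

Lemma expands_unique (c d : nat -> R) (f g : R -> R) :
  expands c f -> expands d g ->
  Rbar_locally p_infty (fun x => f x = g x) ->
  forall n, c n = d n.
Proof.
  intros Hf Hg He n.
  assert (H : c n - d n = 0); [|lra].
  apply (expands_zero _ _ (expands_minus c d f g Hf Hg)).
  revert He. apply filter_imp. intros x ->. ring.
Qed.

(** Coefficients of the reciprocal series, latest first, so that the convolution
    giving the next one reads the list from its head. *)
Fixpoint recip_list (c : nat -> R) (n : nat) : list R :=
  match n with
  | O => (/ c 0%nat :: nil)%list
  | S k =>
      let l := recip_list c k in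
      (- / c 0%nat * sum_f_R0 (fun i => c (S i) * List.nth i l 0)%R k :: l)%list
  end.

Definition recip (c : nat -> R) (n : nat) : R := List.nth 0 (recip_list c n) 0.

Lemma recip_list_nth (c : nat -> R) (n i : nat) :
  (i <= n)%nat -> List.nth i (recip_list c n) 0 = recip c (n - i).
Proof.
  revert i. induction n as [|n IH]; intros [|i] Hi; try lia; try reflexivity.
  simpl List.nth. rewrite IH by lia. f_equal.
Qed.

Lemma recip_S (c : nat -> R) (n : nat) :
  recip c (S n) =
  - / c 0%nat * sum_f_R0 (fun i => c (S i) * recip c (n - i)) n.
Proof.
  unfold recip at 1. simpl. f_equal. apply sum_eq. intros i Hi.
  now rewrite recip_list_nth.
Qed.

Lemma PS_mult_recip (c : nat -> R) (n : nat) :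
  c 0%nat <> 0 ->
  PS_mult c (recip c) n = match n with O => 1 | S _ => 0 end.
Proof.
  intros H0. destruct n as [|n].
  - unfold PS_mult, recip. simpl. field. exact H0.
  - unfold PS_mult. rewrite decomp_sum by lia. simpl pred.
    rewrite Nat.sub_0_r, recip_S. simpl Nat.sub. field. exact H0.
Qed.

Lemma geometric_recip (c : nat -> R) : geometric c -> geometric (recip c).
Proof.
  intros (K & M & HM & H).
  set (A := Rabs (/ c 0%nat)).
  assert (HA : 0 <= A) by apply Rabs_pos.
  assert (HK : 0 <= K).
  { specialize (H 0%nat). simpl in H. generalize (Rabs_pos (c 0%nat)). lra. }
  assert (HAK : 0 <= A * K) by now apply Rmult_le_pos.
  (* This ratio makes [A * K * M / (L - M)] equal to 1, so that the geometric sum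
     [Hgeo] reproduces the bound for the next coefficient. *)
  set (L := M * (1 + A * K)).
  assert (HL : 0 < L) by (apply Rmult_lt_0_compat; lra).
  exists A, L. split; [exact HL|].
  assert (Hgeo : forall n,
    A * (K * sum_f_R0 (fun i => M ^ S i * L ^ (n - i)) n) = L ^ S n - M ^ S n).
  { induction n as [|n IH].
    - simpl. unfold L. ring.
    - rewrite tech5, Nat.sub_diag.
      rewrite (sum_eq _ (fun i => M ^ S i * L ^ (n - i) * L)).
      2:{ intros i Hi. replace (S n - i)%nat with (S (n - i)) by lia.
          simpl. ring. }
      rewrite <- scal_sum.
      replace (A * (K * (L * sum_f_R0 (fun i => M ^ S i * L ^ (n - i)) n
                         + M ^ S (S n) * L ^ 0)))
        with (L * (A * (K * sum_f_R0 (fun i => M ^ S i * L ^ (n - i)) n))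
              + A * K * (M * M ^ S n)) by (simpl; ring).
      rewrite IH. change (L ^ S (S n)) with (L * L ^ S n).
      change (M ^ S (S n)) with (M * M ^ S n).
      replace (L * (L ^ S n - M ^ S n)) with
        (L * L ^ S n - M * (1 + A * K) * M ^ S n) by (unfold L; ring).
      ring. }
  intros n.
  induction n as [n IH] using (well_founded_induction Wf_nat.lt_wf).
  destruct n as [|n].
  - unfold recip. simpl. unfold A. lra.
  - rewrite recip_S, Rabs_mult, Rabs_Ropp. fold A.
    apply Rmult_le_compat_l; [exact HA|].
    apply Rle_trans with (A * (K * sum_f_R0 (fun i => M ^ S i * L ^ (n - i)) n)).
    2:{ rewrite Hgeo. assert (0 < M ^ S n) by now apply pow_lt. lra. }
    apply Rle_trans with (1 := Rsum_abs _ _).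
    rewrite <- Rmult_assoc, scal_sum.
    apply sum_Rle. intros i Hi.
    rewrite Rabs_mult.
    apply Rle_trans with (K * M ^ S i * (A * L ^ (n - i))).
    + apply Rmult_le_compat; try apply Rabs_pos; [apply H|].
      apply IH. lia.
    + right. ring.
Qed.

Lemma expands_inv (c : nat -> R) (f : R -> R) :
  c 0%nat <> 0 -> expands c f -> expands (recip c) (fun x => / f x).
Proof.
  intros H0 Hf.
  assert (Hr := expands_PSeries _ (geometric_recip c (proj1 Hf))).
  apply expands_ext with (2 := Hr).
  assert (Hm := expands_mult _ _ _ _ Hf Hr).
  destruct Hm as [Hg Hm]. revert Hm. apply filter_imp. intros x Hx.
  assert (H1 : PSeries (PS_mult c (recip c)) (/ x) = 1).
  { rewrite (PSeries_ext _ (fun n => match n with O => 1 | S _ => 0 end)).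
    2:{ intros n. now apply PS_mult_recip. }
    rewrite PSeries_decr_1.
    - rewrite (PSeries_ext _ (fun _ => 0)) by reflexivity.
      rewrite PSeries_const_0. ring.
    - apply CV_radius_inside. rewrite <- CV_radius_decr_1.
      rewrite (CV_radius_ext _ (fun _ => 0)) by reflexivity.
      now rewrite CV_radius_const_0. }
  rewrite H1 in Hx.
  assert (f x <> 0) by (intros E; rewrite E in Hx; lra).
  apply Rmult_eq_reg_l with (f x); [|assumption].
  rewrite Hx. field. assumption.
Qed.

(** * Growth of coefficients, and cylinder pairs *)

(** The contradiction between convergence and factorial growth, used both for the
    independence of the cylinder functions and for the angular modes: the ratios tend
    to infinity, hence all late terms vanish, and nonzero ratios carry this back to
    the first term. *)
Lemma superexponential_zero (c lambda : nat -> R) :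
  geometric c ->
  (forall n, c (S n) = lambda n * c n) ->
  (forall n, lambda n <> 0) ->
  (forall B, exists n0, forall n, (n0 <= n)%nat -> B <= Rabs (lambda n)) ->
  forall n, c n = 0.
Proof.
  intros (K & M & HM & Hc) Hrec Hnz Hinf.
  destruct (Hinf (2 * M)) as [n0 Hn0].
  assert (Hlate : forall n, (n0 <= n)%nat -> c n = 0).
  { intros n Hn.
    assert (Hgrow : forall k, (2 * M) ^ k * Rabs (c n) <= Rabs (c (n + k)%nat)).
    { induction k as [|k IH].
      - rewrite Nat.add_0_r. simpl. lra.
      - rewrite Nat.add_succ_r, Hrec, Rabs_mult. simpl pow.
        rewrite Rmult_assoc. apply Rmult_le_compat; try lra.
        + apply Rmult_le_pos; [apply pow_le; lra|apply Rabs_pos].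
        + apply Hn0. lia. }
    destruct (Req_dec (c n) 0) as [E|E]; [exact E|exfalso].
    apply Rabs_pos_lt in E.
    assert (H2 : forall k, 2 ^ k * Rabs (c n) <= K * M ^ n).
    { intros k. apply Rmult_le_reg_l with (M ^ k); [now apply pow_lt|].
      specialize (Hgrow k). specialize (Hc (n + k)%nat).
      rewrite Rpow_mult_distr in Hgrow. rewrite pow_add in Hc. lra. }
    destruct (Pow_x_infinity 2 ltac:(rewrite Rabs_pos_eq; lra)
                (K * M ^ n / Rabs (c n) + 1)) as [k Hk].
    specialize (Hk k (le_n k)). rewrite Rabs_pos_eq in Hk by (apply pow_le; lra).
    specialize (H2 k). apply Rge_le in Hk.
    apply Rmult_le_compat_r with (r := Rabs (c n)) in Hk; [|lra].
    replace ((K * M ^ n / Rabs (c n) + 1) * Rabs (c n))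
      with (K * M ^ n + Rabs (c n)) in Hk by (field; lra).
    lra. }
  assert (Hback : forall n, c (S n) = 0 -> c n = 0).
  { intros n H. rewrite Hrec in H. apply Rmult_integral in H.
    destruct H as [H|H]; [|exact H]. now destruct (Hnz n). }
  intros n.
  destruct (Nat.le_gt_cases n0 n) as [H|H]; [now apply Hlate|].
  assert (Hd : forall d m, (m + d = n0)%nat -> c m = 0).
  { induction d as [|d IH]; intros m Hm; [apply Hlate; lia|].
    apply Hback, IH. lia. }
  apply (Hd (n0 - n)%nat). lia.
Qed.

Lemma near_infinity_locally (P : R -> Prop) :
  Rbar_locally p_infty P -> Rbar_locally p_infty (fun x => locally x P).
Proof.
  intros [X HX]. exists X. intros x Hx.
  exists (mkposreal (x - X) (proj2 (Rlt_0_minus _ _) Hx)). intros y Hy.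
  unfold ball in Hy; simpl in Hy;
    unfold AbsRing_ball, abs, minus, plus, opp in Hy; simpl in Hy.
  apply HX. apply Rabs_def2 in Hy. lra.
Qed.

Definition cexpands (c : nat -> C) (f : R -> C) : Prop :=
  expands (fun n => Re (c n)) (fun x => Re (f x)) /\
  expands (fun n => Im (c n)) (fun x => Im (f x)).

Definition is_cderive (f : R -> C) (x : R) (l : C) : Prop :=
  is_derive (fun y => Re (f y)) x (Re l) /\
  is_derive (fun y => Im (f y)) x (Im l).

Lemma is_cderive_ext_loc (f g : R -> C) (x : R) (l : C) :
  locally x (fun y => f y = g y) -> is_cderive f x l -> is_cderive g x l.
Proof.
  intros He [H1 H2]. split.
  - apply is_derive_ext_loc with (2 := H1).
    revert He. apply filter_imp. now intros y ->.
  - apply is_derive_ext_loc with (2 := H2).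
    revert He. apply filter_imp. now intros y ->.
Qed.

Lemma is_cderive_unique (f : R -> C) (x : R) (l l' : C) :
  is_cderive f x l -> is_cderive f x l' -> l = l'.
Proof.
  intros [H1 H2] [H3 H4].
  apply is_derive_unique in H1. apply is_derive_unique in H2.
  apply is_derive_unique in H3. apply is_derive_unique in H4.
  destruct l, l'; simpl in *. congruence.
Qed.

Lemma is_cderive_const (c : C) (x : R) : is_cderive (fun _ => c) x 0.
Proof. split; apply (is_derive_const (V := R_NormedModule)). Qed.

Lemma is_cderive_plus (f g : R -> C) (x : R) (l m : C) :
  is_cderive f x l -> is_cderive g x m ->
  is_cderive (fun y => f y + g y)%C x (l + m)%C.
Proof.
  intros [H1 H2] [H3 H4].
  split; now apply @is_derive_plus.
Qed.

Lemma is_cderive_mult (f g : R -> C) (x : R) (l m : C) :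
  is_cderive f x l -> is_cderive g x m ->
  is_cderive (fun y => f y * g y)%C x (l * g x + f x * m)%C.
Proof.
  intros [H1 H2] [H3 H4].
  split; simpl; evar_last.
  - apply @is_derive_minus; (apply @is_derive_mult; [eassumption|eassumption|intros; apply Rmult_comm]).
  - unfold minus, plus, opp, mult, Re, Im; simpl. ring.
  - apply @is_derive_plus; (apply @is_derive_mult; [eassumption|eassumption|intros; apply Rmult_comm]).
  - unfold minus, plus, opp, mult, Re, Im; simpl. ring.
Qed.

(** The rules for the derivatives of Bessel functions of orders 0 and 1 at [k * x],
    together with the absence of common zeros; every linear combination of [J] and [Y]
    other than 0 satisfies them. *)
Definition cylinder_pair (k : R) (h0 h1 : R -> C) : Prop :=
  forall x, 0 < x ->
    is_cderive h0 x (- RtoC k * h1 x)%C /\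
    is_cderive h1 x (RtoC k * h0 x - h1 x / RtoC x)%C /\
    (h0 x <> 0 \/ h1 x <> 0).

Lemma cexpands_deriv (c : nat -> C) (f : R -> C) :
  cexpands c f ->
  exists f' : R -> C,
    cexpands (fun n => (deriv_coef (fun n => Re (c n)) n,
                        deriv_coef (fun n => Im (c n)) n)) f' /\
    Rbar_locally p_infty (fun x => is_cderive f x (f' x)).
Proof.
  intros [H1 H2].
  destruct (expands_deriv _ _ H1) as (f1 & E1 & D1).
  destruct (expands_deriv _ _ H2) as (f2 & E2 & D2).
  exists (fun x => (f1 x, f2 x)). split.
  - split; [exact E1|exact E2].
  - generalize (filter_and _ _ D1 D2). apply filter_imp.
    intros x [H3 H4]. split; assumption.
Qed.

(** The derivative of the relation is again a relation between [h0] and [h1], with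
    coefficients [f' + k g] and [g' - k f - g / x]; two relations at a point where
    [(h0, h1)] is nonzero have a vanishing determinant. *)
Lemma cylinder_relation_determinant (k : R) (h0 h1 f g f' g' : R -> C) :
  cylinder_pair k h0 h1 ->
  Rbar_locally p_infty (fun x => is_cderive f x (f' x)) ->
  Rbar_locally p_infty (fun x => is_cderive g x (g' x)) ->
  Rbar_locally p_infty (fun x => (h0 x * f x + h1 x * g x = 0)%C) ->
  Rbar_locally p_infty (fun x =>
    (f x * g' x - g x * f' x =
     RtoC k * (f x * f x + g x * g x) + f x * g x * RtoC (/ x))%C).
Proof.
  intros Hcyl Df Dg Hrel.
  assert (Hpos : Rbar_locally p_infty (fun x => 0 < x)) by (exists 0; auto).
  generalize (filter_and _ _ Hpos (filter_and _ _ (filter_and _ _ Df Dg)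
                (near_infinity_locally _ Hrel))).
  apply filter_imp. intros x [Hx [[Hf Hg] Hloc]].
  destruct (Hcyl x Hx) as (Hh0 & Hh1 & Hnz).
  assert (Hval := locally_singleton _ _ Hloc). simpl in Hval.
  assert (Hd := is_cderive_plus _ _ _ _ _
                  (is_cderive_mult _ _ _ _ _ Hh0 Hf)
                  (is_cderive_mult _ _ _ _ _ Hh1 Hg)).
  apply (is_cderive_ext_loc _ (fun _ => RtoC 0) _ _ Hloc) in Hd.
  assert (E := is_cderive_unique _ _ _ _ Hd (is_cderive_const 0 x)).
  assert (Hxc : RtoC x <> 0) by (intros H; injection H; lra).
  assert (Ex : (/ RtoC x = RtoC (/ x))%C) by (rewrite RtoC_inv; [reflexivity|lra]).
  unfold Cdiv in E. rewrite Ex in E.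
  set (w := RtoC (/ x)) in *. set (kc := RtoC k) in *.
  set (det := (f x * g' x - g x * f' x
               - (kc * (f x * f x + g x * g x) + f x * g x * w))%C).
  assert (H0 : (h0 x * det = 0)%C).
  { unfold det.
    replace (h0 x * _)%C with
      ((h0 x * f x + h1 x * g x) * (g' x - kc * f x - g x * w)
       - g x * ((- kc * h1 x) * f x + h0 x * f' x
                + ((kc * h0 x - h1 x * w) * g x + h1 x * g' x)))%C by ring.
    rewrite Hval, E. ring. }
  assert (H1 : (h1 x * det = 0)%C).
  { unfold det.
    replace (h1 x * _)%C with
      (f x * ((- kc * h1 x) * f x + h0 x * f' x
                + ((kc * h0 x - h1 x * w) * g x + h1 x * g' x))
       - (f' x + kc * g x) * (h0 x * f x + h1 x * g x))%C by ring.
    rewrite Hval, E. ring. }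
  assert (Hdet : det = 0).
  { destruct (Ceq_dec det 0) as [e|e]; [exact e|exfalso].
    destruct Hnz as [Hn|Hn]; now apply (Cmult_neq_0 _ _ Hn e). }
  unfold det in Hdet.
  replace (f x * g' x - g x * f' x)%C with
    (f x * g' x - g x * f' x - (kc * (f x * f x + g x * g x) + f x * g x * w)
     + (kc * (f x * f x + g x * g x) + f x * g x * w))%C by ring.
  rewrite Hdet. ring.
Qed.

Lemma is_derive_quotient_over_id (N D : R -> R) (x N' D' : R) :
  is_derive N x N' -> is_derive D x D' -> D x <> 0 -> x <> 0 ->
  is_derive (fun y => N y * / D y / y) x
    ((N' * D x - N x * D') / D x ^ 2 / x - N x / D x / x ^ 2).
Proof.
  intros HN HD H0 Hx. evar_last.
  - apply @is_derive_mult.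
    + apply @is_derive_mult; [exact HN| |intros; apply Rmult_comm].
      apply is_derive_inv; [exact HD|exact H0].
    + apply is_derive_inv; [apply @is_derive_id|exact Hx].
    + intros; apply Rmult_comm.
  - unfold plus, mult, one; simpl. field. auto.
Qed.

(** * Independence of the two cylinder functions *)

(** For cylinder functions [(h0, h1)], the quantities [|h0|^2], [Re (h0 conj h1)] and
    [|h1|^2] solve this linear system.  Eliminating [S] and [T] leaves [P_(n+2) = -
    n^3 / (4 k^2 (n+1)) P_n], so the odd coefficients of a convergent solution vanish.
    *)
Lemma product_system_leading_zero (k : R) (P S T : nat -> R) (p s t : R -> R) :
  0 < k -> expands P p -> expands S s -> expands T t ->
  Rbar_locally p_infty (fun x => is_derive p x (- 2 * k * s x)) ->
  Rbar_locally p_infty (fun x => is_derive s x (k * p x - k * t x - s x / x)) ->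
  Rbar_locally p_infty (fun x => is_derive t x (2 * k * s x - 2 * (t x / x))) ->
  P 1%nat = 0.
Proof.
  intros Hk Hp Hs Ht Dp Ds Dt.
  assert (Hcoef : forall (c d : nat -> R) (f g : R -> R),
    expands c f -> expands d g ->
    Rbar_locally p_infty (fun x => is_derive f x (g x)) ->
    forall n, deriv_coef c n = d n).
  { intros c d f g Hf Hg Hd.
    destruct (expands_deriv _ _ Hf) as (f' & Hf' & Df').
    apply (expands_unique _ _ _ _ Hf' Hg).
    generalize (filter_and _ _ Hd Df'). apply filter_imp. intros x [H1 H2].
    apply is_derive_unique in H1. apply is_derive_unique in H2. congruence. }
  assert (Ep := Hcoef _ _ _ _ Hp (expands_scal (- 2 * k) _ _ Hs) Dp).
  assert (Es := Hcoef _ _ _ _ Hs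
    (expands_minus _ _ _ _
       (expands_minus _ _ _ _ (expands_scal k _ _ Hp) (expands_scal k _ _ Ht))
       (expands_shift _ _ Hs)) Ds).
  assert (Et := Hcoef _ _ _ _ Ht
    (expands_minus _ _ _ _ (expands_scal (2 * k) _ _ Hs)
       (expands_scal 2 _ _ (expands_shift _ _ Ht))) Dt).
  simpl in Ep, Es, Et.
  assert (Hrec : forall n, P (2 * (n + 1) + 1)%nat =
     - (INR (2 * n + 1) ^ 3 / (4 * k ^ 2 * INR (2 * n + 2))) * P (2 * n + 1)%nat).
  { intros n.
    replace (2 * (n + 1) + 1)%nat with (Datatypes.S (Datatypes.S (2 * n + 1))) by lia.
    replace (2 * n + 2)%nat with (Datatypes.S (2 * n + 1)) by lia.
    set (m := (2 * n + 1)%nat).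
    assert (Hm : 1 <= INR m) by (replace 1 with (INR 1) by reflexivity; apply le_INR; lia).
    assert (E1 := Ep (Datatypes.S m)). assert (E2 := Es (Datatypes.S (Datatypes.S m))).
    assert (E3 := Et (Datatypes.S (Datatypes.S (Datatypes.S m)))).
    assert (E4 := Ep (Datatypes.S (Datatypes.S (Datatypes.S m)))).
    cbn [deriv_coef PS_incr_1] in E1, E2, E3, E4.
    rewrite !S_INR in *.
    set (p0 := P m) in *. set (p2 := P (Datatypes.S (Datatypes.S m))) in *.
    set (s1 := S (Datatypes.S m)) in *.
    set (s3 := S (Datatypes.S (Datatypes.S (Datatypes.S m)))) in *.
    set (t2 := T (Datatypes.S (Datatypes.S m))) in *.
    set (q := INR m) in *.
    assert (F1 : s1 = q * p0 / (2 * k)).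
    { apply Rmult_eq_reg_l with (-2 * k); [|lra]. rewrite <- E1. field. lra. }
    assert (F3 : t2 = - (q + 2) / q * p2).
    { apply Rmult_eq_reg_l with q; [|lra].
      replace (q * (- (q + 2) / q * p2)) with (- (q + 2) * p2) by (field; lra).
      lra. }
    rewrite F1, F3 in E2.
    apply Rmult_eq_reg_l with (k * (1 + (q + 2) / q)).
    2:{ apply Rmult_integral_contrapositive_currified; [lra|].
        replace (1 + (q + 2) / q) with ((2 * q + 2) / q) by (field; lra).
        apply Rmult_integral_contrapositive_currified; [lra|].
        apply Rinv_neq_0_compat. lra. }
    replace (k * (1 + (q + 2) / q) * p2) with
      (- (q + 1) * (q * p0 / (2 * k)) + q * p0 / (2 * k)).
    2:{ rewrite E2. field. lra. }
    field. lra. }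
  change (P (2 * 0 + 1)%nat = 0).
  refine (superexponential_zero (fun n => P (2 * n + 1)%nat)
            (fun n => - (INR (2 * n + 1) ^ 3 / (4 * k ^ 2 * INR (2 * n + 2)))) _ _ _ _ 0%nat).
  - destruct Hp as [(K & M & HM & H) _].
    exists (K * M), (M ^ 2). split; [now apply pow_lt|]. intros n.
    apply Rle_trans with (1 := H _). right.
    rewrite pow_add, pow_mult. ring.
  - intros n. rewrite <- Hrec. f_equal. lia.
  - intros n. apply Ropp_neq_0_compat.
    assert (0 < INR (2 * n + 1)) by (apply lt_0_INR; lia).
    assert (0 < INR (2 * n + 2)) by (apply lt_0_INR; lia).
    assert (0 < INR (2 * n + 1) ^ 3) by now apply pow_lt.
    apply Rgt_not_eq. apply Rdiv_lt_0_compat; [assumption|].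
    apply Rmult_lt_0_compat; [|assumption]. nra.
  - intros B.
    destruct (INR_unbounded (B * (4 * k ^ 2))) as [n0 Hn0].
    exists n0. intros n Hn. apply le_INR in Hn.
    rewrite Rabs_Ropp.
    rewrite !plus_INR, !mult_INR. simpl INR.
    set (q := INR n) in *. assert (0 <= q) by apply pos_INR.
    rewrite Rabs_pos_eq.
    2:{ apply Rle_mult_inv_pos; [apply pow_le; lra|].
        apply Rmult_lt_0_compat; nra. }
    assert (0 < 4 * k ^ 2) by nra.
    apply Rle_trans with (q / (4 * k ^ 2)).
    + apply Rmult_le_reg_r with (4 * k ^ 2); [assumption|].
      unfold Rdiv. rewrite Rmult_assoc, Rinv_l by lra. lra.
    + apply Rmult_le_reg_r with (4 * k ^ 2 * ((1 + 1) * q + (1 + 1))).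
      { apply Rmult_lt_0_compat; lra. }
      replace (q / (4 * k ^ 2) * (4 * k ^ 2 * ((1 + 1) * q + (1 + 1))))
        with (q * (2 * q + 2)) by (field; lra).
      replace (((1 + 1) * q + 1) ^ 3 / (4 * k ^ 2 * ((1 + 1) * q + (1 + 1))) *
               (4 * k ^ 2 * ((1 + 1) * q + (1 + 1))))
        with ((2 * q + 1) ^ 3) by (field; split; lra).
      nra.
Qed.

(** If [b0] were nonzero, then [|g|^2 / (x D)], [- Re (f conj g) / (x D)] and [|f|^2 /
    (x D)] with [D = Im (f conj g)] would be a convergent solution of the preceding
    system in which [P_1 = |b0|^2 / D_0] is nonzero.  The numerators of the
    derivatives are the imaginary parts of the determinant [f g' - g f'] multiplied by
    [conj g ^ 2], [conj (f g)] and [conj f ^ 2]. *)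
Lemma determinant_leading_zero (k : R) (a b : nat -> C) (f g f' g' : R -> C) :
  0 < k -> cexpands a f -> cexpands b g ->
  Rbar_locally p_infty (fun x => is_cderive f x (f' x)) ->
  Rbar_locally p_infty (fun x => is_cderive g x (g' x)) ->
  Rbar_locally p_infty (fun x =>
    (f x * g' x - g x * f' x =
     RtoC k * (f x * f x + g x * g x) + f x * g x * RtoC (/ x))%C) ->
  a 0%nat = 0 /\ b 0%nat = 0.
Proof.
  intros Hk Hf Hg Df Dg Hdet.
  assert (Hpos : Rbar_locally p_infty (fun x => 0 < x)) by (exists 0; auto).
  set (a1 := fun n => Re (a n)). set (a2 := fun n => Im (a n)).
  set (b1 := fun n => Re (b n)). set (b2 := fun n => Im (b n)).
  set (f1 := fun x => Re (f x)). set (f2 := fun x => Im (f x)).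
  set (g1 := fun x => Re (g x)). set (g2 := fun x => Im (g x)).
  set (f1' := fun x => Re (f' x)). set (f2' := fun x => Im (f' x)).
  set (g1' := fun x => Re (g' x)). set (g2' := fun x => Im (g' x)).
  destruct Hf as [Hf1 Hf2]. destruct Hg as [Hg1 Hg2].
  fold a1 f1 in Hf1. fold a2 f2 in Hf2. fold b1 g1 in Hg1. fold b2 g2 in Hg2.
  assert (Hd : forall (c : nat -> R) (u u' : R -> R), expands c u ->
    Rbar_locally p_infty (fun x => is_derive u x (u' x)) ->
    expands (deriv_coef c) u').
  { intros c u u' Hu Du. destruct (expands_deriv _ _ Hu) as (v & Hv & Dv).
    apply expands_ext with (2 := Hv).
    generalize (filter_and _ _ Du Dv). apply filter_imp. intros x [H1 H2].
    apply is_derive_unique in H1. apply is_derive_unique in H2. congruence. }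
  assert (Df1 : Rbar_locally p_infty (fun x => is_derive f1 x (f1' x))).
  { revert Df. apply filter_imp. now intros x [H _]. }
  assert (Df2 : Rbar_locally p_infty (fun x => is_derive f2 x (f2' x))).
  { revert Df. apply filter_imp. now intros x [_ H]. }
  assert (Dg1 : Rbar_locally p_infty (fun x => is_derive g1 x (g1' x))).
  { revert Dg. apply filter_imp. now intros x [H _]. }
  assert (Dg2 : Rbar_locally p_infty (fun x => is_derive g2 x (g2' x))).
  { revert Dg. apply filter_imp. now intros x [_ H]. }
  assert (R1 : Rbar_locally p_infty (fun x =>
    f1 x * g1' x - f2 x * g2' x - (g1 x * f1' x - g2 x * f2' x) =
    k * (f1 x * f1 x - f2 x * f2 x + (g1 x * g1 x - g2 x * g2 x))
    + (f1 x * g1 x - f2 x * g2 x) / x)).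
  { revert Hdet. apply filter_imp. intros x H. apply (f_equal Re) in H.
    unfold f1, f2, g1, g2, f1', f2', g1', g2'.
    destruct (f x), (g x), (f' x), (g' x). unfold Re, Im in *. simpl in *.
    unfold Rdiv. lra. }
  assert (R2 : Rbar_locally p_infty (fun x =>
    f1 x * g2' x + f2 x * g1' x - (g1 x * f2' x + g2 x * f1' x) =
    k * (2 * (f1 x * f2 x) + 2 * (g1 x * g2 x))
    + (f1 x * g2 x + f2 x * g1 x) / x)).
  { revert Hdet. apply filter_imp. intros x H. apply (f_equal Im) in H.
    unfold f1, f2, g1, g2, f1', f2', g1', g2'.
    destruct (f x), (g x), (f' x), (g' x). unfold Re, Im in *. simpl in *.
    unfold Rdiv. lra. }
  assert (E1 := Hd _ _ _ Hf1 Df1). assert (E2 := Hd _ _ _ Hf2 Df2).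
  assert (E3 := Hd _ _ _ Hg1 Dg1). assert (E4 := Hd _ _ _ Hg2 Dg2).
  (* Derivatives and terms divided by [x] vanish at infinity, so only the quadratic
     terms contribute to the constant coefficients. *)
  assert (L1 : a1 0%nat * a1 0%nat - a2 0%nat * a2 0%nat
               + (b1 0%nat * b1 0%nat - b2 0%nat * b2 0%nat) = 0).
  { assert (H := expands_unique _ _ _ _
      (expands_minus _ _ _ _
        (expands_minus _ _ _ _ (expands_mult _ _ _ _ Hf1 E3) (expands_mult _ _ _ _ Hf2 E4))
        (expands_minus _ _ _ _ (expands_mult _ _ _ _ Hg1 E1) (expands_mult _ _ _ _ Hg2 E2)))
      (expands_plus _ _ _ _
        (expands_scal k _ _ (expands_plus _ _ _ _
          (expands_minus _ _ _ _ (expands_mult _ _ _ _ Hf1 Hf1) (expands_mult _ _ _ _ Hf2 Hf2))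
          (expands_minus _ _ _ _ (expands_mult _ _ _ _ Hg1 Hg1) (expands_mult _ _ _ _ Hg2 Hg2))))
        (expands_shift _ _
          (expands_minus _ _ _ _ (expands_mult _ _ _ _ Hf1 Hg1) (expands_mult _ _ _ _ Hf2 Hg2))))
      R1 0%nat).
    unfold PS_mult in H. simpl in H. unfold zero in H; simpl in H.
    apply Rmult_eq_reg_l with k; lra. }
  assert (L2 : a1 0%nat * a2 0%nat + b1 0%nat * b2 0%nat = 0).
  { assert (H := expands_unique _ _ _ _
      (expands_minus _ _ _ _
        (expands_plus _ _ _ _ (expands_mult _ _ _ _ Hf1 E4) (expands_mult _ _ _ _ Hf2 E3))
        (expands_plus _ _ _ _ (expands_mult _ _ _ _ Hg1 E2) (expands_mult _ _ _ _ Hg2 E1)))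
      (expands_plus _ _ _ _
        (expands_scal k _ _ (expands_plus _ _ _ _
          (expands_scal 2 _ _ (expands_mult _ _ _ _ Hf1 Hf2))
          (expands_scal 2 _ _ (expands_mult _ _ _ _ Hg1 Hg2))))
        (expands_shift _ _
          (expands_plus _ _ _ _ (expands_mult _ _ _ _ Hf1 Hg2) (expands_mult _ _ _ _ Hf2 Hg1))))
      R2 0%nat).
    unfold PS_mult in H. simpl in H. unfold zero in H; simpl in H.
    apply Rmult_eq_reg_l with k; lra. }
  set (N := fun x => g1 x * g1 x + g2 x * g2 x).
  set (M := fun x => f1 x * g1 x + f2 x * g2 x).
  set (Q := fun x => f1 x * f1 x + f2 x * f2 x).
  set (D := fun x => f2 x * g1 x - f1 x * g2 x).
  assert (HN : expands (fun n => PS_mult b1 b1 n + PS_mult b2 b2 n) N)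
    by now apply expands_plus; apply expands_mult.
  assert (HM : expands (fun n => PS_mult a1 b1 n + PS_mult a2 b2 n) M)
    by now apply expands_plus; apply expands_mult.
  assert (HQ : expands (fun n => PS_mult a1 a1 n + PS_mult a2 a2 n) Q)
    by now apply expands_plus; apply expands_mult.
  set (dc := fun n => PS_mult a2 b1 n - PS_mult a1 b2 n).
  assert (HD : expands dc D)
    by now apply expands_minus; apply expands_mult.
  assert (Hzero : b1 0%nat * b1 0%nat + b2 0%nat * b2 0%nat = 0).
  { apply Classical_Prop.NNPP. intros HN0.
    assert (HD0 : dc 0%nat <> 0).
    { unfold dc, PS_mult. simpl. intros HD0. apply HN0.
      set (x1 := a1 0%nat) in *. set (x2 := a2 0%nat) in *.
      set (y1 := b1 0%nat) in *. set (y2 := b2 0%nat) in *.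
      (* With [x1^2+x2^2 = y1^2+y2^2], Lagrange's identity reads
         [(y1^2+y2^2)^2 = D^2 + M^2], and here [M^2 = - (x1^2-y2^2)^2]. *)
      assert ((y1 * y1 + y2 * y2) ^ 2 <= 0); [|nra].
      assert (x1 * x1 + x2 * x2 = y1 * y1 + y2 * y2).
      { assert ((x1 * x1 + x2 * x2) ^ 2 = (y1 * y1 + y2 * y2) ^ 2).
        { replace ((x1 * x1 + x2 * x2) ^ 2) with
            ((x1 * x1 - x2 * x2) ^ 2 + 4 * (x1 * x2) ^ 2) by ring.
          replace (x1 * x1 - x2 * x2) with (- (y1 * y1 - y2 * y2)) by lra.
          replace (x1 * x2) with (- (y1 * y2)) by lra. ring. }
        nra. }
      assert (EM : (x1 * y1 + x2 * y2) ^ 2 = - (x1 * x1 - y2 * y2) ^ 2).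
      { assert (x2 * x2 - y1 * y1 = - (x1 * x1 - y2 * y2)) by lra.
        assert (x1 * x1 - y2 * y2 = x2 * x2 - y1 * y1) by lra.
        nra. }
      replace ((y1 * y1 + y2 * y2) ^ 2) with
        ((x1 * x1 + x2 * x2) * (y1 * y1 + y2 * y2)) by (rewrite H; ring).
      replace ((x1 * x1 + x2 * x2) * (y1 * y1 + y2 * y2)) with
        ((x2 * y1 - x1 * y2) ^ 2 + (x1 * y1 + x2 * y2) ^ 2) by ring.
      rewrite HD0, EM. nra. }
    assert (HDnz : Rbar_locally p_infty (fun x => D x <> 0)).
    { assert (HL := expands_lim _ _ HD). unfold is_lim in HL.
      apply (HL (fun y => y <> 0)). simpl.
      apply open_neq. exact HD0. }
    assert (HI := expands_inv _ _ HD0 HD).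
    assert (Hp := expands_shift _ _ (expands_mult _ _ _ _ HN HI)).
    assert (Hs := expands_scal (-1) _ _ (expands_shift _ _ (expands_mult _ _ _ _ HM HI))).
    assert (Ht := expands_shift _ _ (expands_mult _ _ _ _ HQ HI)).
    assert (DN : Rbar_locally p_infty (fun x =>
      is_derive N x (2 * (g1 x * g1' x + g2 x * g2' x)))).
    { generalize (filter_and _ _ Dg1 Dg2). apply filter_imp. intros x [d1 d2].
      evar_last.
      - apply @is_derive_plus;
          (apply @is_derive_mult; [eassumption|eassumption|intros; apply Rmult_comm]).
      - unfold plus, mult; simpl. ring. }
    assert (DQ : Rbar_locally p_infty (fun x =>
      is_derive Q x (2 * (f1 x * f1' x + f2 x * f2' x)))).
    { generalize (filter_and _ _ Df1 Df2). apply filter_imp. intros x [d1 d2].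
      evar_last.
      - apply @is_derive_plus;
          (apply @is_derive_mult; [eassumption|eassumption|intros; apply Rmult_comm]).
      - unfold plus, mult; simpl. ring. }
    assert (Dall := filter_and _ _ (filter_and _ _ Df1 Df2) (filter_and _ _ Dg1 Dg2)).
    assert (DM : Rbar_locally p_infty (fun x =>
      is_derive M x (f1' x * g1 x + f1 x * g1' x + (f2' x * g2 x + f2 x * g2' x)))).
    { revert Dall. apply filter_imp. intros x [[d1 d2] [d3 d4]].
      evar_last.
      - apply @is_derive_plus;
          (apply @is_derive_mult; [eassumption|eassumption|intros; apply Rmult_comm]).
      - unfold plus, mult; simpl. ring. }
    assert (DD : Rbar_locally p_infty (fun x =>
      is_derive D x (f2' x * g1 x + f2 x * g1' x - (f1' x * g2 x + f1 x * g2' x)))).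
    { revert Dall. apply filter_imp. intros x [[d1 d2] [d3 d4]].
      evar_last.
      - apply @is_derive_minus;
          (apply @is_derive_mult; [eassumption|eassumption|intros; apply Rmult_comm]).
      - unfold minus, plus, opp, mult; simpl. ring. }
    assert (Hall := filter_and _ _ (filter_and _ _ (filter_and _ _ Hpos HDnz) (filter_and _ _ R1 R2))
      (filter_and _ _ (filter_and _ _ DN DD) (filter_and _ _ DM DQ))).
    assert (H := product_system_leading_zero k _ _ _
      (fun x => N x * / D x / x) (fun x => -1 * (M x * / D x / x))
      (fun x => Q x * / D x / x) Hk Hp Hs Ht).
    assert (HP : (PS_mult b1 b1 0%nat + PS_mult b2 b2 0%nat) * recip dc 0%nat = 0).
    { change (PS_mult (fun n => PS_mult b1 b1 n + PS_mult b2 b2 n) (recip dc) 0%nat = 0).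
      apply H; revert Hall; apply filter_imp;
        intros x [[[Hx Hnz] [HR1 HR2]] [[dN dD] [dM dQ]]].
      - evar_last.
        + apply is_derive_quotient_over_id; [exact dN|exact dD|exact Hnz|lra].
        + replace (2 * (g1 x * g1' x + g2 x * g2' x) * D x -
            N x * (f2' x * g1 x + f2 x * g1' x - (f1' x * g2 x + f1 x * g2' x)))
          with ((g1 x * g1 x - g2 x * g2 x) *
                (f1 x * g2' x + f2 x * g1' x - (g1 x * f2' x + g2 x * f1' x))
                - 2 * g1 x * g2 x *
                (f1 x * g1' x - f2 x * g2' x - (g1 x * f1' x - g2 x * f2' x)))
            by (unfold N, D; ring).
          rewrite HR1, HR2. unfold N, M, D in *. field. lra.
      - evar_last.
        + apply (is_derive_scal (fun x => M x * / D x / x)).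
          apply is_derive_quotient_over_id; [exact dM|exact dD|exact Hnz|lra].
        + replace ((f1' x * g1 x + f1 x * g1' x + (f2' x * g2 x + f2 x * g2' x)) * D x -
            M x * (f2' x * g1 x + f2 x * g1' x - (f1' x * g2 x + f1 x * g2' x)))
          with ((f1 x * g1 x - f2 x * g2 x) *
                (f1 x * g2' x + f2 x * g1' x - (g1 x * f2' x + g2 x * f1' x))
                - (f1 x * g2 x + f2 x * g1 x) *
                (f1 x * g1' x - f2 x * g2' x - (g1 x * f1' x - g2 x * f2' x)))
            by (unfold M, D; ring).
          rewrite HR1, HR2. unfold scal; simpl; unfold mult; simpl.
          unfold N, M, Q, D in *. field. lra.
      - evar_last.
        + apply is_derive_quotient_over_id; [exact dQ|exact dD|exact Hnz|lra].
        + replace (2 * (f1 x * f1' x + f2 x * f2' x) * D x -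
            Q x * (f2' x * g1 x + f2 x * g1' x - (f1' x * g2 x + f1 x * g2' x)))
          with ((f1 x * f1 x - f2 x * f2 x) *
                (f1 x * g2' x + f2 x * g1' x - (g1 x * f2' x + g2 x * f1' x))
                - 2 * f1 x * f2 x *
                (f1 x * g1' x - f2 x * g2' x - (g1 x * f1' x - g2 x * f2' x)))
            by (unfold Q, D; ring).
          rewrite HR1, HR2. unfold N, M, Q, D in *. field. lra. }
    apply Rmult_integral in HP. destruct HP as [HP|HP].
    - now apply HN0.
    - revert HP. unfold recip. simpl. now apply Rinv_neq_0_compat. }
  destruct (Rplus_sqr_eq_0 _ _ Hzero) as [B1 B2].
  assert (A1 : a1 0%nat = 0 /\ a2 0%nat = 0).
  { rewrite B1, B2 in L1, L2.
    assert (E : a1 0%nat * a2 0%nat = 0) by lra.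
    apply Rmult_integral in E.
    destruct E as [E|E]; rewrite E in L1; split; try assumption;
      apply Rsqr_0_uniq; unfold Rsqr; lra. }
  destruct A1 as [A1 A2]. split; apply injective_projections; assumption.
Qed.

(** A common zero of the constant coefficients can be divided out, so the vanishing of
    the constant coefficients propagates to all others. *)
Lemma cylinder_independence (k : R) (h0 h1 : R -> C) (a b : nat -> C) (f g : R -> C) :
  0 < k -> cylinder_pair k h0 h1 -> cexpands a f -> cexpands b g ->
  Rbar_locally p_infty (fun x => (h0 x * f x + h1 x * g x = 0)%C) ->
  forall n, a n = 0 /\ b n = 0.
Proof.
  intros Hk Hcyl Hf Hg Hrel n. revert a b f g Hf Hg Hrel.
  assert (Hfirst : forall a b f g, cexpands a f -> cexpands b g ->
    Rbar_locally p_infty (fun x => (h0 x * f x + h1 x * g x = 0)%C) ->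
    a 0%nat = 0 /\ b 0%nat = 0).
  { intros a b f g Hf Hg Hrel.
    destruct (cexpands_deriv _ _ Hf) as (f' & _ & Df).
    destruct (cexpands_deriv _ _ Hg) as (g' & _ & Dg).
    apply (determinant_leading_zero k a b f g f' g'); try assumption.
    now apply cylinder_relation_determinant with h0 h1. }
  induction n as [|n IH]; intros a b f g Hf Hg Hrel; [now apply Hfirst with f g|].
  destruct (Hfirst a b f g Hf Hg Hrel) as [Ha Hb].
  apply (IH (fun n => a (S n)) (fun n => b (S n))
           (fun x => (RtoC x * f x)%C) (fun x => (RtoC x * g x)%C)).
  - destruct Hf as [H1 H2].
    apply expands_unshift in H1; [|now rewrite Ha].
    apply expands_unshift in H2; [|now rewrite Ha].
    split; [apply expands_ext with (2 := H1)|apply expands_ext with (2 := H2)];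
      exists 0; intros x _; unfold Re, Im; simpl; ring.
  - destruct Hg as [H1 H2].
    apply expands_unshift in H1; [|now rewrite Hb].
    apply expands_unshift in H2; [|now rewrite Hb].
    split; [apply expands_ext with (2 := H1)|apply expands_ext with (2 := H2)];
      exists 0; intros x _; unfold Re, Im; simpl; ring.
  - revert Hrel. apply filter_imp. intros x H.
    replace (h0 x * (RtoC x * f x) + h1 x * (RtoC x * g x))%C
      with (RtoC x * (h0 x * f x + h1 x * g x))%C by ring.
    rewrite H. ring.
Qed.

(** * The Hankel functions of orders 0 and 1 *)

(** After expansion of [cos (x sin t - t)], the integrals defining the Bessel
    functions of orders 0 and 1 become the moments below, on which differentiation in
    [x] acts by raising the exponent. *)
Definition cos_moment (n : nat) (x : R) : R :=
  RInt (fun t => cos (x * sin t) * sin t ^ n) 0 PI.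
Definition sin_moment (n : nat) (x : R) : R :=
  RInt (fun t => sin (x * sin t) * sin t ^ n) 0 PI.

Lemma continuity_2d_pt_of_prod (f : R -> R -> R) (x y : R) :
  continuous (fun p : R * R => f (fst p) (snd p)) (x, y) ->
  continuity_2d_pt f x y.
Proof. intros H. apply continuity_2d_pt_filterlim. exact H. Qed.

Lemma continuous_pow_comp {U : UniformSpace} (f : U -> R) (n : nat) (p : U) :
  continuous f p -> continuous (fun q => f q ^ n) p.
Proof.
  intros H. apply (continuous_comp f (fun y => y ^ n)); [exact H|].
  apply (ex_derive_continuous (V := R_NormedModule)). now auto_derive.
Qed.

Lemma continuous_derivable_comp {U : UniformSpace} (f : U -> R) (g : R -> R) (p : U) :
  continuous f p -> (forall y, ex_derive g y) -> continuous (fun q => g (f q)) p.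
Proof.
  intros H Hg. apply (continuous_comp f g); [exact H|].
  now apply (ex_derive_continuous (V := R_NormedModule)).
Qed.

Lemma is_derive_cos_moment (n : nat) (x : R) :
  is_derive (cos_moment n) x (- sin_moment (S n) x).
Proof.
  unfold cos_moment, sin_moment. evar_last.
  - apply (is_derive_RInt_param (fun u t => cos (u * sin t) * sin t ^ n)).
    + apply filter_forall. intros u t _. now auto_derive.
    + intros t _. apply continuity_2d_pt_ext with
        (fun u v => - (sin (u * sin v) * sin v ^ S n)).
      { intros u v. symmetry. apply is_derive_unique. auto_derive; [exact I|simpl; ring]. }
      apply continuity_2d_pt_of_prod.
      apply (continuous_opp (V := R_NormedModule)).
      apply (continuous_mult (K := R_AbsRing)).
      * apply (continuous_derivable_comp (fun q : R * R => fst q * sin (snd q)) sin);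
          [|intros; now auto_derive].
        apply (continuous_mult (K := R_AbsRing)); [apply continuous_fst|].
        apply (continuous_derivable_comp snd sin); [apply continuous_snd|intros; now auto_derive].
      * apply (continuous_pow_comp (fun q : R * R => sin (snd q))).
        apply (continuous_derivable_comp snd sin); [apply continuous_snd|intros; now auto_derive].
    + apply filter_forall. intros u. apply ex_RInt_of_derivable.
      intros t. now auto_derive.
  - rewrite <- (RInt_opp (V := R_CompleteNormedModule)).
    + apply RInt_ext. intros t _. apply is_derive_unique.
      auto_derive; [exact I|]. unfold opp; simpl. ring.
    + apply ex_RInt_of_derivable. intros t. now auto_derive.
Qed.

Lemma is_derive_sin_moment (n : nat) (x : R) :
  is_derive (sin_moment n) x (cos_moment (S n) x).
Proof.
  unfold cos_moment, sin_moment. evar_last.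
  - apply (is_derive_RInt_param (fun u t => sin (u * sin t) * sin t ^ n)).
    + apply filter_forall. intros u t _. now auto_derive.
    + intros t _. apply continuity_2d_pt_ext with
        (fun u v => cos (u * sin v) * sin v ^ S n).
      { intros u v. symmetry. apply is_derive_unique. auto_derive; [exact I|simpl; ring]. }
      apply continuity_2d_pt_of_prod.
      apply (continuous_mult (K := R_AbsRing)).
      * apply (continuous_derivable_comp (fun q : R * R => fst q * sin (snd q)) cos);
          [|intros; now auto_derive].
        apply (continuous_mult (K := R_AbsRing)); [apply continuous_fst|].
        apply (continuous_derivable_comp snd sin); [apply continuous_snd|intros; now auto_derive].
      * apply (continuous_pow_comp (fun q : R * R => sin (snd q))).
        apply (continuous_derivable_comp snd sin); [apply continuous_snd|intros; now auto_derive].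
    + apply filter_forall. intros u. apply ex_RInt_of_derivable.
      intros t. now auto_derive.
  - apply RInt_ext. intros t _. apply is_derive_unique.
    auto_derive; [exact I|]. simpl. ring.
Qed.

Lemma RInt_of_derivative (F f : R -> R) (a b : R) :
  (forall t, is_derive F t (f t)) -> (forall t, ex_derive f t) ->
  is_RInt f a b (F b - F a).
Proof.
  intros HF Hf. apply (is_RInt_derive (V := R_CompleteNormedModule)).
  - intros t _. apply HF.
  - intros t _. now apply (ex_derive_continuous (V := R_NormedModule)).
Qed.

(** The integrand of the difference is the derivative of [sin (x sin t) cos t]. *)
Lemma cos_moment_relation (x : R) :
  x * (cos_moment 0 x - cos_moment 2 x) = sin_moment 1 x.
Proof.
  assert (H : is_RInt (fun t => x * (cos (x * sin t) * sin t ^ 0)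
      - x * (cos (x * sin t) * sin t ^ 2) - sin (x * sin t) * sin t ^ 1) 0 PI 0).
  { replace 0 with (sin (x * sin PI) * cos PI - sin (x * sin 0) * cos 0) at 2
      by (rewrite sin_PI, sin_0, Rmult_0_r, sin_0; ring).
    apply (RInt_of_derivative (fun t => sin (x * sin t) * cos t)); intros t.
    - auto_derive; [exact I|].
      replace (sin t ^ 2) with (1 - Rsqr (cos t)) by (rewrite cos2; unfold Rsqr; ring).
      unfold Rsqr. ring.
    - now auto_derive. }
  apply (is_RInt_unique (V := R_CompleteNormedModule)) in H.
  unfold cos_moment, sin_moment.
  rewrite (RInt_minus (V := R_CompleteNormedModule)
    (fun t => x * (cos (x * sin t) * sin t ^ 0) - x * (cos (x * sin t) * sin t ^ 2))
    (fun t => sin (x * sin t) * sin t ^ 1)) in H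
    by (apply ex_RInt_of_derivable; intros t; now auto_derive).
  rewrite (RInt_minus (V := R_CompleteNormedModule)
    (fun t => x * (cos (x * sin t) * sin t ^ 0))
    (fun t => x * (cos (x * sin t) * sin t ^ 2))) in H
    by (apply ex_RInt_of_derivable; intros t; now auto_derive).
  rewrite (RInt_scal (V := R_CompleteNormedModule)
    (fun t => cos (x * sin t) * sin t ^ 0)) in H
    by (apply ex_RInt_of_derivable; intros t; now auto_derive).
  rewrite (RInt_scal (V := R_CompleteNormedModule)
    (fun t => cos (x * sin t) * sin t ^ 2)) in H
    by (apply ex_RInt_of_derivable; intros t; now auto_derive).
  unfold minus, plus, opp, scal in H; simpl in H; unfold mult in H; simpl in H.
  simpl. lra.
Qed.

(** The integrand of the difference is the derivative of [- cos (x sin t) cos t],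
    whose boundary values contribute the 2. *)
Lemma sin_moment_relation (x : R) :
  x * (sin_moment 0 x - sin_moment 2 x) = 2 - cos_moment 1 x.
Proof.
  assert (H : is_RInt (fun t => x * (sin (x * sin t) * sin t ^ 0)
      - x * (sin (x * sin t) * sin t ^ 2) + cos (x * sin t) * sin t ^ 1) 0 PI 2).
  { evar_last.
    - apply (RInt_of_derivative (fun t => - (cos (x * sin t) * cos t))); intros t.
      + auto_derive; [exact I|].
        replace (sin t ^ 2) with (1 - Rsqr (cos t)) by (rewrite cos2; unfold Rsqr; ring).
        unfold Rsqr. ring.
      + now auto_derive.
    - simpl. rewrite sin_PI, sin_0, Rmult_0_r, cos_0, cos_PI. ring. }
  apply (is_RInt_unique (V := R_CompleteNormedModule)) in H.
  unfold cos_moment, sin_moment.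
  rewrite (RInt_plus (V := R_CompleteNormedModule)
    (fun t => x * (sin (x * sin t) * sin t ^ 0) - x * (sin (x * sin t) * sin t ^ 2))
    (fun t => cos (x * sin t) * sin t ^ 1)) in H
    by (apply ex_RInt_of_derivable; intros t; now auto_derive).
  rewrite (RInt_minus (V := R_CompleteNormedModule)
    (fun t => x * (sin (x * sin t) * sin t ^ 0))
    (fun t => x * (sin (x * sin t) * sin t ^ 2))) in H
    by (apply ex_RInt_of_derivable; intros t; now auto_derive).
  rewrite (RInt_scal (V := R_CompleteNormedModule)
    (fun t => sin (x * sin t) * sin t ^ 0)) in H
    by (apply ex_RInt_of_derivable; intros t; now auto_derive).
  rewrite (RInt_scal (V := R_CompleteNormedModule)
    (fun t => sin (x * sin t) * sin t ^ 2)) in H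
    by (apply ex_RInt_of_derivable; intros t; now auto_derive).
  unfold minus, plus, opp, scal in H; simpl in H; unfold mult in H; simpl in H.
  simpl. lra.
Qed.

Lemma RInt_cos_sub (x : R) : 0 < x ->
  RInt (fun t => cos (x * sin t - INR 1 * t)) 0 PI = sin_moment 1 x.
Proof.
  intros Hx.
  apply (is_RInt_unique (V := R_CompleteNormedModule)).
  apply is_RInt_ext with
    (fun t => plus (cos (x * sin t) * cos t) (sin (x * sin t) * sin t ^ 1)).
  { intros t _. rewrite Rmult_1_l, cos_minus, pow_1. reflexivity. }
  replace (sin_moment 1 x) with (plus 0 (sin_moment 1 x)) by (unfold plus; simpl; ring).
  apply (is_RInt_plus (V := R_NormedModule)).
  - replace 0 with (sin (x * sin PI) / x - sin (x * sin 0) / x) at 2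
      by (rewrite sin_PI, sin_0; field; lra).
    apply (RInt_of_derivative (fun t => sin (x * sin t) / x)); intros t.
    + auto_derive; [exact I|field; lra].
    + now auto_derive.
  - apply (RInt_correct (V := R_CompleteNormedModule)).
    apply ex_RInt_of_derivable. intros t. now auto_derive.
Qed.

Lemma RInt_sin_sub (x : R) : 0 < x ->
  RInt (fun t => sin (x * sin t - INR 1 * t)) 0 PI = - cos_moment 1 x.
Proof.
  intros Hx.
  apply (is_RInt_unique (V := R_CompleteNormedModule)).
  apply is_RInt_ext with
    (fun t => minus (sin (x * sin t) * cos t) (cos (x * sin t) * sin t ^ 1)).
  { intros t _. rewrite Rmult_1_l, sin_minus, pow_1. reflexivity. }
  replace (- cos_moment 1 x) with (minus 0 (cos_moment 1 x))
    by (unfold minus, plus, opp; simpl; ring).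
  apply (is_RInt_minus (V := R_NormedModule)).
  - replace 0 with (- (cos (x * sin PI) / x) - - (cos (x * sin 0) / x)) at 2
      by (rewrite sin_PI, sin_0; field; lra).
    apply (RInt_of_derivative (fun t => - (cos (x * sin t) / x))); intros t.
    + auto_derive; [exact I|field; lra].
    + now auto_derive.
  - apply (RInt_correct (V := R_CompleteNormedModule)).
    apply ex_RInt_of_derivable. intros t. now auto_derive.
Qed.

Lemma RInt_cos_order0 (x : R) :
  RInt (fun t => cos (x * sin t - INR 0 * t)) 0 PI = cos_moment 0 x.
Proof.
  apply RInt_ext. intros t _. simpl. rewrite Rmult_0_l, Rminus_0_r. ring.
Qed.

Lemma RInt_sin_order0 (x : R) :
  RInt (fun t => sin (x * sin t - INR 0 * t)) 0 PI = sin_moment 0 x.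
Proof.
  apply RInt_ext. intros t _. simpl. rewrite Rmult_0_l, Rminus_0_r. ring.
Qed.

(** With [J0], [J1] the two moments up to the factor [1/PI], the derivative of [x^2
    (J0^2 + J1^2)] is [2 x J0^2], which is nonnegative and is positive near 0. *)
Lemma cos_moment_no_common_zero (x : R) :
  0 < x -> cos_moment 0 x <> 0 \/ sin_moment 1 x <> 0.
Proof.
  intros Hx0. apply Classical_Prop.NNPP. intros Hn.
  apply Classical_Prop.not_or_and in Hn. destruct Hn as [HC HS].
  apply Classical_Prop.NNPP in HC. apply Classical_Prop.NNPP in HS.
  set (g := fun y => y ^ 2 * (cos_moment 0 y ^ 2 + sin_moment 1 y ^ 2)).
  assert (Hg : forall y, is_derive g y (2 * y * cos_moment 0 y ^ 2)).
  { intros y. unfold g.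
    assert (D0 := is_derive_cos_moment 0 y). assert (D1 := is_derive_sin_moment 1 y).
    auto_derive.
    - repeat split; eexists; eassumption.
    - replace (Derive (fun x => cos_moment 0 x) y) with (- sin_moment 1 y)
        by (symmetry; now apply is_derive_unique).
      replace (Derive (fun x => sin_moment 1 x) y) with (cos_moment 2 y)
        by (symmetry; now apply is_derive_unique).
      assert (E := cos_moment_relation y).
      replace (2 * y * cos_moment 0 y ^ 2) with
        (2 * y * cos_moment 0 y ^ 2 + 2 * y * sin_moment 1 y *
          (sin_moment 1 y - y * (cos_moment 0 y - cos_moment 2 y))).
      + ring.
      + rewrite E. ring. }
  assert (Hmono : forall u v, 0 <= u <= v -> g u <= g v).
  { intros u v [Hu Huv].
    destruct (MVT_gen g u v (fun y => 2 * y * cos_moment 0 y ^ 2)) as (c & Hc & E).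
    - intros y _. apply Hg.
    - intros y _. apply continuity_pt_filterlim.
      apply (ex_derive_continuous (V := R_NormedModule)). eexists. apply Hg.
    - rewrite Rmin_left, Rmax_right in Hc by lra.
      assert (0 <= cos_moment 0 c ^ 2) by (simpl; nra).
      assert (0 <= 2 * c * cos_moment 0 c ^ 2) by (apply Rmult_le_pos; lra).
      nra. }
  assert (Hz : forall y, 0 < y <= x -> cos_moment 0 y = 0).
  { intros y Hy. assert (H1 := Hmono 0 y ltac:(lra)). assert (H2 := Hmono y x ltac:(lra)).
    unfold g in H1, H2 at 2. rewrite HC, HS in H2.
    assert (E : y ^ 2 * (cos_moment 0 y ^ 2 + sin_moment 1 y ^ 2) = 0).
    { unfold g in H2. lra. }
    apply Rmult_integral in E. destruct E as [E|E]; [|nra].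
    exfalso. assert (0 < y ^ 2) by (apply pow_lt; lra). lra. }
  assert (Hc : continuous (cos_moment 0) 0).
  { apply (ex_derive_continuous (V := R_NormedModule)).
    eexists. apply is_derive_cos_moment. }
  assert (H0 : cos_moment 0 0 = PI).
  { unfold cos_moment. rewrite (RInt_ext _ (fun _ => 1)).
    - rewrite (RInt_const (V := R_CompleteNormedModule)). unfold scal; simpl; unfold mult; simpl. ring.
    - intros t _. rewrite Rmult_0_l, cos_0. apply Rmult_1_r. }
  assert (Hp : locally 0 (fun y => 0 < cos_moment 0 y)).
  { apply (Hc (fun z => 0 < z)). rewrite H0. apply open_gt. apply PI_RGT_0. }
  destruct Hp as [d Hd].
  assert (Hm : 0 < Rmin (d / 2) x).
  { apply Rmin_glb_lt; [|exact Hx0]. generalize (cond_pos d). lra. }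
  specialize (Hd (Rmin (d / 2) x)).
  rewrite Hz in Hd.
  - apply (Rlt_irrefl 0), Hd.
    unfold ball; simpl; unfold AbsRing_ball, abs, minus, plus, opp; simpl.
    rewrite Ropp_0, Rplus_0_r, Rabs_pos_eq by lra.
    generalize (Rmin_l (d / 2) x) (cond_pos d). lra.
  - split; [exact Hm|apply Rmin_r].
Qed.

Definition sinh_moment (n : nat) (x : R) : R :=
  RInt_gen (fun t => sinh t ^ n * exp (- (x * sinh t)))
           (at_point 0) (Rbar_locally p_infty).

Lemma is_RInt_gen_of_lim (f : R -> R) (l : R) :
  (forall T, 0 <= T -> ex_RInt f 0 T) ->
  is_lim (fun T => RInt f 0 T) p_infty l ->
  is_RInt_gen f (at_point 0) (Rbar_locally p_infty) l.
Proof.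
  intros Hex Hlim P HP. specialize (Hlim P HP).
  destruct Hlim as [X HX].
  apply Filter_prod with (fun a => a = 0) (fun T => 0 <= T /\ X < T).
  - reflexivity.
  - exists (Rmax 0 X). intros T HT.
    generalize (Rmax_l 0 X) (Rmax_r 0 X). lra.
  - intros a T -> [HT HXT]. exists (RInt f 0 T). split.
    + apply (RInt_correct (V := R_CompleteNormedModule)). now apply Hex.
    + now apply HX.
Qed.

(** The integrals over [[0, T]] increase with [T] and are bounded through the
    antiderivative [G]; their supremum is the improper integral. *)
Lemma ex_RInt_gen_dominated (f g G : R -> R) :
  (forall t, ex_derive f t) -> (forall t, ex_derive g t) ->
  (forall t, is_derive G t (g t)) ->
  (forall t, 0 <= t -> 0 <= f t <= g t) ->
  (exists B, forall T, 0 <= T -> G T <= B) ->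
  exists l, is_RInt_gen f (at_point 0) (Rbar_locally p_infty) l.
Proof.
  intros Hf Hg HG Hfg [B HB].
  assert (Hbound : forall T, 0 <= T -> RInt f 0 T <= B - G 0).
  { intros T HT. apply Rle_trans with (RInt g 0 T).
    - apply RInt_le; [exact HT| | |].
      + now apply ex_RInt_of_derivable.
      + now apply ex_RInt_of_derivable.
      + intros t Ht. apply Hfg. lra.
    - rewrite (is_RInt_unique g 0 T _ (RInt_of_derivative G g 0 T HG Hg)).
      specialize (HB T HT). lra. }
  assert (Hmono : forall S T, 0 <= S <= T -> RInt f 0 S <= RInt f 0 T).
  { intros S T HST.
    rewrite <- (RInt_Chasles (V := R_CompleteNormedModule) f 0 S T);
      [|now apply ex_RInt_of_derivable|now apply ex_RInt_of_derivable].
    unfold plus; simpl.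
    assert (0 <= RInt f S T); [|lra].
    apply RInt_ge_0; [lra|now apply ex_RInt_of_derivable|].
    intros t Ht. apply Hfg. lra. }
  destruct (completeness (fun y => exists T, 0 <= T /\ y = RInt f 0 T)) as [l [Hub Hl]].
  - exists (B - G 0). intros y (T & HT & ->). now apply Hbound.
  - exists (RInt f 0 0), 0. split; [lra|reflexivity].
  - exists l. apply is_RInt_gen_of_lim.
    { intros T _. now apply ex_RInt_of_derivable. }
    intros P [eps HP].
    assert (Hex : exists T, 0 <= T /\ l - eps < RInt f 0 T).
    { apply Classical_Prop.NNPP. intros Hn.
      assert (l <= l - eps); [|generalize (cond_pos eps); lra].
      apply Hl. intros y (T & HT & ->).
      destruct (Rle_lt_dec (RInt f 0 T) (l - eps)) as [H|H]; [exact H|].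
      exfalso. apply Hn. now exists T. }
    destruct Hex as (T & HT & HlT).
    exists T. intros S HS. apply HP.
    unfold ball; simpl; unfold AbsRing_ball, abs, minus, plus, opp; simpl.
    assert (H1 := Hmono T S ltac:(lra)).
    assert (H2 : RInt f 0 S <= l) by (apply Hub; exists S; split; [lra|reflexivity]).
    apply Rabs_def1; lra.
Qed.

Lemma is_derive_sinh (t : R) : is_derive sinh t (cosh t).
Proof. apply is_derive_Reals, derivable_pt_lim_sinh. Qed.

Lemma is_derive_cosh (t : R) : is_derive cosh t (sinh t).
Proof. apply is_derive_Reals, derivable_pt_lim_cosh. Qed.

Lemma sinh_ge_id (t : R) : 0 <= t -> t <= sinh t.
Proof.
  intros Ht. destruct (MVT_gen sinh 0 t cosh) as (c & Hc & E).
  - intros y _. apply is_derive_sinh.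
  - intros y _. apply derivable_continuous_pt, derivable_pt_sinh.
  - rewrite sinh_0, !Rminus_0_r in E. rewrite E.
    assert (1 <= cosh c); [|nra].
    unfold cosh. assert (H1 := exp_ineq1_le c). assert (H2 := exp_ineq1_le (- c)). lra.
Qed.

(** The power of [sinh t] is absorbed by half of the exponential, and [t <= sinh t].
    *)
Lemma sinh_moment_integrand_bound (n : nat) (x : R) :
  0 < x -> exists B, 0 <= B /\ forall t, 0 <= t ->
    0 <= sinh t ^ n * exp (- (x * sinh t)) <= B * exp (- (x / 2 * t)).
Proof.
  intros Hx. set (c := x / (2 * (INR n + 1))).
  assert (Hn := pos_INR n).
  assert (Hc : 0 < c) by (apply Rdiv_lt_0_compat; lra).
  assert (Hcn : INR n * c <= x / 2).
  { unfold c. apply Rmult_le_reg_r with (2 * (INR n + 1)); [lra|].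
    replace (INR n * (x / (2 * (INR n + 1))) * (2 * (INR n + 1)))
      with (INR n * x) by (field; lra). nra. }
  exists ((/ c) ^ n). split.
  { apply pow_le. left. now apply Rinv_0_lt_compat. }
  intros t Ht. assert (Hs := sinh_ge_id t Ht).
  set (s := sinh t) in *. assert (Hs0 : 0 <= s) by lra.
  split.
  { apply Rmult_le_pos; [now apply pow_le|left; apply exp_pos]. }
  assert (Hpow : s ^ n <= (/ c) ^ n * exp (INR n * (c * s))).
  { assert (He : exp (INR n * (c * s)) = exp (c * s) ^ n).
    { generalize (c * s). clear. intros y.
      induction n as [|n IH]; [simpl; now rewrite Rmult_0_l, exp_0|].
      rewrite S_INR, Rmult_plus_distr_r, exp_plus, IH, Rmult_1_l. simpl. ring. }
    rewrite He, <- Rpow_mult_distr. apply pow_incr. split; [exact Hs0|].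
    assert (H := exp_ineq1_le (c * s)).
    apply Rmult_le_reg_l with c; [exact Hc|].
    rewrite <- Rmult_assoc, Rinv_r, Rmult_1_l by lra. lra. }
  apply Rle_trans with ((/ c) ^ n * exp (INR n * (c * s)) * exp (- (x * s))).
  { apply Rmult_le_compat_r; [left; apply exp_pos|exact Hpow]. }
  rewrite Rmult_assoc, <- exp_plus. apply Rmult_le_compat_l.
  { apply pow_le. left. now apply Rinv_0_lt_compat. }
  assert (Hle : INR n * (c * s) + - (x * s) <= - (x / 2 * t)).
  { replace (INR n * (c * s)) with (INR n * c * s) by ring.
    assert (INR n * c * s <= x / 2 * s) by (now apply Rmult_le_compat_r).
    assert (x / 2 * t <= x / 2 * s) by (apply Rmult_le_compat_l; lra). lra. }
  destruct Hle as [H|H]; [left; now apply exp_increasing|right; now rewrite H].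
Qed.

Lemma ex_derive_sinh_moment_integrand (n : nat) (x t : R) :
  ex_derive (fun t => sinh t ^ n * exp (- (x * sinh t))) t.
Proof.
  assert (ex_derive sinh t) by (eexists; apply is_derive_sinh).
  now auto_derive.
Qed.

Lemma is_RInt_gen_sinh_moment (n : nat) (x : R) :
  0 < x ->
  is_RInt_gen (fun t => sinh t ^ n * exp (- (x * sinh t)))
    (at_point 0) (Rbar_locally p_infty) (sinh_moment n x).
Proof.
  intros Hx. apply (RInt_gen_correct (V := R_CompleteNormedModule)).
  destruct (sinh_moment_integrand_bound n x Hx) as (B & HB & Hb).
  destruct (ex_RInt_gen_dominated
    (fun t => sinh t ^ n * exp (- (x * sinh t)))
    (fun t => B * exp (- (x / 2 * t)))
    (fun t => - (2 * B / x) * exp (- (x / 2 * t)))) as [l Hl].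
  - apply ex_derive_sinh_moment_integrand.
  - intros t. now auto_derive.
  - intros t. auto_derive; [exact I|]. field. lra.
  - exact Hb.
  - exists 0. intros T HT. assert (H := exp_pos (- (x / 2 * T))).
    assert (0 <= 2 * B / x) by (apply Rle_mult_inv_pos; lra). nra.
  - now exists l.
Qed.

Lemma exp_remainder (u : R) :
  Rabs (exp u - 1 - u) <= u ^ 2 * exp (Rabs u).
Proof.
  assert (H1 := exp_ineq1_le u). assert (H2 := exp_ineq1_le (- u)).
  assert (He := exp_pos u). assert (He' := exp_pos (- u)).
  assert (Hm : exp u * exp (- u) = 1) by (rewrite <- exp_plus, Rplus_opp_r; apply exp_0).
  rewrite Rabs_pos_eq by lra.
  destruct (Rle_lt_dec 0 u) as [Hu|Hu].
  - rewrite (Rabs_pos_eq u Hu).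
    assert (exp u - 1 <= u * exp u) by nra.
    assert (u * (exp u - 1) <= u * (u * exp u)) by (now apply Rmult_le_compat_l).
    nra.
  - rewrite (Rabs_left u Hu).
    assert (exp u - 1 - u <= - u * (1 - exp u)) by nra.
    assert (- u * (1 - exp u) <= - u * - u) by nra.
    assert (1 <= exp (- u)) by lra.
    nra.
Qed.

(** Turns one estimate of a Taylor remainder under the integral sign into
    differentiability of an improper integral. *)
Lemma is_derive_of_quadratic_remainder (f : R -> R) (x l B d : R) :
  0 < d ->
  (forall h, Rabs h <= d -> Rabs (f (x + h) - f x - l * h) <= B * h ^ 2) ->
  is_derive f x l.
Proof.
  intros Hd H. apply is_derive_Reals. intros eps Heps.
  assert (HB : 0 <= B).
  { specialize (H d). rewrite Rabs_pos_eq in H by lra. specialize (H (Rle_refl d)).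
    assert (H' := Rle_trans _ _ _ (Rabs_pos _) H).
    assert (0 < d ^ 2) by now apply pow_lt.
    destruct (Rle_lt_dec 0 B); [assumption|nra]. }
  assert (Hdel : 0 < Rmin d (eps / (B + 1))).
  { apply Rmin_glb_lt; [exact Hd|]. apply Rdiv_lt_0_compat; lra. }
  exists (mkposreal _ Hdel). intros h Hh0 Hh. simpl in Hh.
  assert (Hh1 : Rabs h <= d) by (generalize (Rmin_l d (eps / (B + 1))); lra).
  assert (Hh2 : Rabs h < eps / (B + 1)) by (generalize (Rmin_r d (eps / (B + 1))); lra).
  specialize (H h Hh1).
  assert (Hp : 0 < Rabs h) by now apply Rabs_pos_lt.
  replace ((f (x + h) - f x) / h - l) with ((f (x + h) - f x - l * h) / h)
    by (field; exact Hh0).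
  unfold Rdiv. rewrite Rabs_mult, Rabs_inv.
  apply Rle_lt_trans with (B * Rabs h).
  - apply Rmult_le_reg_r with (Rabs h); [exact Hp|].
    rewrite Rmult_assoc, Rinv_l, Rmult_1_r by lra.
    apply Rle_trans with (1 := H). rewrite <- (pow2_abs h). right. ring.
  - apply Rmult_lt_compat_r with (r := B + 1) in Hh2; [|lra].
    unfold Rdiv in Hh2. rewrite Rmult_assoc, Rinv_l, Rmult_1_r in Hh2 by lra. nra.
Qed.

(** The remainder of order 2 of [exp (- x s)] is at most [h^2 s^2 exp (- x s / 2)]
    when [|h| <= x / 2], which integrates to a multiple of [h^2]. *)
Lemma is_derive_sinh_moment (n : nat) (x : R) :
  0 < x -> is_derive (sinh_moment n) x (- sinh_moment (S n) x).
Proof.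
  intros Hx.
  apply (is_derive_of_quadratic_remainder _ _ _ (sinh_moment (S (S n)) (x / 2)) (x / 2));
    [lra|].
  intros h Hh. apply Rabs_le_between in Hh.
  assert (I1 := is_RInt_gen_sinh_moment n (x + h) ltac:(lra)).
  assert (I2 := is_RInt_gen_sinh_moment n x Hx).
  assert (I3 := is_RInt_gen_sinh_moment (S n) x Hx).
  assert (I4 := is_RInt_gen_sinh_moment (S (S n)) (x / 2) ltac:(lra)).
  assert (L := is_RInt_gen_plus _ _ _ _
                 (is_RInt_gen_minus _ _ _ _ I1 I2) (is_RInt_gen_scal _ h _ I3)).
  assert (G := is_RInt_gen_scal _ (h ^ 2) _ I4).
  replace (sinh_moment n (x + h) - sinh_moment n x - - sinh_moment (S n) x * h)
    with (plus (minus (sinh_moment n (x + h)) (sinh_moment n x))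
               (scal h (sinh_moment (S n) x)))
    by (unfold plus, minus, scal, opp, plus; simpl; unfold mult; simpl; ring).
  replace (sinh_moment (S (S n)) (x / 2) * h ^ 2)
    with (scal (h ^ 2) (sinh_moment (S (S n)) (x / 2)))
    by (unfold scal; simpl; unfold mult; simpl; ring).
  apply (RInt_gen_norm (V := R_CompleteNormedModule)
    (Fa := at_point 0) (Fb := Rbar_locally p_infty)) with (3 := L) (4 := G).
  - apply Filter_prod with (fun a => a = 0) (fun T => 0 < T); [reflexivity|now exists 0|].
    intros a T -> HT. simpl. lra.
  - apply Filter_prod with (fun a => a = 0) (fun T => 0 < T); [reflexivity|now exists 0|].
    intros a T -> _ t [Ht _]. simpl in Ht.
    assert (Hs := sinh_ge_id t Ht).
    unfold plus, minus, scal, opp, plus, norm; simpl; unfold mult, abs; simpl.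
    set (s := sinh t) in *.
    replace (s ^ n * exp (- ((x + h) * s)) + - (s ^ n * exp (- (x * s)))
             + h * (s * s ^ n * exp (- (x * s))))
      with (s ^ n * exp (- (x * s)) * (exp (- (h * s)) - 1 - - (h * s))).
    2:{ replace (- ((x + h) * s)) with (- (x * s) + - (h * s)) by ring.
        rewrite exp_plus. ring. }
    rewrite Rabs_mult, Rabs_pos_eq.
    2:{ apply Rmult_le_pos; [apply pow_le; lra|left; apply exp_pos]. }
    apply Rle_trans with (s ^ n * exp (- (x * s)) * ((- (h * s)) ^ 2 * exp (Rabs (- (h * s))))).
    { apply Rmult_le_compat_l; [|apply exp_remainder].
      apply Rmult_le_pos; [apply pow_le; lra|left; apply exp_pos]. }
    replace (s ^ n * exp (- (x * s)) * ((- (h * s)) ^ 2 * exp (Rabs (- (h * s)))))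
      with (h * (h * 1) * (s * (s * s ^ n) * exp (- (x * s) + Rabs (- (h * s)))))
      by (rewrite exp_plus; ring).
    apply Rmult_le_compat_l; [nra|].
    apply Rmult_le_compat_l.
    { apply Rmult_le_pos; [lra|]. apply Rmult_le_pos; [lra|]. apply pow_le. lra. }
    assert (Hle : - (x * s) + Rabs (- (h * s)) <= - (x / 2 * s)).
    { rewrite Rabs_Ropp, Rabs_mult, (Rabs_pos_eq s) by lra.
      assert (Rabs h <= x / 2) by (apply Rabs_le; lra). nra. }
    destruct Hle as [Hl|Hl]; [left; now apply exp_increasing|right; now rewrite Hl].
Qed.

Lemma is_lim_exp_decay (B c : R) : 0 < c ->
  is_lim (fun T => B * exp (- (c * T))) p_infty 0.
Proof.
  intros Hc.
  replace (Finite 0) with (Rbar_mult B 0) by (simpl; f_equal; ring).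
  apply is_lim_scal_l.
  apply (is_lim_comp exp (fun T => - (c * T)) p_infty 0 m_infty).
  - apply is_lim_exp_m.
  - replace m_infty with (Rbar_mult (- c) p_infty).
    + apply is_lim_ext with (fun T => - c * T); [intros; ring|].
      apply is_lim_scal_l, is_lim_id.
    + simpl. destruct (Rle_dec 0 (- c)) as [H|H]; [exfalso; lra|reflexivity].
  - exists 0. discriminate.
Qed.

(** The integrand of the difference is the derivative of [- cosh t exp (- x sinh t)],
    which runs from -1 to 0. *)
Lemma sinh_moment_relation (x : R) :
  0 < x -> x * (sinh_moment 0 x + sinh_moment 2 x) = 1 + sinh_moment 1 x.
Proof.
  intros Hx.
  assert (I0 := is_RInt_gen_sinh_moment 0 x Hx).
  assert (I1 := is_RInt_gen_sinh_moment 1 x Hx).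
  assert (I2 := is_RInt_gen_sinh_moment 2 x Hx).
  assert (L := is_RInt_gen_minus _ _ _ _
                 (is_RInt_gen_scal _ x _ (is_RInt_gen_plus _ _ _ _ I0 I2)) I1).
  set (w := fun t => minus (scal x (plus (sinh t ^ 0 * exp (- (x * sinh t)))
              (sinh t ^ 2 * exp (- (x * sinh t))))) (sinh t ^ 1 * exp (- (x * sinh t)))).
  assert (Hw : is_RInt_gen w (at_point 0) (Rbar_locally p_infty) 1).
  { assert (HI : forall T, is_RInt w 0 T (1 - cosh T * exp (- (x * sinh T)))).
    { intros T. evar_last.
      - apply (RInt_of_derivative (fun t => - (cosh t * exp (- (x * sinh t))))).
        + intros t.
          assert (Ds := is_derive_sinh t). assert (Dc := is_derive_cosh t).
          auto_derive.
          * repeat split; eexists; eassumption.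
          * replace (Derive (fun x => sinh x) t) with (cosh t)
              by (symmetry; now apply is_derive_unique).
            replace (Derive (fun x => cosh x) t) with (sinh t)
              by (symmetry; now apply is_derive_unique).
            unfold w, minus, plus, opp, scal, mult; simpl. unfold mult; simpl.
            assert (E : cosh t * cosh t = 1 + sinh t * sinh t).
            { unfold cosh, sinh.
              replace 1 with (exp t * exp (- t))
                by (rewrite <- exp_plus, Rplus_opp_r; apply exp_0).
              field. }
            replace (sinh t * (sinh t * 1)) with (cosh t * cosh t - 1) by lra. ring.
        + intros t. assert (ex_derive sinh t) by (eexists; apply is_derive_sinh).
          unfold w, minus, plus, opp, scal, mult; simpl. unfold mult; simpl.
          now auto_derive.
      - simpl. rewrite cosh_0, sinh_0, Rmult_0_r, Ropp_0, exp_0. ring. }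
    apply is_RInt_gen_of_lim.
    - intros T _. eexists. apply HI.
    - apply is_lim_ext with (fun T => 1 - cosh T * exp (- (x * sinh T))).
      { intros T. symmetry. apply is_RInt_unique, HI. }
      replace (Finite 1) with (Rbar_minus 1 0) by (simpl; f_equal; ring).
      apply is_lim_minus' ; [apply is_lim_const|].
      destruct (sinh_moment_integrand_bound 0 x Hx) as (B0 & HB0 & H0).
      destruct (sinh_moment_integrand_bound 1 x Hx) as (B1 & HB1 & H1).
      apply (is_lim_le_le_loc (fun _ => 0) (fun T => (B0 + B1) * exp (- (x / 2 * T)))).
      + exists 0. intros T HT.
        assert (Hch : 0 <= cosh T <= 1 + sinh T).
        { unfold cosh, sinh. assert (P1 := exp_pos T). assert (P2 := exp_pos (- T)).
          assert (exp (- T) <= 1).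
          { rewrite <- exp_0. left. apply exp_increasing. lra. }
          lra. }
        specialize (H0 T ltac:(lra)). specialize (H1 T ltac:(lra)). simpl in H0, H1.
        assert (P := exp_pos (- (x * sinh T))).
        split; [apply Rmult_le_pos; lra|]. nra.
      + apply is_lim_const.
      + apply is_lim_exp_decay. lra. }
  assert (U1 := is_RInt_gen_unique _ _ L).
  assert (U2 := is_RInt_gen_unique _ _ Hw).
  assert (E := eq_trans (eq_sym U1) U2). clear U1 U2. rename E into U2.
  unfold minus, plus, opp, scal in U2; simpl in U2; unfold mult in U2; simpl in U2.
  lra.
Qed.

Lemma bessel_J_0_eq (x : R) : bessel_J 0 x = / PI * cos_moment 0 x.
Proof. unfold bessel_J. now rewrite RInt_cos_order0. Qed.

Lemma bessel_J_1_eq (x : R) : 0 < x -> bessel_J 1 x = / PI * sin_moment 1 x.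
Proof. intros Hx. unfold bessel_J. now rewrite RInt_cos_sub. Qed.

Lemma bessel_Y_0_eq (x : R) :
  0 < x -> bessel_Y 0 x = / PI * (sin_moment 0 x - 2 * sinh_moment 0 x).
Proof.
  intros Hx. unfold bessel_Y. rewrite RInt_sin_order0.
  assert (H := is_RInt_gen_scal _ 2 _ (is_RInt_gen_sinh_moment 0 x Hx)).
  rewrite (is_RInt_gen_unique _ (2 * sinh_moment 0 x)); [ring|].
  refine (is_RInt_gen_ext (V := R_NormedModule) (fun t => scal 2 (sinh t ^ 0 * exp (- (x * sinh t)))) _ _ _ H).
  apply filter_forall. intros ab t _.
  unfold scal; simpl; unfold mult; simpl. rewrite Rmult_0_l, Ropp_0, exp_0. ring.
Qed.

Lemma bessel_Y_1_eq (x : R) :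
  0 < x -> bessel_Y 1 x = / PI * (- cos_moment 1 x - 2 * sinh_moment 1 x).
Proof.
  intros Hx. unfold bessel_Y. rewrite RInt_sin_sub by exact Hx.
  assert (H := is_RInt_gen_scal _ 2 _ (is_RInt_gen_sinh_moment 1 x Hx)).
  rewrite (is_RInt_gen_unique _ (2 * sinh_moment 1 x)); [ring|].
  refine (is_RInt_gen_ext (V := R_NormedModule) (fun t => scal 2 (sinh t ^ 1 * exp (- (x * sinh t)))) _ _ _ H).
  apply filter_forall. intros ab t _.
  unfold scal; simpl; unfold mult; simpl. unfold sinh at 1. rewrite !Rmult_1_l. field.
Qed.

Lemma is_derive_ext_pos (f g : R -> R) (x l : R) :
  0 < x -> (forall y, 0 < y -> f y = g y) -> is_derive f x l -> is_derive g x l.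
Proof.
  intros Hx He. apply is_derive_ext_loc.
  generalize (open_gt 0 x Hx). apply filter_imp. exact He.
Qed.

(** In the derivative of [Y1] the boundary terms of [sin_moment_relation] and of
    [sinh_moment_relation], the latter entering twice, cancel. *)
Lemma hankel_derivatives (x : R) : 0 < x ->
  is_derive (bessel_J 0) x (- bessel_J 1 x) /\
  is_derive (bessel_J 1) x (bessel_J 0 x - bessel_J 1 x / x) /\
  is_derive (bessel_Y 0) x (- bessel_Y 1 x) /\
  is_derive (bessel_Y 1) x (bessel_Y 0 x - bessel_Y 1 x / x).
Proof.
  intros Hx. assert (HPI := PI_neq0).
  assert (Rc := cos_moment_relation x). assert (Rs := sin_moment_relation x).
  assert (Rh := sinh_moment_relation x Hx).
  rewrite bessel_J_0_eq, bessel_J_1_eq, bessel_Y_0_eq, bessel_Y_1_eq by exact Hx.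
  split; [|split; [|split]].
  - apply is_derive_ext with (fun y => / PI * cos_moment 0 y).
    { intros y. now rewrite bessel_J_0_eq. }
    evar_last; [apply is_derive_scal, is_derive_cos_moment|ring].
  - apply is_derive_ext_pos with (fun y => / PI * sin_moment 1 y); [exact Hx| |].
    { intros y Hy. now rewrite bessel_J_1_eq. }
    evar_last; [apply is_derive_scal, is_derive_sin_moment|].
    rewrite <- Rc. field. split; (exact HPI || lra).
  - apply is_derive_ext_pos with
      (fun y => / PI * (sin_moment 0 y - 2 * sinh_moment 0 y)); [exact Hx| |].
    { intros y Hy. now rewrite bessel_Y_0_eq. }
    evar_last.
    + apply is_derive_scal. apply @is_derive_minus; [apply is_derive_sin_moment|].
      apply is_derive_scal. now apply is_derive_sinh_moment.
    + unfold minus, plus, opp; simpl. ring.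
  - apply is_derive_ext_pos with
      (fun y => / PI * (- cos_moment 1 y - 2 * sinh_moment 1 y)); [exact Hx| |].
    { intros y Hy. now rewrite bessel_Y_1_eq. }
    evar_last.
    + apply is_derive_scal. apply @is_derive_minus.
      * apply @is_derive_opp. apply is_derive_cos_moment.
      * apply is_derive_scal. now apply is_derive_sinh_moment.
    + unfold minus, plus, opp; simpl.
      replace (sin_moment 2 x) with (sin_moment 0 x - (2 - cos_moment 1 x) / x)
        by (rewrite <- Rs; field; lra).
      replace (sinh_moment 2 x) with ((1 + sinh_moment 1 x) / x - sinh_moment 0 x)
        by (rewrite <- Rh; field; lra).
      field. split; (exact HPI || lra).
Qed.

(** A common zero of the two Hankel functions would be one of their real parts. *)
Lemma hankel_cylinder_pair (k : R) :
  0 < k ->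
  cylinder_pair k (fun r => hankel1 0 (k * r)) (fun r => hankel1 1 (k * r)).
Proof.
  intros Hk r Hr. assert (Hx : 0 < k * r) by now apply Rmult_lt_0_compat.
  destruct (hankel_derivatives _ Hx) as (D1 & D2 & D3 & D4).
  assert (Hcomp : forall (f : R -> R) l,
    is_derive f (k * r) l -> is_derive (fun y => f (k * y)) r (k * l)).
  { intros f l Hf. evar_last.
    - apply (is_derive_comp f (fun y => k * y)); [exact Hf|].
      apply is_derive_scal, @is_derive_id.
    - unfold scal, one; simpl; unfold mult; simpl. ring. }
  assert (Hdiv : (hankel1 1 (k * r) / RtoC r)%C
                 = (bessel_J 1 (k * r) / r, bessel_Y 1 (k * r) / r)).
  { unfold hankel1, Cdiv. rewrite <- RtoC_inv by lra.
    unfold Cmult, RtoC; simpl. f_equal; field; lra. }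
  split; [split|split; [split|]].
  - evar_last; [apply Hcomp, D1|]. simpl. ring.
  - evar_last; [apply Hcomp, D3|]. simpl. ring.
  - rewrite Hdiv. evar_last; [apply Hcomp, D2|]. simpl. field. lra.
  - rewrite Hdiv. evar_last; [apply Hcomp, D4|]. simpl. field. lra.
  - assert (HPI : / PI <> 0) by (apply Rinv_neq_0_compat, PI_neq0).
    destruct (cos_moment_no_common_zero _ Hx) as [H|H]; [left|right];
      intros E; injection E; intros _ E1.
    + rewrite bessel_J_0_eq in E1. apply Rmult_integral in E1. now destruct E1.
    + rewrite bessel_J_1_eq in E1 by exact Hx. apply Rmult_integral in E1. now destruct E1.
Qed.

(** * Limits of coefficients along filters *)

Lemma ultrafilter_extension {T : Type} (F : (T -> Prop) -> Prop) :
  ProperFilter F ->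
  exists G : (T -> Prop) -> Prop,
    ProperFilter G /\ (forall P, F P -> G P) /\
    (forall P, G P \/ G (fun x => ~ P x)).
Proof.
  intros [Hex [Htrue Hand Himp]].
  assert (HF : filter.ProperFilter F).
  { constructor.
    - intros H. destruct (Hex _ H) as [x Hx]. exact Hx.
    - constructor; [exact Htrue|exact Hand|exact Himp]. }
  destruct (@filter.ultraFilterLemma T F HF) as (G & HG & Hsub).
  exists G. assert (HGU := HG). destruct HG as [[Hne [Ht Hi Hs]] _].
  split; [|split].
  - constructor.
    + intros P HP. apply Classical_Prop.NNPP. intros Hn. apply Hne.
      apply Hs with (2 := HP). intros x Hx. apply Hn. now exists x.
    + constructor; [exact Ht|exact Hi|exact Hs].
  - exact Hsub.
  - intros P. exact (filter.in_ultra_setVsetC P HGU).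
Qed.

Definition Cconverges {T : Type} (F : (T -> Prop) -> Prop) (u : T -> C) (l : C) : Prop :=
  forall eps, 0 < eps -> F (fun x => Cmod (u x - l) < eps).

(** The limit is the supremum of the lower bounds that [u] has along [G]. *)
Lemma ultrafilter_limit_R {T : Type} (G : (T -> Prop) -> Prop) (u : T -> R) (B : R) :
  ProperFilter G -> (forall P, G P \/ G (fun x => ~ P x)) ->
  (forall x, Rabs (u x) <= B) ->
  exists l, Rabs l <= B /\ forall eps, 0 < eps -> G (fun x => Rabs (u x - l) < eps).
Proof.
  intros HG Hultra Hu.
  destruct (completeness (fun y => G (fun x => y <= u x))) as [l [Hub Hlub]].
  - exists B. intros y Hy. destruct (filter_ex _ Hy) as [x Hx].
    specialize (Hu x). apply Rabs_le_between in Hu. lra.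
  - exists (- B). apply filter_forall. intros x.
    specialize (Hu x). apply Rabs_le_between in Hu. lra.
  - assert (H1 : - B <= l).
    { apply Hub. apply filter_forall. intros x.
      specialize (Hu x). apply Rabs_le_between in Hu. lra. }
    assert (H2 : l <= B).
    { apply Hlub. intros y Hy. destruct (filter_ex _ Hy) as [x Hx].
      specialize (Hu x). apply Rabs_le_between in Hu. lra. }
    exists l. split; [apply Rabs_le; lra|].
    intros eps Heps.
    assert (Hlow : G (fun x => l - eps < u x)).
    { destruct (Hultra (fun x => l - eps < u x)) as [H|H]; [exact H|exfalso].
      assert (l <= l - eps); [|lra].
      apply Hlub. intros y Hy. destruct (filter_ex _ (filter_and _ _ H Hy)) as [x Hx].
      lra. }
    assert (Hup : G (fun x => u x < l + eps)).
    { destruct (Hultra (fun x => u x < l + eps)) as [H|H]; [exact H|exfalso].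
      assert (l + eps <= l); [|lra].
      apply Hub. revert H. apply filter_imp. intros x Hx. lra. }
    generalize (filter_and _ _ Hlow Hup). apply filter_imp. intros x Hx.
    apply Rabs_def1; lra.
Qed.

Lemma Cmod_le_sum (z : C) : Cmod z <= Rabs (Re z) + Rabs (Im z).
Proof.
  unfold Cmod. apply Rsqr_incr_0_var.
  - rewrite Rsqr_sqrt by nra. unfold Rsqr.
    assert (H1 := Rabs_pos (fst z)). assert (H2 := Rabs_pos (snd z)).
    rewrite <- (pow2_abs (fst z)), <- (pow2_abs (snd z)). unfold Re, Im. nra.
  - apply Rplus_le_le_0_compat; apply Rabs_pos.
Qed.

Lemma Rabs_Im_le (z : C) : Rabs (Im z) <= Cmod z.
Proof. apply Rle_trans with (2 := Rmax_Cmod z). apply Rmax_r. Qed.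

Lemma ultrafilter_limit {T : Type} (G : (T -> Prop) -> Prop) (u : T -> C) (B : R) :
  ProperFilter G -> (forall P, G P \/ G (fun x => ~ P x)) ->
  (forall x, Cmod (u x) <= B) ->
  exists l, Cmod l <= 2 * B /\ Cconverges G u l.
Proof.
  intros HG Hultra Hu.
  destruct (ultrafilter_limit_R G (fun x => Re (u x)) B HG Hultra) as (l1 & B1 & H1).
  { intros x. apply Rle_trans with (2 := Hu x). apply re_le_Cmod. }
  destruct (ultrafilter_limit_R G (fun x => Im (u x)) B HG Hultra) as (l2 & B2 & H2).
  { intros x. apply Rle_trans with (2 := Hu x). apply Rabs_Im_le. }
  exists (l1, l2). split.
  - apply Rle_trans with (1 := Cmod_le_sum _). unfold Re, Im. cbn [fst snd]. lra.
  - intros eps Heps.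
    assert (Heps2 : 0 < eps / 2) by lra.
    generalize (filter_and _ _ (H1 _ Heps2) (H2 _ Heps2)).
    apply filter_imp. intros x [E1 E2].
    apply Rle_lt_trans with (1 := Cmod_le_sum _).
    unfold Re, Im, Cminus, Cplus, Copp, Rminus in *. cbn [fst snd] in *. lra.
Qed.

Section Convergence.

Context {T : Type} (F : (T -> Prop) -> Prop) {HF : ProperFilter F}.

Lemma Cconverges_unique (u : T -> C) (l l' : C) :
  Cconverges F u l -> Cconverges F u l' -> l = l'.
Proof.
  intros H1 H2. destruct (Ceq_dec l l') as [e|e]; [exact e|exfalso].
  assert (Hd : 0 < Cmod (l - l')).
  { apply Cmod_gt_0. intros E. apply e.
    replace l with (l - l' + l')%C by ring. rewrite E. ring. }
  assert (Hd2 : 0 < Cmod (l - l') / 2) by lra.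
  destruct (filter_ex _ (filter_and _ _ (H1 _ Hd2) (H2 _ Hd2))) as [x [E1 E2]].
  assert (E3 := Cmod_triangle (u x - l') (- (u x - l))).
  rewrite Cmod_opp in E3.
  replace (u x - l' + - (u x - l))%C with (l - l')%C in E3 by ring. lra.
Qed.

Lemma Cconverges_plus (u v : T -> C) (l m : C) :
  Cconverges F u l -> Cconverges F v m ->
  Cconverges F (fun x => u x + v x)%C (l + m)%C.
Proof.
  intros H1 H2 eps Heps.
  assert (Heps2 : 0 < eps / 2) by lra.
  generalize (filter_and _ _ (H1 _ Heps2) (H2 _ Heps2)).
  apply filter_imp. intros x [E1 E2].
  replace (u x + v x - (l + m))%C with ((u x - l) + (v x - m))%C by ring.
  apply Rle_lt_trans with (1 := Cmod_triangle _ _). lra.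
Qed.

Lemma Cconverges_scal (k : C) (u : T -> C) (l : C) :
  Cconverges F u l -> Cconverges F (fun x => k * u x)%C (k * l)%C.
Proof.
  intros H eps Heps. assert (Hk := Cmod_ge_0 k).
  generalize (H (eps / (Cmod k + 1)) ltac:(apply Rdiv_lt_0_compat; lra)).
  apply filter_imp. intros x E.
  replace (k * u x - k * l)%C with (k * (u x - l))%C by ring.
  rewrite Cmod_mult.
  assert (H0 := Cmod_ge_0 (u x - l)).
  apply Rmult_lt_compat_r with (r := Cmod k + 1) in E; [|lra].
  unfold Rdiv in E. rewrite Rmult_assoc, Rinv_l, Rmult_1_r in E by lra. nra.
Qed.

Lemma Cconverges_sum_n (u : nat -> T -> C) (l : nat -> C) (n : nat) :
  (forall j, Cconverges F (u j) (l j)) ->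
  Cconverges F (fun x => sum_n (fun j => u j x) n) (sum_n l n).
Proof.
  intros H. induction n as [|n IH].
  - rewrite sum_O. intros eps Heps. generalize (H 0%nat eps Heps).
    apply filter_imp. intros x. now rewrite sum_O.
  - rewrite sum_Sn. intros eps Heps.
    generalize (Cconverges_plus _ _ _ _ IH (H (S n)) eps Heps).
    apply filter_imp. intros x. now rewrite sum_Sn.
Qed.

End Convergence.

Definition inv_series (c : nat -> C) (r : R) : C :=
  (PSeries (fun j => Re (c j)) (/ r), PSeries (fun j => Im (c j)) (/ r)).

(** For [2 M <= r] the terms are dominated by a geometric series of ratio 1/2. *)
Lemma PSeries_tail (c : nat -> R) (K M r : R) (n : nat) :
  0 < M -> 2 * M <= r -> (forall j, Rabs (c j) <= K * M ^ j) ->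
  Rabs (PSeries c (/ r) - sum_f_R0 (fun j => c j * (/ r) ^ j) n) <= K * (1 / 2) ^ n.
Proof.
  intros HM Hr Hc.
  assert (HK : 0 <= K).
  { specialize (Hc 0%nat). simpl in Hc. generalize (Rabs_pos (c 0%nat)). lra. }
  assert (Hq : 0 < M * / r <= 1 / 2).
  { split; [apply Rdiv_lt_0_compat; lra|].
    apply Rmult_le_reg_r with r; [lra|].
    rewrite Rmult_assoc, Rinv_l by lra. lra. }
  assert (Hri : 0 < / r) by (apply Rinv_0_lt_compat; lra).
  set (q := M * / r) in *.
  assert (Hterm : forall m j, Rabs (c (m + j)%nat * (/ r) ^ (m + j)) <= K * q ^ m * q ^ j).
  { intros m j. rewrite Rabs_mult, (Rabs_pos_eq ((/ r) ^ (m + j))) by (apply pow_le; lra).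
    replace (K * q ^ m * q ^ j) with (K * M ^ (m + j) * (/ r) ^ (m + j)).
    - apply Rmult_le_compat_r; [apply pow_le; lra|apply Hc].
    - unfold q. rewrite !Rpow_mult_distr, !pow_add. ring. }
  assert (Hgeom : ex_series (fun j => q ^ j)).
  { exists (/ (1 - q)). apply is_series_geom. rewrite Rabs_pos_eq; lra. }
  assert (Hex : ex_series (fun j => c j * (/ r) ^ j)).
  { apply (ex_series_le (K := R_AbsRing) (V := R_CompleteNormedModule) _ (fun j => K * q ^ 0 * q ^ j)).
    - intros j. apply (Hterm 0%nat j).
    - now apply (ex_series_scal (K := R_AbsRing) (V := R_NormedModule) (K * q ^ 0)). }
  unfold PSeries. rewrite (Series_incr_n _ (S n)); [|lia|exact Hex].
  simpl pred.
  replace (sum_f_R0 _ n + _ - sum_f_R0 _ n)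
    with (Series (fun k => c (S n + k)%nat * (/ r) ^ (S n + k))) by ring.
  assert (Habs : ex_series (fun k => Rabs (c (S n + k)%nat * (/ r) ^ (S n + k)))).
  { apply (ex_series_le (K := R_AbsRing) (V := R_CompleteNormedModule) _ (fun k => K * q ^ S n * q ^ k)).
    - intros k. unfold norm; simpl; unfold abs; simpl. rewrite Rabs_Rabsolu.
      apply (Hterm (S n) k).
    - now apply (ex_series_scal (K := R_AbsRing) (V := R_NormedModule) (K * q ^ S n)). }
  apply Rle_trans with (1 := Series_Rabs _ Habs).
  apply Rle_trans with (Series (fun k => K * q ^ S n * q ^ k)).
  { apply Series_le.
    - intros k. split; [apply Rabs_pos|apply (Hterm (S n) k)].
    - now apply (ex_series_scal (K := R_AbsRing) (V := R_NormedModule) (K * q ^ S n)). }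
  rewrite Series_scal_l, Series_geom by (rewrite Rabs_pos_eq; lra).
  assert (Hinv : / (1 - q) <= 2).
  { apply Rmult_le_reg_r with (1 - q); [lra|]. rewrite Rinv_l; lra. }
  assert (Hinv0 : 0 < / (1 - q)) by (apply Rinv_0_lt_compat; lra).
  assert (Hqn : 0 <= q ^ n <= (1 / 2) ^ n).
  { split; [apply pow_le; lra|apply pow_incr; lra]. }
  simpl pow.
  replace (K * (q * q ^ n) * / (1 - q)) with (K * q ^ n * (q * / (1 - q))) by ring.
  assert (q * / (1 - q) <= 1) by nra.
  assert (0 <= K * q ^ n) by (apply Rmult_le_pos; lra).
  apply Rle_trans with (K * q ^ n * 1); [now apply Rmult_le_compat_l|].
  rewrite Rmult_1_r. apply Rmult_le_compat_l; lra.
Qed.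

Lemma sum_n_components (c : nat -> C) (r : R) (n : nat) :
  0 < r ->
  sum_n (fun j => c j / RtoC (r ^ j))%C n =
  (sum_f_R0 (fun j => Re (c j) * (/ r) ^ j) n, sum_f_R0 (fun j => Im (c j) * (/ r) ^ j) n).
Proof.
  intros Hr.
  assert (Ht : forall j, (c j / RtoC (r ^ j))%C = (Re (c j) * (/ r) ^ j, Im (c j) * (/ r) ^ j)).
  { intros j. unfold Cdiv.
    assert (r ^ j <> 0) by (apply pow_nonzero; lra).
    rewrite <- RtoC_inv by assumption. rewrite pow_inv.
    unfold Cmult, RtoC, Re, Im; simpl. f_equal; ring. }
  induction n as [|n IH].
  - rewrite sum_O. simpl sum_f_R0. apply (Ht 0%nat).
  - rewrite sum_Sn, IH, Ht. reflexivity.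
Qed.

Lemma inv_series_tail (c : nat -> C) (K M r : R) (n : nat) :
  0 < M -> 2 * M <= r -> (forall j, Cmod (c j) <= K * M ^ j) ->
  Cmod (inv_series c r - sum_n (fun j => c j / RtoC (r ^ j)) n)%C <= 2 * K * (1 / 2) ^ n.
Proof.
  intros HM Hr Hc. rewrite sum_n_components by lra.
  apply Rle_trans with (1 := Cmod_le_sum _).
  assert (H1 := PSeries_tail (fun j => Re (c j)) K M r n HM Hr
    (fun j => Rle_trans _ _ _ (re_le_Cmod _) (Hc j))).
  assert (H2 := PSeries_tail (fun j => Im (c j)) K M r n HM Hr
    (fun j => Rle_trans _ _ _ (Rabs_Im_le _) (Hc j))).
  unfold inv_series, Re, Im in *. simpl in *. unfold Rminus in *. lra.
Qed.

Lemma half_pow_small (A eps : R) : 0 < eps -> exists n, A * (1 / 2) ^ n < eps.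
Proof.
  intros Heps.
  destruct (pow_lt_1_zero (1 / 2) ltac:(rewrite Rabs_pos_eq; lra)
              (eps / (Rabs A + 1))) as [n Hn].
  { apply Rdiv_lt_0_compat; [lra|]. generalize (Rabs_pos A). lra. }
  exists n. specialize (Hn n (le_n n)).
  assert (Hp : 0 <= (1 / 2) ^ n) by (apply pow_le; lra).
  rewrite Rabs_pos_eq in Hn by exact Hp.
  assert (HA := Rabs_pos A).
  apply Rmult_lt_compat_r with (r := Rabs A + 1) in Hn; [|lra].
  unfold Rdiv in Hn at 2. rewrite (Rmult_assoc eps), Rinv_l, Rmult_1_r in Hn by lra.
  assert (A <= Rabs A) by apply Rle_abs. nra.
Qed.

(** Tannery's theorem along a filter: the tails are small uniformly in [x]. *)
Lemma inv_series_converges {T : Type} (F : (T -> Prop) -> Prop) (HF : ProperFilter F)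
    (c : T -> nat -> C) (l : nat -> C) (K M r : R) :
  0 < M -> 2 * M <= r ->
  (forall x j, Cmod (c x j) <= K * M ^ j) -> (forall j, Cmod (l j) <= K * M ^ j) ->
  (forall j, Cconverges F (fun x => c x j) (l j)) ->
  Cconverges F (fun x => inv_series (c x) r) (inv_series l r).
Proof.
  intros HM Hr Hc Hl Hlim eps Heps.
  destruct (half_pow_small (2 * K) (eps / 3)) as [n Hn]; [lra|].
  assert (Hsum : Cconverges F (fun x => sum_n (fun j => c x j / RtoC (r ^ j))%C n)
                   (sum_n (fun j => l j / RtoC (r ^ j))%C n)).
  { apply (Cconverges_sum_n F (fun j x => c x j / RtoC (r ^ j))%C).
    intros j eps' Heps'.
    generalize (Cconverges_scal F (/ RtoC (r ^ j)) _ _ (Hlim j) eps' Heps').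
    apply filter_imp. intros x. unfold Cdiv.
    now rewrite (Cmult_comm (c x j)), (Cmult_comm (l j)). }
  generalize (Hsum (eps / 3) ltac:(lra)). apply filter_imp. intros x Hx.
  assert (E1 := inv_series_tail (c x) K M r n HM Hr (Hc x)).
  assert (E2 := inv_series_tail l K M r n HM Hr Hl).
  set (A := inv_series (c x) r) in *. set (B := inv_series l r) in *.
  set (A' := sum_n (fun j => c x j / RtoC (r ^ j))%C n) in *.
  set (B' := sum_n (fun j => l j / RtoC (r ^ j))%C n) in *.
  replace (A - B)%C with ((A - A') + ((A' - B') + - (B - B')))%C by ring.
  apply Rle_lt_trans with (1 := Cmod_triangle _ _).
  assert (E3 := Cmod_triangle (A' - B') (- (B - B'))). rewrite Cmod_opp in E3. lra.
Qed.

Lemma inv_series_cexpands (c : nat -> C) (K M : R) :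
  0 < M -> (forall j, Cmod (c j) <= K * M ^ j) -> cexpands c (inv_series c).
Proof.
  intros HM Hc. split; apply expands_PSeries; exists K, M; (split; [exact HM|]); intros j.
  - apply Rle_trans with (2 := Hc j). apply re_le_Cmod.
  - apply Rle_trans with (2 := Hc j). apply Rabs_Im_le.
Qed.

(** Convergence of the expanded functions forces convergence of the coefficients.  It
    suffices to argue along the finer ultrafilters.  There bounded coefficients have
    limits, Tannery's theorem passes to the limit in the series, and independence of
    the cylinder functions shows that the limits are [a0] and [b0]. *)
Lemma cylinder_coefficients_continuous (k : R) (h0 h1 : R -> C)
    {T : Type} (F : (T -> Prop) -> Prop) (HF : ProperFilter F)
    (a b : T -> nat -> C) (a0 b0 : nat -> C) (K M X : R) :
  0 < k -> cylinder_pair k h0 h1 -> 0 < M ->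
  (forall x j, Cmod (a x j) <= K * M ^ j) ->
  (forall x j, Cmod (b x j) <= K * M ^ j) ->
  (forall j, Cmod (a0 j) <= K * M ^ j) ->
  (forall j, Cmod (b0 j) <= K * M ^ j) ->
  (forall r, X < r ->
     Cconverges F (fun x => h0 r * inv_series (a x) r + h1 r * inv_series (b x) r)%C
       (h0 r * inv_series a0 r + h1 r * inv_series b0 r)%C) ->
  forall j, Cconverges F (fun x => a x j) (a0 j) /\ Cconverges F (fun x => b x j) (b0 j).
Proof.
  intros Hk Hcyl HM Ha Hb Ha0 Hb0 Hlim.
  (* Along every finer ultrafilter the coefficients converge, and independence
     identifies the limits. *)
  assert (Hultra : forall G : (T -> Prop) -> Prop, ProperFilter G ->
    (forall P, F P -> G P) -> (forall P, G P \/ G (fun x => ~ P x)) ->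
    forall j, Cconverges G (fun x => a x j) (a0 j) /\ Cconverges G (fun x => b x j) (b0 j)).
  { intros G HG Hsub HU.
    assert (Hchoice : forall c : T -> nat -> C, (forall x j, Cmod (c x j) <= K * M ^ j) ->
      exists l : nat -> C, forall j, Cmod (l j) <= 2 * K * M ^ j /\
        Cconverges G (fun x => c x j) (l j)).
    { intros c Hc.
      apply (IndefiniteDescription.functional_choice (fun j l => Cmod l <= 2 * K * M ^ j /\
        Cconverges G (fun x => c x j) l)).
      intros j. destruct (ultrafilter_limit G (fun x => c x j) (K * M ^ j) HG HU
        (fun x => Hc x j)) as (l & H1 & H2).
      exists l. split; [lra|exact H2]. }
    destruct (Hchoice a Ha) as [al Hal]. destruct (Hchoice b Hb) as [bl Hbl].
    assert (HK : 0 <= K).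
    { specialize (Ha0 0%nat). simpl in Ha0. generalize (Cmod_ge_0 (a0 0%nat)). lra. }
    assert (Hdouble : forall z : C, forall j, Cmod z <= K * M ^ j -> Cmod z <= 2 * K * M ^ j).
    { intros z j Hz. assert (0 <= K * M ^ j) by (apply Rmult_le_pos; [exact HK|apply pow_le; lra]).
      lra. }
    assert (Hrel : forall r, Rmax X (2 * M) < r ->
      (h0 r * inv_series al r + h1 r * inv_series bl r =
       h0 r * inv_series a0 r + h1 r * inv_series b0 r)%C).
    { intros r Hr.
      assert (HX : X < r) by (generalize (Rmax_l X (2 * M)); lra).
      assert (HMr : 2 * M <= r) by (generalize (Rmax_r X (2 * M)); lra).
      apply (Cconverges_unique G
        (fun x => h0 r * inv_series (a x) r + h1 r * inv_series (b x) r)%C).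
      - apply (Cconverges_plus G); apply (Cconverges_scal G);
          apply inv_series_converges with (2 * K) M; auto; intros j; try apply Hal; apply Hbl.
      - intros eps Heps. apply Hsub. now apply Hlim. }
    assert (Hext : forall (c d : nat -> C), (forall j, Cmod (c j) <= 2 * K * M ^ j) ->
      (forall j, Cmod (d j) <= 2 * K * M ^ j) ->
      cexpands (fun j => c j - d j)%C (fun r => inv_series c r - inv_series d r)%C).
    { intros c d Hc Hd.
      destruct (inv_series_cexpands c _ _ HM Hc) as [H1 H2].
      destruct (inv_series_cexpands d _ _ HM Hd) as [H3 H4].
      split; [exact (expands_minus _ _ _ _ H1 H3)|exact (expands_minus _ _ _ _ H2 H4)]. }
    assert (Hind := cylinder_independence k h0 h1 _ _ _ _ Hk Hcyl
      (Hext al a0 (fun j => proj1 (Hal j)) (fun j => Hdouble _ j (Ha0 j)))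
      (Hext bl b0 (fun j => proj1 (Hbl j)) (fun j => Hdouble _ j (Hb0 j)))).
    intros j. destruct (Hind) with (n := j) as [E1 E2].
    { exists (Rmax X (2 * M)). intros r Hr. specialize (Hrel r Hr).
      replace (h0 r * (inv_series al r - inv_series a0 r) +
               h1 r * (inv_series bl r - inv_series b0 r))%C
        with ((h0 r * inv_series al r + h1 r * inv_series bl r) -
              (h0 r * inv_series a0 r + h1 r * inv_series b0 r))%C by ring.
      rewrite Hrel. ring. }
    replace (a0 j) with (al j).
    2:{ replace (al j) with (al j - a0 j + a0 j)%C by ring. rewrite E1. ring. }
    replace (b0 j) with (bl j).
    2:{ replace (bl j) with (bl j - b0 j + b0 j)%C by ring. rewrite E2. ring. }
    split; [apply Hal|apply Hbl]. }
  assert (Hsuff : forall P : T -> Prop,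
    (forall G : (T -> Prop) -> Prop, ProperFilter G ->
       (forall P, F P -> G P) -> (forall P, G P \/ G (fun x => ~ P x)) -> G P) -> F P).
  { intros P HP. apply Classical_Prop.NNPP. intros Hn.
    destruct (ultrafilter_extension (fun Q => F (fun x => ~ P x -> Q x))) as (G & HG & Hsub & HU).
    - constructor.
      + intros Q HQ. apply Classical_Prop.NNPP. intros HQn. apply Hn.
        revert HQ. apply filter_imp. intros x Hx.
        apply Classical_Prop.NNPP. intros Hx'. apply HQn. exists x. now apply Hx.
      + constructor.
        * apply filter_forall. auto.
        * intros Q R HQ HR. generalize (filter_and _ _ HQ HR).
          apply filter_imp. intros x [H1 H2] H3. split; auto.
        * intros Q R Himp. apply filter_imp. intros x H1 H2. auto.
    - assert (H1 : G P).
      { apply HP; [exact HG| |exact HU]. intros Q HQ. apply Hsub.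
        revert HQ. apply filter_imp. auto. }
      assert (H2 : G (fun x => ~ P x)) by (apply Hsub, filter_forall; auto).
      destruct (filter_ex _ (filter_and _ _ H1 H2)) as [x [H3 H4]]. auto. }
  intros j. split; intros eps Heps; apply Hsuff; intros G HG Hsub HU;
    now apply (Hultra G HG Hsub HU j).
Qed.

(** * A continuous function is determined by its cosine moments *)

(** Its powers are trigonometric polynomials that concentrate at [c]. *)
Definition cos_kernel (c t : R) : R := (1 + cos (t - c)) / 2.

(** Multiplication by the kernel maps [cos (m y)] to a combination of [cos (m y)],
    [cos ((m+1) y)] and [cos ((m-1) y)]. *)
Lemma cos_kernel_moments (g : R -> R) (c : R) :
  (forall t, continuous g t) ->
  (forall m, RInt (fun t => g t * cos (INR m * (t - c))) (c - PI) (c + PI) = 0) ->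
  forall N m,
    RInt (fun t => g t * (cos_kernel c t ^ N * cos (INR m * (t - c)))) (c - PI) (c + PI) = 0.
Proof.
  intros Hg H0.
  assert (Hex : forall N m,
    ex_RInt (fun t => g t * (cos_kernel c t ^ N * cos (INR m * (t - c)))) (c - PI) (c + PI)).
  { intros N m. apply ex_RInt_of_continuous. intros t. apply continuous_Rmult; [apply Hg|].
    apply continuous_of_ex_derive. unfold cos_kernel. now auto_derive. }
  induction N as [|N IH]; intros m.
  - rewrite <- (H0 m). apply RInt_ext. intros t _. simpl. ring.
  - set (m' := match m with O => 1%nat | S p => p end).
    assert (Hm : forall y, cos (INR m' * y) = cos (INR m * y - y)).
    { intros y. unfold m'. destruct m as [|p].
      - replace (INR 1 * y) with (- (INR 0 * y - y)) by (simpl; ring). apply cos_neg.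
      - f_equal. rewrite S_INR. ring. }
    assert (HI : forall j, is_RInt
      (fun t => g t * (cos_kernel c t ^ N * cos (INR j * (t - c)))) (c - PI) (c + PI) 0).
    { intros j. rewrite <- (IH j). apply (RInt_correct (V := R_CompleteNormedModule)), Hex. }
    assert (L := is_RInt_plus _ _ _ _ _ _ (is_RInt_scal _ _ _ (1 / 2) _ (HI m))
      (is_RInt_plus _ _ _ _ _ _ (is_RInt_scal _ _ _ (1 / 4) _ (HI (S m)))
                                 (is_RInt_scal _ _ _ (1 / 4) _ (HI m')))).
    apply (is_RInt_unique (V := R_CompleteNormedModule)). evar_last.
    + refine (is_RInt_ext _ _ _ _ _ _ L). intros t _.
      unfold plus, scal; simpl; unfold mult; simpl.
      rewrite Hm. change (match m with O => 1 | S _ => INR m + 1 end) with (INR (S m)).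
      rewrite S_INR. replace ((INR m + 1) * (t - c)) with (INR m * (t - c) + (t - c)) by ring.
      unfold cos_kernel. set (y := t - c). rewrite cos_plus, cos_minus. field.
    + unfold plus, scal; simpl; unfold mult; simpl. ring.
Qed.

(** If [g c > 0], the integral of [g] against the [N]-th power of the kernel is at
    least a multiple of [p^N], coming from a small neighbourhood of [c], minus a
    multiple of [q^N] with [q < p], coming from outside a larger one; it cannot vanish
    for all [N]. *)
Lemma trig_moments_determine (g : R -> R) (c : R) :
  (forall t, continuous g t) ->
  (forall m, RInt (fun t => g t * cos (INR m * (t - c))) (c - PI) (c + PI) = 0) ->
  g c = 0.
Proof.
  assert (Hpos : forall g : R -> R, (forall t, continuous g t) ->
    (forall m, RInt (fun t => g t * cos (INR m * (t - c))) (c - PI) (c + PI) = 0) ->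
    ~ 0 < g c).
  { clear g. intros g Hg H0 Hc.
    assert (HP := PI_RGT_0).
    assert (Hk : forall N, RInt (fun t => g t * cos_kernel c t ^ N) (c - PI) (c + PI) = 0).
    { intros N. rewrite <- (cos_kernel_moments g c Hg H0 N 0). apply RInt_ext.
      intros t _. simpl. rewrite Rmult_0_l, cos_0. ring. }
    assert (Hkc : forall N t, continuous (fun t => cos_kernel c t ^ N) t).
    { intros N t. apply continuous_of_ex_derive. unfold cos_kernel. now auto_derive. }
    assert (Hloc : locally c (fun t => g c / 2 < g t)).
    { apply (Hg c (fun y => g c / 2 < y)). apply open_gt. lra. }
    destruct Hloc as [e He].
    set (d := Rmin (e / 2) (PI / 2)).
    assert (Hd : 0 < d <= PI / 2).
    { split; [|apply Rmin_r]. apply Rmin_glb_lt; [|lra]. generalize (cond_pos e). lra. }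
    assert (Hnear : forall t, Rabs (t - c) <= d -> g c / 2 < g t).
    { intros t Ht. apply He. unfold ball; simpl; unfold AbsRing_ball, abs, minus, plus, opp; simpl.
      change (t + - c) with (t - c).
      assert (d <= e / 2) by apply Rmin_l. generalize (cond_pos e). lra. }
    destruct (continuity_ab_maj (fun t => Rabs (g t)) (c - PI) (c + PI)) as [tM [HM _]].
    { lra. }
    { intros t _. apply continuity_pt_filterlim.
      apply (continuous_comp g Rabs); [apply Hg|apply continuous_Rabs]. }
    set (G := Rabs (g tM)) in *. cbv beta in HM.
    set (q := (1 + cos d) / 2). set (p := (1 + cos (d / 2)) / 2).
    assert (Hcosle : forall u v, 0 <= u <= v -> v <= PI -> cos v <= cos u).
    { intros u v Hu Hv. destruct (Rle_lt_or_eq_dec u v) as [H|H]; [lra| |right; now rewrite H].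
      left. apply cos_decreasing_1; lra. }
    assert (Hqp : 0 <= q < p).
    { unfold p, q. assert (Hb := COS_bound d).
      assert (cos d < cos (d / 2)) by (apply cos_decreasing_1; lra). lra. }
    assert (Hcosabs : forall y, cos (Rabs y) = cos y).
    { intros y. unfold Rabs. destruct (Rcase_abs y); [apply cos_neg|reflexivity]. }
    assert (Hker0 : forall t, 0 <= cos_kernel c t).
    { intros t. unfold cos_kernel. assert (Hb := COS_bound (t - c)). lra. }
    assert (Hin : forall t, Rabs (t - c) <= d / 2 -> p <= cos_kernel c t).
    { intros t Ht. unfold cos_kernel, p. rewrite <- (Hcosabs (t - c)).
      assert (cos (d / 2) <= cos (Rabs (t - c))).
      { apply Hcosle; [split; [apply Rabs_pos|exact Ht]|lra]. }
      lra. }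
    assert (Hout : forall t, d <= Rabs (t - c) <= PI -> cos_kernel c t <= q).
    { intros t Ht. unfold cos_kernel, q. rewrite <- (Hcosabs (t - c)).
      assert (cos (Rabs (t - c)) <= cos d) by (apply Hcosle; lra). lra. }
    assert (HG : 0 <= G) by apply Rabs_pos.
    assert (Hlow : forall N t, Rabs (t - c) <= PI -> - (G * q ^ N) <= g t * cos_kernel c t ^ N).
    { intros N t Ht.
      assert (Hp0 : 0 <= cos_kernel c t ^ N) by (apply pow_le, Hker0).
      assert (Hq0 : 0 <= q ^ N) by (apply pow_le; lra).
      destruct (Rle_lt_dec (Rabs (t - c)) d) as [H|H].
      - assert (H1 := Hnear t H). nra.
      - assert (Hle : cos_kernel c t ^ N <= q ^ N).
        { apply pow_incr. split; [apply Hker0|apply Hout; lra]. }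
        assert (Hgt : - G <= g t).
        { assert (Ht' := proj1 (Rabs_le_between _ _) Ht).
          assert (H1 := HM t ltac:(lra)). apply Rabs_le_between in H1. lra. }
        nra. }
    assert (Hup : forall N t, Rabs (t - c) <= d / 2 -> g c / 2 * p ^ N <= g t * cos_kernel c t ^ N).
    { intros N t Ht. assert (H1 := Hnear t ltac:(lra)).
      apply Rmult_le_compat; [lra|apply pow_le; lra|lra|].
      apply pow_incr. split; [lra|now apply Hin]. }
    assert (Hmain : forall N, d * (g c / 2) * p ^ N <= 2 * PI * G * q ^ N).
    { intros N.
      assert (Hexk : forall a b, ex_RInt (fun t => g t * cos_kernel c t ^ N) a b).
      { intros a b. apply ex_RInt_of_continuous. intros t.
        apply continuous_Rmult; [apply Hg|apply Hkc]. }
      assert (Hc1 : forall a b v, a <= b -> (forall t, a <= t <= b -> v <= g t * cos_kernel c t ^ N) ->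
        (b - a) * v <= RInt (fun t => g t * cos_kernel c t ^ N) a b).
      { intros a b v Hab Hv.
        replace ((b - a) * v) with (RInt (fun _ => v) a b)
          by (rewrite (RInt_const (V := R_CompleteNormedModule)); reflexivity).
        apply RInt_le; [exact Hab|apply (ex_RInt_const (V := R_NormedModule))|apply Hexk|].
        intros t Ht. apply Hv. lra. }
      assert (E := Hk N).
      rewrite <- (RInt_Chasles (V := R_CompleteNormedModule) _ (c - PI) (c - d / 2) (c + PI)) in E by apply Hexk.
      rewrite <- (RInt_Chasles (V := R_CompleteNormedModule) _ (c - d / 2) (c + d / 2) (c + PI)) in E by apply Hexk.
      unfold plus in E; simpl in E.
      assert (I1 := Hc1 (c - PI) (c - d / 2) (- (G * q ^ N)) ltac:(lra)
        (fun t Ht => Hlow N t ltac:(apply Rabs_le; lra))).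
      assert (I2 := Hc1 (c - d / 2) (c + d / 2) (g c / 2 * p ^ N) ltac:(lra)
        (fun t Ht => Hup N t ltac:(apply Rabs_le; lra))).
      assert (I3 := Hc1 (c + d / 2) (c + PI) (- (G * q ^ N)) ltac:(lra)
        (fun t Ht => Hlow N t ltac:(apply Rabs_le; lra))).
      assert (HGq : 0 <= G * q ^ N) by (apply Rmult_le_pos; [exact HG|apply pow_le; lra]).
      nra. }
    destruct (pow_lt_1_zero (q / p)) with (y := d * (g c / 2) / (2 * PI * G + 1)) as [N HN].
    { rewrite Rabs_pos_eq.
      - apply Rmult_lt_reg_r with p; [lra|]. unfold Rdiv. rewrite Rmult_assoc, Rinv_l; lra.
      - apply Rle_mult_inv_pos; lra. }
    { apply Rdiv_lt_0_compat; [apply Rmult_lt_0_compat; lra|]. nra. }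
    specialize (HN N (le_n N)). specialize (Hmain N).
    assert (Hr : 0 <= (q / p) ^ N) by (apply pow_le, Rle_mult_inv_pos; lra).
    rewrite Rabs_pos_eq in HN by exact Hr.
    assert (HPG : 0 <= 2 * PI * G) by (apply Rmult_le_pos; lra).
    apply Rmult_lt_compat_r with (r := 2 * PI * G + 1) in HN; [|lra].
    unfold Rdiv in HN at 2. rewrite (Rmult_assoc (d * (g c / 2))), Rinv_l, Rmult_1_r in HN by lra.
    assert (Hpn : 0 < p ^ N) by (apply pow_lt; lra).
    apply (Rlt_not_le _ _ HN).
    apply Rmult_le_reg_r with (p ^ N); [exact Hpn|].
    apply Rle_trans with (1 := Hmain).
    replace ((q / p) ^ N * (2 * PI * G + 1) * p ^ N) with ((2 * PI * G + 1) * q ^ N).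
    - assert (0 <= q ^ N) by (apply pow_le; lra). nra.
    - unfold Rdiv. rewrite Rpow_mult_distr, pow_inv. field. lra. }
  intros Hg H0.
  destruct (Rtotal_order (g c) 0) as [H|[H|H]]; [exfalso|exact H|exfalso].
  - apply (Hpos (fun t => - g t)).
    + intros t. now apply (continuous_opp (V := R_NormedModule)).
    + intros m. rewrite (RInt_ext _ (fun t => opp (g t * cos (INR m * (t - c))))).
      * rewrite (RInt_opp (V := R_CompleteNormedModule)), H0.
        -- unfold opp; simpl. ring.
        -- apply ex_RInt_of_continuous. intros t. apply continuous_Rmult; [apply Hg|].
           apply continuous_of_ex_derive. now auto_derive.
      * intros t _. unfold opp; simpl. ring.
    + lra.
  - now apply (Hpos g).
Qed.

(** * Angular modes of solutions of the Helmholtz equation *)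

(** Continuous partial derivatives on an open set give differentiability, which the
    chain rule in polar coordinates needs. *)
Lemma differentiable_of_ex_diff_1 (U : R * R -> Prop) (g : R -> R -> R) (a b : R) :
  open U -> U (a, b) -> (forall x y, U (x, y) -> ex_diff_n g 1 x y) ->
  differentiable_pt_lim g a b
    (Derive (fun z => g z b) a) (Derive (fun z => g a z) b).
Proof.
  intros HU Hab Hg.
  apply filterdiff_differentiable_pt_lim.
  apply (is_derive_filterdiff g a b (fun x y => Derive (fun z => g z y) x)
           (Derive (fun z => g a z) b)).
  - generalize (HU _ Hab). apply filter_imp. intros [x y] Hxy.
    apply Derive_correct. apply (Hg x y Hxy).
  - apply Derive_correct. apply (Hg a b Hab).
  - destruct (Hg a b Hab) as (_ & _ & _ & [Hc _] & _).
    exact (proj1 (continuity_2d_pt_filterlim _ a b) Hc).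
Qed.

Section Polar.

Variables (f : R -> R -> R) (r phi lx ly : R).
Hypothesis Hf : differentiable_pt_lim f (r * cos phi) (r * sin phi) lx ly.

Lemma is_derive_polar_radius :
  is_derive (fun s => f (s * cos phi) (s * sin phi)) r (lx * cos phi + ly * sin phi).
Proof.
  apply is_derive_Reals.
  apply (derivable_pt_lim_comp_2d f (fun s => s * cos phi) (fun s => s * sin phi));
    [exact Hf| |]; apply is_derive_Reals; auto_derive; (exact I || ring).
Qed.

Lemma is_derive_polar_angle :
  is_derive (fun t => f (r * cos t) (r * sin t)) phi
    (lx * (- r * sin phi) + ly * (r * cos phi)).
Proof.
  apply is_derive_Reals.
  apply (derivable_pt_lim_comp_2d f (fun t => r * cos t) (fun t => r * sin t));
    [exact Hf| |]; apply is_derive_Reals; auto_derive; (exact I || ring).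
Qed.

End Polar.

Lemma continuity_2d_pt_polar (f : R -> R -> R) (r phi : R) :
  continuity_2d_pt f (r * cos phi) (r * sin phi) ->
  continuity_2d_pt (fun s t => f (s * cos t) (s * sin t)) r phi.
Proof.
  intros Hf. apply continuity_2d_pt_filterlim. apply continuity_2d_pt_filterlim in Hf.
  assert (Hcomp : forall g : R -> R, (forall t, ex_derive g t) ->
    continuous (fun p : R * R => fst p * g (snd p)) (r, phi)).
  { intros g Hg. apply (continuous_mult (K := R_AbsRing) (U := prod_UniformSpace R_UniformSpace R_UniformSpace)).
    - apply continuous_fst.
    - apply (continuous_comp snd g); [apply continuous_snd|].
      now apply continuous_of_ex_derive. }
  apply (continuous_comp_2 (fun p : R * R => fst p * cos (snd p))
           (fun p : R * R => fst p * sin (snd p)) f (r, phi)).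
  - apply Hcomp. intros t. now auto_derive.
  - apply Hcomp. intros t. now auto_derive.
  - exact Hf.
Qed.

Lemma continuity_2d_pt_comp_snd (g : R -> R) (r phi : R) :
  (forall t, ex_derive g t) -> continuity_2d_pt (fun _ t => g t) r phi.
Proof.
  intros Hg. apply continuity_1d_2d_pt_comp; [|apply continuity_2d_pt_id2].
  apply continuity_pt_filterlim. now apply continuous_of_ex_derive.
Qed.

Lemma continuity_2d_pt_slice (f : R -> R -> R) (r t : R) :
  continuity_2d_pt f r t -> continuous (f r) t.
Proof.
  intros H. apply continuity_2d_pt_filterlim in H.
  apply (continuous_comp_2 (fun _ : R => r) (fun s : R => s) f t);
    [apply continuous_const|apply continuous_id|exact H].
Qed.

Lemma is_derive_weighted_integral (w w' : R -> R -> R) (e : R -> R) (rho a b : R) :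
  (forall t, ex_derive e t) ->
  (forall r t, rho < r -> is_derive (fun s => w s t) r (w' r t)) ->
  (forall r t, rho < r -> continuity_2d_pt w r t) ->
  (forall r t, rho < r -> continuity_2d_pt w' r t) ->
  forall r, rho < r ->
    is_derive (fun s => RInt (fun t => w s t * e t) a b) r
              (RInt (fun t => w' r t * e t) a b).
Proof.
  intros He Hd Hc Hc' r Hr.
  assert (Hde : forall s t, rho < s -> is_derive (fun z => w z t * e t) s (w' s t * e t)).
  { intros s t Hs. evar_last.
    - apply @is_derive_mult; [now apply Hd|apply @is_derive_const|intros; apply Rmult_comm].
    - unfold plus, mult, zero; simpl. ring. }
  rewrite (RInt_ext _ (fun t => Derive (fun z => w z t * e t) r)).
  2:{ intros t _. symmetry. now apply is_derive_unique, Hde. }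
  apply (is_derive_RInt_param (fun s t => w s t * e t)).
  - generalize (open_gt rho r Hr). apply filter_imp. intros s Hs t _.
    eexists. now apply Hde.
  - intros t _. apply continuity_2d_pt_ext_loc with (fun s v => w' s v * e v).
    + exists (mkposreal (r - rho) (proj2 (Rlt_0_minus _ _) Hr)).
      intros s v Hs _. simpl in Hs. symmetry. apply is_derive_unique, Hde.
      apply Rabs_def2 in Hs. lra.
    + apply continuity_2d_pt_mult; [now apply Hc'|now apply continuity_2d_pt_comp_snd].
  - generalize (open_gt rho r Hr). apply filter_imp. intros s Hs.
    apply ex_RInt_of_continuous. intros t. apply continuous_Rmult.
    + now apply continuity_2d_pt_slice, Hc.
    + now apply continuous_of_ex_derive.
Qed.

Lemma sin_INR_PI (m : nat) : sin (INR m * PI) = 0.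
Proof. apply sin_eq_0_1. exists (Z.of_nat m). now rewrite INR_IZR_INZ. Qed.

(** In polar coordinates the equation reads [u_rr + u_r / r + u_pp / r^2 + k^2 u = 0].
    Differentiation under the integral sign gives the radial terms, and two
    integrations by parts turn [u_pp] into [- m^2 u]. *)
Lemma angular_mode_bessel (U : R * R -> Prop) (f : R -> R -> R) (k rho c : R) (m : nat) :
  open U ->
  (forall a b, U (a, b) -> ex_diff_n f 2 a b) ->
  (forall a b, U (a, b) ->
     partial_derive 2 0 f a b + partial_derive 0 2 f a b + k ^ 2 * f a b = 0) ->
  0 <= rho ->
  (forall r phi, rho < r -> U (r * cos phi, r * sin phi)) ->
  let mode r := RInt (fun t => f (r * cos t) (r * sin t) * cos (INR m * (t - c)))
                     (c - PI) (c + PI) in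
  exists d1 d2 : R -> R, forall r, rho < r ->
    is_derive mode r (d1 r) /\ is_derive d1 r (d2 r) /\
    d2 r + d1 r / r + (k ^ 2 - INR m ^ 2 / r ^ 2) * mode r = 0.
Proof.
  intros HU Hf Heq Hrho Hpol mode.
  set (fx := fun a b => Derive (fun z => f z b) a).
  set (fy := fun a b => Derive (fun z => f a z) b).
  set (fxx := fun a b => Derive (fun z => fx z b) a).
  set (fxy := fun a b => Derive (fun z => fx a z) b).
  set (fyx := fun a b => Derive (fun z => fy z b) a).
  set (fyy := fun a b => Derive (fun z => fy a z) b).
  assert (Hf1 : forall a b, U (a, b) -> ex_diff_n f 1 a b).
  { intros a b H. apply ex_diff_n_m with 2%nat; [lia|now apply Hf]. }
  assert (Hfx : forall a b, U (a, b) -> ex_diff_n fx 1 a b).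
  { intros a b H. now apply ex_diff_n_deriv_aux1, Hf. }
  assert (Hfy : forall a b, U (a, b) -> ex_diff_n fy 1 a b).
  { intros a b H. now apply ex_diff_n_deriv_aux2, Hf. }
  assert (Df : forall a b, U (a, b) -> differentiable_pt_lim f a b (fx a b) (fy a b)).
  { intros a b H. now apply (differentiable_of_ex_diff_1 U f a b HU H). }
  assert (Dfx : forall a b, U (a, b) -> differentiable_pt_lim fx a b (fxx a b) (fxy a b)).
  { intros a b H. now apply (differentiable_of_ex_diff_1 U fx a b HU H). }
  assert (Dfy : forall a b, U (a, b) -> differentiable_pt_lim fy a b (fyx a b) (fyy a b)).
  { intros a b H. now apply (differentiable_of_ex_diff_1 U fy a b HU H). }
  assert (C2 : forall a b, U (a, b) ->
    continuity_2d_pt fxx a b /\ continuity_2d_pt fxy a b /\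
    continuity_2d_pt fyx a b /\ continuity_2d_pt fyy a b).
  { intros a b H. destruct (Hfx a b H) as (_ & _ & _ & [H1 _] & [H2 _]).
    destruct (Hfy a b H) as (_ & _ & _ & [H3 _] & [H4 _]). repeat split; assumption. }
  set (P := fun (g : R -> R -> R) (r t : R) => g (r * cos t) (r * sin t)).
  set (ur := fun r t => P fx r t * cos t + P fy r t * sin t).
  set (urr := fun r t => (P fxx r t * cos t + P fxy r t * sin t) * cos t
                       + (P fyx r t * cos t + P fyy r t * sin t) * sin t).
  set (up := fun r t => P fx r t * (- r * sin t) + P fy r t * (r * cos t)).
  set (upp := fun r t =>
    (P fxx r t * (- r * sin t) + P fxy r t * (r * cos t)) * (- r * sin t)
    + P fx r t * (- r * cos t)
    + ((P fyx r t * (- r * sin t) + P fyy r t * (r * cos t)) * (r * cos t)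
       + P fy r t * (- r * sin t))).
  assert (Dur : forall r t, rho < r -> is_derive (fun s => P f s t) r (ur r t)).
  { intros r t Hr. apply is_derive_polar_radius. now apply Df, Hpol. }
  assert (Durr : forall r t, rho < r -> is_derive (fun s => ur s t) r (urr r t)).
  { intros r t Hr. evar_last.
    - apply @is_derive_plus; apply @is_derive_mult;
        [ apply is_derive_polar_radius; now apply Dfx, Hpol
        | apply @is_derive_const | intros; apply Rmult_comm
        | apply is_derive_polar_radius; now apply Dfy, Hpol
        | apply @is_derive_const | intros; apply Rmult_comm].
    - unfold urr, P, plus, mult, zero; simpl. ring. }
  assert (Dup : forall r t, rho < r -> is_derive (fun s => P f r s) t (up r t)).
  { intros r t Hr. apply is_derive_polar_angle. now apply Df, Hpol. }
  assert (Dupp : forall r t, rho < r -> is_derive (fun s => up r s) t (upp r t)).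
  { intros r t Hr. evar_last.
    - apply @is_derive_plus; apply @is_derive_mult;
        [ apply is_derive_polar_angle; now apply Dfx, Hpol
        | apply is_derive_scal, is_derive_Reals, derivable_pt_lim_sin
        | intros; apply Rmult_comm
        | apply is_derive_polar_angle; now apply Dfy, Hpol
        | apply is_derive_scal, is_derive_Reals, derivable_pt_lim_cos
        | intros; apply Rmult_comm].
    - unfold upp, P, plus, mult; simpl. ring. }
  assert (CP : forall g, (forall a b, U (a, b) -> continuity_2d_pt g a b) ->
    forall r t, rho < r -> continuity_2d_pt (P g) r t).
  { intros g Hg r t Hr. apply continuity_2d_pt_polar. now apply Hg, Hpol. }
  assert (Ccos : forall r t, continuity_2d_pt (fun _ v => cos v) r t).
  { intros. apply continuity_2d_pt_comp_snd. intros s. now auto_derive. }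
  assert (Csin : forall r t, continuity_2d_pt (fun _ v => sin v) r t).
  { intros. apply continuity_2d_pt_comp_snd. intros s. now auto_derive. }
  assert (Cf : forall r t, rho < r -> continuity_2d_pt (P f) r t).
  { apply CP. intros a b H. apply (Hf1 a b H). }
  assert (Cfx : forall r t, rho < r -> continuity_2d_pt (P fx) r t).
  { apply CP. intros a b H. apply (Hfx a b H). }
  assert (Cfy : forall r t, rho < r -> continuity_2d_pt (P fy) r t).
  { apply CP. intros a b H. apply (Hfy a b H). }
  assert (Cfxx : forall r t, rho < r -> continuity_2d_pt (P fxx) r t).
  { apply CP. intros a b H. apply (C2 a b H). }
  assert (Cfxy : forall r t, rho < r -> continuity_2d_pt (P fxy) r t).
  { apply CP. intros a b H. apply (C2 a b H). }
  assert (Cfyx : forall r t, rho < r -> continuity_2d_pt (P fyx) r t).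
  { apply CP. intros a b H. apply (C2 a b H). }
  assert (Cfyy : forall r t, rho < r -> continuity_2d_pt (P fyy) r t).
  { apply CP. intros a b H. apply (C2 a b H). }
  assert (Cur : forall r t, rho < r -> continuity_2d_pt ur r t).
  { intros r t Hr. unfold ur.
    repeat (apply continuity_2d_pt_plus || apply continuity_2d_pt_mult); auto. }
  assert (Curr : forall r t, rho < r -> continuity_2d_pt urr r t).
  { intros r t Hr. unfold urr.
    repeat (apply continuity_2d_pt_plus || apply continuity_2d_pt_mult); auto. }
  set (e := fun t => cos (INR m * (t - c))).
  assert (De : forall t, ex_derive e t) by (intros t; unfold e; now auto_derive).
  exists (fun r => RInt (fun t => ur r t * e t) (c - PI) (c + PI)),
         (fun r => RInt (fun t => urr r t * e t) (c - PI) (c + PI)).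
  intros r Hr. split; [|split].
  - exact (is_derive_weighted_integral (P f) ur e rho _ _ De Dur Cf Cur r Hr).
  - exact (is_derive_weighted_integral ur urr e rho _ _ De Durr Cur Curr r Hr).
  - assert (Hr0 : r <> 0) by lra.
    (* Two integrations by parts in the angle; the boundary terms cancel by periodicity. *)
    assert (Hparts : is_RInt (fun t => upp r t * e t + INR m ^ 2 * (P f r t * e t))
                       (c - PI) (c + PI) 0).
    { evar_last.
      - apply (is_RInt_derive (V := R_CompleteNormedModule)
          (fun t => up r t * e t + P f r t * (INR m * sin (INR m * (t - c))))).
        + intros t _. evar_last.
          * apply @is_derive_plus; apply @is_derive_mult;
              [ now apply Dupp
              | unfold e; auto_derive; [exact I|reflexivity]
              | intros; apply Rmult_comm
              | now apply Dup
              | auto_derive; [exact I|reflexivity]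
              | intros; apply Rmult_comm].
          * unfold plus, mult, e; simpl. change (t + - c) with (t - c). ring.
        + intros t _.
          assert (Ce : continuous e t) by now apply continuous_of_ex_derive.
          apply (continuous_plus (V := R_NormedModule)).
          * apply continuous_Rmult; [|exact Ce].
            assert (S : forall g, (forall r t, rho < r -> continuity_2d_pt (P g) r t) ->
                      continuous (P g r) t).
            { intros g Hg. now apply continuity_2d_pt_slice, Hg. }
            assert (S1 : continuous sin t) by (apply continuous_of_ex_derive; now auto_derive).
            assert (S2 : continuous cos t) by (apply continuous_of_ex_derive; now auto_derive).
            unfold upp.
            assert (F1 := S _ Cfx). assert (F2 := S _ Cfy). assert (F3 := S _ Cfxx).
            assert (F4 := S _ Cfxy). assert (F5 := S _ Cfyx). assert (F6 := S _ Cfyy).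
            repeat match goal with
            | |- continuous (fun s => _ + _) _ => apply continuous_Rplus
            | |- continuous (fun s => _ * _) _ => apply continuous_Rmult
            end; first [ exact S1 | exact S2 | apply continuous_const | exact F1 | exact F2
                       | exact F3 | exact F4 | exact F5 | exact F6 ].
          * apply continuous_Rmult; [apply continuous_const|].
            apply continuous_Rmult; [|exact Ce].
            now apply continuity_2d_pt_slice, Cf.
      - assert (Ecos : cos (c + PI) = cos (c - PI) /\ sin (c + PI) = sin (c - PI)).
        { replace (c + PI) with (c - PI + 2 * INR 1 * PI) by (simpl; ring).
          now rewrite cos_period, sin_period. }
        destruct Ecos as [Ecos Esin].
        unfold minus, plus, opp; simpl. unfold up, P, e. rewrite Ecos, Esin.
        replace (c + PI - c) with PI by ring.
        replace (INR m * (c - PI - c)) with (- (INR m * PI)) by ring.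
        rewrite cos_neg, sin_neg, sin_INR_PI. ring. }
    assert (HI : forall g, (forall r t, rho < r -> continuity_2d_pt g r t) ->
      is_RInt (fun t => g r t * e t) (c - PI) (c + PI)
        (RInt (fun t => g r t * e t) (c - PI) (c + PI))).
    { intros g Hg. apply (RInt_correct (V := R_CompleteNormedModule)).
      apply ex_RInt_of_continuous. intros t. apply continuous_Rmult.
      - now apply continuity_2d_pt_slice, Hg.
      - now apply continuous_of_ex_derive. }
    assert (L := is_RInt_plus _ _ _ _ _ _
      (is_RInt_plus _ _ _ _ _ _ (HI urr Curr) (is_RInt_scal _ _ _ (/ r) _ (HI ur Cur)))
      (is_RInt_scal _ _ _ (k ^ 2 - INR m ^ 2 / r ^ 2) _ (HI (P f) Cf))).
    assert (Rt := is_RInt_scal _ _ _ (- / r ^ 2) _ Hparts).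
    assert (E : is_RInt (fun t => plus (plus (urr r t * e t) (scal (/ r) (ur r t * e t)))
        (scal (k ^ 2 - INR m ^ 2 / r ^ 2) (P f r t * e t))) (c - PI) (c + PI)
        (scal (- / r ^ 2) 0)).
    { refine (is_RInt_ext _ _ _ _ _ _ Rt). intros t _.
      unfold plus, scal; simpl; unfold mult; simpl.
      assert (Hlap := Heq _ _ (Hpol r t Hr)).
      change (partial_derive 2 0 f (r * cos t) (r * sin t)) with (P fxx r t) in Hlap.
      change (partial_derive 0 2 f (r * cos t) (r * sin t)) with (P fyy r t) in Hlap.
      change (f (r * cos t) (r * sin t)) with (P f r t) in Hlap.
      assert (Hupp : upp r t = - r ^ 2 * urr r t - r * ur r t
        + r ^ 2 * (P fxx r t + P fyy r t) * ((sin t)² + (cos t)²)).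
      { unfold upp, urr, ur, Rsqr. ring. }
      rewrite sin2_cos2 in Hupp. rewrite Hupp.
      replace (P fxx r t + P fyy r t) with (- k ^ 2 * P f r t) by lra.
      field. exact Hr0. }
    apply (is_RInt_unique (V := R_CompleteNormedModule)) in L.
    apply (is_RInt_unique (V := R_CompleteNormedModule)) in E.
    assert (E' := eq_trans (eq_sym L) E).
    unfold plus, scal in E'; simpl in E'; unfold mult in E'; simpl in E'.
    rewrite Rmult_0_r in E'.
    change (mode r) with (RInt (fun t => P f r t * e t) (c - PI) (c + PI)).
    simpl. unfold Rdiv in *. lra.
Qed.

(** * Half-turn symmetry and the coefficient recurrences *)

Lemma RInt_shift (f : R -> R) (v a b : R) :
  (forall t, continuous f t) ->
  RInt (fun t => f (t + v)) a b = RInt f (a + v) (b + v).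
Proof.
  intros Hf. apply (is_RInt_unique (V := R_CompleteNormedModule)).
  apply is_RInt_ext with (fun t => scal 1 (f (1 * t + v))).
  { intros t _. unfold scal; simpl; unfold mult; simpl. rewrite !Rmult_1_l. reflexivity. }
  apply (is_RInt_comp_lin (V := R_NormedModule) f 1 v a b).
  rewrite !Rmult_1_l. apply (RInt_correct (V := R_CompleteNormedModule)).
  now apply ex_RInt_of_continuous.
Qed.

Lemma RInt_full_period (f : R -> R) (c : R) :
  (forall t, continuous f t) -> (forall t, f (t + 2 * PI) = f t) ->
  RInt f c (c + 2 * PI) = RInt f (c - PI) (c + PI).
Proof.
  intros Hf Hper.
  assert (Hex : forall a b, ex_RInt f a b) by (intros; now apply ex_RInt_of_continuous).
  rewrite <- (RInt_Chasles (V := R_CompleteNormedModule) f c (c + PI) (c + 2 * PI)) by apply Hex.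
  rewrite <- (RInt_Chasles (V := R_CompleteNormedModule) f (c - PI) c (c + PI)) by apply Hex.
  replace (RInt f (c + PI) (c + 2 * PI)) with (RInt f (c - PI) c).
  - unfold plus; simpl. ring.
  - replace (c + PI) with (c - PI + 2 * PI) by ring.
    rewrite <- RInt_shift by exact Hf.
    apply RInt_ext. intros t _. now rewrite Hper.
Qed.

Lemma cos_sub_INR_PI (m : nat) (y : R) : cos (y - INR m * PI) = (-1) ^ m * cos y.
Proof.
  induction m as [|m IH].
  - simpl. rewrite Rmult_0_l, Rminus_0_r. ring.
  - replace (y - INR (S m) * PI) with (y - INR m * PI - PI) by (rewrite S_INR; ring).
    rewrite cos_minus, cos_PI, sin_PI, IH. simpl. ring.
Qed.

Lemma pow_m1_sum_even (s m : nat) : Nat.Even (s + m) -> (-1) ^ s * (-1) ^ m = 1.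
Proof. intros [j H]. rewrite <- pow_add, H. apply pow_1_even. Qed.

(** The function [p t - (-1)^s p (t + PI)] has vanishing cosine moments: a half turn
    multiplies the [m]-th moment by [(-1)^m], which cancels the moments with [s + m]
    even. *)
Lemma half_turn_symmetry (p : R -> R) (c : R) (s : nat) :
  (forall t, continuous p t) -> (forall t, p (t + 2 * PI) = p t) ->
  (forall m, Nat.Odd (s + m) ->
     RInt (fun t => p t * cos (INR m * (t - c))) (c - PI) (c + PI) = 0) ->
  p c = (-1) ^ s * p (c + PI).
Proof.
  intros Hp Hper Hodd.
  assert (Hpc : forall t, continuous (fun t => p (t + PI)) t).
  { intros t. apply (continuous_comp (fun t => t + PI) p); [|apply Hp].
    apply continuous_of_ex_derive. now auto_derive. }
  assert (He : forall m t, continuous (fun t => cos (INR m * (t - c))) t).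
  { intros m t. apply continuous_of_ex_derive. now auto_derive. }
  assert (Hshift : forall m,
    RInt (fun t => p (t + PI) * cos (INR m * (t - c))) (c - PI) (c + PI) =
    (-1) ^ m * RInt (fun t => p t * cos (INR m * (t - c))) (c - PI) (c + PI)).
  { intros m.
    set (f := fun t => p t * cos (INR m * (t - c))).
    assert (Hf : forall t, continuous f t) by (intros t; apply continuous_Rmult; auto).
    rewrite (RInt_ext _ (fun t => scal ((-1) ^ m) (f (t + PI)))).
    - rewrite (RInt_scal (V := R_CompleteNormedModule)).
      + rewrite RInt_shift by exact Hf. unfold scal; simpl; unfold mult; simpl. f_equal.
        replace (c - PI + PI) with c by ring. replace (c + PI + PI) with (c + 2 * PI) by ring.
        apply RInt_full_period; [exact Hf|].
        intros t. unfold f. rewrite Hper. f_equal.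
        replace (INR m * (t + 2 * PI - c)) with (INR m * (t - c) + 2 * INR m * PI) by ring.
        apply cos_period.
      + apply ex_RInt_of_continuous. intros t.
        apply (continuous_comp (fun t => t + PI) f); [|apply Hf].
        apply continuous_of_ex_derive. now auto_derive.
    - intros t _. unfold f, scal; simpl; unfold mult; simpl.
      replace (INR m * (t - c)) with (INR m * (t + PI - c) - INR m * PI) by ring.
      rewrite cos_sub_INR_PI. ring. }
  assert (Hzero : p c - (-1) ^ s * p (c + PI) = 0); [|lra].
  apply (trig_moments_determine (fun t => p t - (-1) ^ s * p (t + PI)) c).
  - intros t. apply (continuous_minus (V := R_NormedModule)); [apply Hp|].
    apply continuous_Rmult; [apply continuous_const|apply Hpc].
  - intros m.
    rewrite (RInt_ext _ (fun t => minus (p t * cos (INR m * (t - c)))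
      (scal ((-1) ^ s) (p (t + PI) * cos (INR m * (t - c)))))).
    2:{ intros t _. unfold minus, plus, opp, scal; simpl; unfold mult; simpl. ring. }
    assert (E1 : ex_RInt (fun t => p t * cos (INR m * (t - c))) (c - PI) (c + PI)).
    { apply ex_RInt_of_continuous. intros t. apply continuous_Rmult; auto. }
    assert (E2 : ex_RInt (fun t => p (t + PI) * cos (INR m * (t - c))) (c - PI) (c + PI)).
    { apply ex_RInt_of_continuous. intros t. apply continuous_Rmult; auto. }
    rewrite (RInt_minus (V := R_CompleteNormedModule));
      [|exact E1|apply (ex_RInt_scal (V := R_NormedModule)); exact E2].
    rewrite (RInt_scal (V := R_CompleteNormedModule)) by exact E2.
    rewrite Hshift. unfold minus, plus, opp, scal; simpl; unfold mult; simpl.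
    destruct (Nat.Even_or_Odd (s + m)) as [H|H].
    + rewrite <- Rmult_assoc, (pow_m1_sum_even s m H). ring.
    + rewrite (Hodd m H). ring.
Qed.

(** The entries in question form one chain [a_0, b_1, a_2, ...] or [b_0, a_1, b_2,
    ...], according to the parity of [m].  Along it the factors [n^2 - m^2] and
    [(n+1)^2 - m^2] are never 0, for parity reasons, and the ratios grow linearly. *)
Lemma recurrence_parity (k : R) (m : nat) (a b : nat -> R) :
  0 < k -> geometric a -> geometric b ->
  (forall n, (INR n ^ 2 - INR m ^ 2) * a n = 2 * k * (INR n + 1) * b (S n)) ->
  (forall n, ((INR n + 1) ^ 2 - INR m ^ 2) * b n = - (2 * k * (INR n + 1) * a (S n))) ->
  forall n, (Nat.Odd (n + m) -> a n = 0) /\ (Nat.Even (n + m) -> b n = 0).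
Proof.
  intros Hk (K1 & M1 & HM1 & Ha) (K2 & M2 & HM2 & Hb) Hab Hba.
  set (c := fun n => if Nat.even (n + m) then b n else a n).
  set (lambda := fun n => (if Nat.even (n + m) then - ((INR n + 1) ^ 2 - INR m ^ 2)
                           else INR n ^ 2 - INR m ^ 2) / (2 * k * (INR n + 1))).
  assert (Hden : forall n, 0 < 2 * k * (INR n + 1)).
  { intros n. assert (0 <= INR n) by apply pos_INR. apply Rmult_lt_0_compat; lra. }
  assert (Hc : forall n, c n = 0).
  { apply (superexponential_zero c lambda).
    - exists (Rmax K1 K2), (Rmax M1 M2).
      split; [apply Rlt_le_trans with (1 := HM1), Rmax_l|].
      assert (Hgen : forall K M n, 0 < M -> M <= Rmax M1 M2 -> K <= Rmax K1 K2 ->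
        forall y, Rabs y <= K * M ^ n -> Rabs y <= Rmax K1 K2 * Rmax M1 M2 ^ n).
      { intros K M n HM HMle HK y Hy.
        assert (Hp : 0 < M ^ n) by now apply pow_lt.
        assert (HK0 : 0 <= K).
        { generalize (Rabs_pos y). intros. destruct (Rle_lt_dec 0 K); [assumption|nra]. }
        apply Rle_trans with (1 := Hy). apply Rmult_le_compat; try lra.
        apply pow_incr. lra. }
      intros n. unfold c. destruct (Nat.even (n + m)).
      + apply (Hgen K2 M2 n HM2 (Rmax_r _ _) (Rmax_r _ _)), Hb.
      + apply (Hgen K1 M1 n HM1 (Rmax_l _ _) (Rmax_l _ _)), Ha.
    - intros n. unfold c, lambda.
      replace (S n + m)%nat with (S (n + m)) by lia. rewrite Nat.even_succ, <- Nat.negb_even.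
      specialize (Hden n). specialize (Hab n). specialize (Hba n).
      destruct (Nat.even (n + m)); simpl negb; cbv iota.
      + apply Rmult_eq_reg_l with (2 * k * (INR n + 1)); [|lra].
        replace (2 * k * (INR n + 1) *
          (- ((INR n + 1) ^ 2 - INR m ^ 2) / (2 * k * (INR n + 1)) * b n))
          with (- (((INR n + 1) ^ 2 - INR m ^ 2) * b n)) by (field; nra).
        lra.
      + apply Rmult_eq_reg_l with (2 * k * (INR n + 1)); [|lra].
        rewrite <- Hab. field. nra.
    - intros n. unfold lambda. apply Rmult_integral_contrapositive_currified.
      2:{ apply Rinv_neq_0_compat. specialize (Hden n). lra. }
      assert (Hsq : forall p q : nat, p <> q -> INR p ^ 2 - INR q ^ 2 <> 0).
      { intros p q Hpq E. apply Hpq, INR_eq.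
        assert (0 <= INR p) by apply pos_INR. assert (0 <= INR q) by apply pos_INR. nra. }
      destruct (Nat.even (n + m)) eqn:E.
      + apply Ropp_neq_0_compat. rewrite <- S_INR. apply Hsq.
        intros H. subst m. replace (n + S n)%nat with (S (2 * n)) in E by lia.
        rewrite Nat.even_succ, <- Nat.negb_even, Nat.even_mul in E. discriminate.
      + apply Hsq. intros H. subst m. replace (n + n)%nat with (2 * n)%nat in E by lia.
        rewrite Nat.even_mul in E. discriminate.
    - intros B. destruct (INR_unbounded (8 * k * B)) as [n1 Hn1].
      exists (Nat.max n1 (2 * m + 1)). intros n Hn.
      assert (HnB : INR n1 <= INR n) by (apply le_INR; lia).
      assert (Hnm : 2 * INR m + 1 <= INR n).
      { replace (2 * INR m + 1) with (INR (2 * m + 1)) by (rewrite plus_INR, mult_INR; reflexivity).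
        apply le_INR. lia. }
      assert (Hm0 : 0 <= INR m) by apply pos_INR.
      specialize (Hden n). unfold lambda, Rdiv.
      rewrite Rabs_mult, (Rabs_pos_eq (/ _)) by (left; now apply Rinv_0_lt_compat).
      apply Rmult_le_reg_r with (2 * k * (INR n + 1)); [exact Hden|].
      rewrite (Rmult_assoc (Rabs _)), Rinv_l, Rmult_1_r by lra.
      set (q := INR n) in *.
      assert (Hmq : INR m ^ 2 <= (q / 2) ^ 2) by (apply pow_incr; lra).
      apply Rle_trans with (q ^ 2 - INR m ^ 2).
      { apply Rle_trans with (q / (8 * k) * (2 * k * (q + 1))).
        - apply Rmult_le_compat_r; [lra|].
          apply Rmult_le_reg_r with (8 * k); [lra|].
          unfold Rdiv. rewrite Rmult_assoc, Rinv_l, Rmult_1_r by lra. lra.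
        - replace (q / (8 * k) * (2 * k * (q + 1))) with (q * (q + 1) / 4) by (field; lra).
          nra. }
      destruct (Nat.even (n + m)).
      + rewrite Rabs_Ropp. apply Rle_trans with (2 := Rle_abs _). nra.
      + apply Rle_abs. }
  intros n. specialize (Hc n). unfold c in Hc. split; intros H.
  - apply Nat.odd_spec in H. rewrite <- Nat.negb_even in H.
    now destruct (Nat.even (n + m)).
  - apply Nat.even_spec in H. now rewrite H in Hc.
Qed.

Lemma is_cderive_inv (x : R) :
  0 < x -> is_cderive (fun y => RtoC (/ y)) x (RtoC (- / x ^ 2)).
Proof.
  intros Hx. split; simpl.
  - evar_last; [apply is_derive_inv; [apply @is_derive_id|lra]|].
    unfold one; simpl. field. lra.
  - apply @is_derive_const.
Qed.

(** Coefficients of [f'' + s g' + t f'/x + q f/x^2] when [f] and [g] have coefficients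
    [c] and [d]. *)
Definition bessel_operator_coef (c d : nat -> R) (s t q : R) (n : nat) : R :=
  deriv_coef (deriv_coef c) n + s * deriv_coef d n
  + t * PS_incr_1 (deriv_coef c) n + q * PS_incr_1 (PS_incr_1 c) n.

(** Substituting [h0 A + h1 B] in Bessel's equation with parameter [mu = m^2] and
    removing the derivatives of [h0], [h1] leaves a relation between [h0] and [h1]
    with the coefficients [A'' + 2 k B' + A'/x - mu A/x^2] and [B'' - 2 k A' - B'/x +
    (1 - mu) B/x^2].  By independence both vanish, and the recurrences are their
    coefficients of [x^(-n-2)]. *)
Lemma cylinder_bessel_recurrence (k mu : R) (h0 h1 : R -> C) (a b : nat -> C)
    (A B f d1 d2 : R -> C) :
  0 < k -> cylinder_pair k h0 h1 -> cexpands a A -> cexpands b B ->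
  Rbar_locally p_infty (fun x => f x = (h0 x * A x + h1 x * B x)%C) ->
  Rbar_locally p_infty (fun x => is_cderive f x (d1 x) /\ is_cderive d1 x (d2 x) /\
    (d2 x + d1 x * RtoC (/ x)
     + (RtoC (k * k) - RtoC mu * RtoC (/ x) * RtoC (/ x)) * f x = 0)%C) ->
  forall n,
    ((INR n ^ 2 - mu) * Re (a n) = 2 * k * (INR n + 1) * Re (b (S n)) /\
     (INR n ^ 2 - mu) * Im (a n) = 2 * k * (INR n + 1) * Im (b (S n))) /\
    (((INR n + 1) ^ 2 - mu) * Re (b n) = - (2 * k * (INR n + 1) * Re (a (S n))) /\
     ((INR n + 1) ^ 2 - mu) * Im (b n) = - (2 * k * (INR n + 1) * Im (a (S n)))).
Proof.
  intros Hk Hcyl HA HB Hf Hode.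
  destruct (cexpands_deriv _ _ HA) as (A1 & HA1 & DA).
  destruct (cexpands_deriv _ _ HA1) as (A2 & HA2 & DA1).
  destruct (cexpands_deriv _ _ HB) as (B1 & HB1 & DB).
  destruct (cexpands_deriv _ _ HB1) as (B2 & HB2 & DB1).
  assert (Hpos : Rbar_locally p_infty (fun x => 0 < x)) by (exists 0; auto).
  set (w := fun x : R => RtoC (/ x)). set (kc := RtoC k).
  set (u := fun x => (A1 x + kc * B x)%C).
  set (v := fun x => (B1 x + - kc * A x + - (1) * (B x * w x))%C).
  assert (Hd1 : Rbar_locally p_infty (fun x => d1 x = (h0 x * u x + h1 x * v x)%C)).
  { generalize (filter_and _ _ (filter_and _ _ Hpos (near_infinity_locally _ Hf))
      (filter_and _ _ Hode (filter_and _ _ DA DB))).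
    apply filter_imp. intros x [[Hx Hloc] [[D1 _] [dA dB]]].
    destruct (Hcyl x Hx) as (Dh0 & Dh1 & _).
    apply (is_cderive_ext_loc f (fun x => h0 x * A x + h1 x * B x)%C) in D1; [|exact Hloc].
    assert (E := is_cderive_unique _ _ _ _ D1
      (is_cderive_plus _ _ _ _ _ (is_cderive_mult _ _ _ _ _ Dh0 dA)
                                 (is_cderive_mult _ _ _ _ _ Dh1 dB))).
    rewrite E. unfold u, v, w, kc.
    unfold Cdiv. rewrite <- RtoC_inv by lra. ring. }
  assert (Hrel : Rbar_locally p_infty (fun x =>
    (h0 x * (A2 x + 2 * kc * B1 x + A1 x * w x + - RtoC mu * (A x * w x * w x)) +
     h1 x * (B2 x + - (2) * kc * A1 x + - (1) * (B1 x * w x) + B x * w x * w x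
             + - RtoC mu * (B x * w x * w x)) = 0)%C)).
  { generalize (filter_and _ _ (filter_and _ _ Hpos
      (filter_and _ _ Hf (near_infinity_locally _ Hd1)))
      (filter_and _ _ (filter_and _ _ Hode (filter_and _ _ DA DB))
        (filter_and _ _ DA1 DB1))).
    apply filter_imp. intros x [[Hx [Ef Hloc]] [[(_ & D2 & Eode) [dA dB]] [dA1 dB1]]].
    destruct (Hcyl x Hx) as (Dh0 & Dh1 & _).
    assert (Dw := is_cderive_inv x Hx). fold w in Dw.
    assert (Du := is_cderive_plus _ _ _ _ _ dA1
      (is_cderive_mult _ _ _ _ _ (is_cderive_const kc x) dB)).
    assert (Dv := is_cderive_plus _ _ _ _ _
      (is_cderive_plus _ _ _ _ _ dB1
        (is_cderive_mult _ _ _ _ _ (is_cderive_const (- kc)%C x) dA))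
      (is_cderive_mult _ _ _ _ _ (is_cderive_const (- (1))%C x)
        (is_cderive_mult _ _ _ _ _ dB Dw))).
    apply (is_cderive_ext_loc d1 (fun x => h0 x * u x + h1 x * v x)%C) in D2; [|exact Hloc].
    assert (E := is_cderive_unique _ _ _ _ D2
      (is_cderive_plus _ _ _ _ _ (is_cderive_mult _ _ _ _ _ Dh0 Du)
                                 (is_cderive_mult _ _ _ _ _ Dh1 Dv))).
    assert (E1 := locally_singleton _ _ Hloc). simpl in E1.
    rewrite E, E1, Ef in Eode.
    unfold Cdiv in Eode. rewrite <- RtoC_inv in Eode by lra.
    assert (Ew : RtoC (- / x ^ 2) = (- (w x * w x))%C).
    { unfold w. rewrite <- RtoC_mult, <- RtoC_opp. f_equal. field. lra. }
    rewrite Ew, RtoC_mult in Eode. rewrite <- Eode.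
    unfold u, v, kc. fold (w x). ring. }
  assert (Hcomb : forall (c d : nat -> R) (F F1 F2 G1 : R -> R) (s t q : R),
    expands c F -> expands (deriv_coef c) F1 -> expands (deriv_coef (deriv_coef c)) F2 ->
    expands (deriv_coef d) G1 ->
    expands (bessel_operator_coef c d s t q)
      (fun x => F2 x + s * G1 x + t * (F1 x / x) + q * (F x / x / x))).
  { intros. unfold bessel_operator_coef.
    repeat apply expands_plus; repeat apply expands_scal;
      repeat apply expands_shift; assumption. }
  destruct HA as [HAr HAi]. destruct HB as [HBr HBi].
  destruct HA1 as [HA1r HA1i]. destruct HB1 as [HB1r HB1i].
  destruct HA2 as [HA2r HA2i]. destruct HB2 as [HB2r HB2i].
  set (ar := fun n => Re (a n)). set (ai := fun n => Im (a n)).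
  set (br := fun n => Re (b n)). set (bi := fun n => Im (b n)).
  assert (Hind := cylinder_independence k h0 h1
    (fun n => (bessel_operator_coef ar br (2 * k) 1 (- mu) n,
               bessel_operator_coef ai bi (2 * k) 1 (- mu) n))
    (fun n => (bessel_operator_coef br ar (-2 * k) (-1) (1 - mu) n,
               bessel_operator_coef bi ai (-2 * k) (-1) (1 - mu) n))
    (fun x => (A2 x + 2 * kc * B1 x + A1 x * w x + - RtoC mu * (A x * w x * w x))%C)
    (fun x => (B2 x + - (2) * kc * A1 x + - (1) * (B1 x * w x) + B x * w x * w x
             + - RtoC mu * (B x * w x * w x))%C) Hk Hcyl).
  assert (Hzero : forall n,
    (bessel_operator_coef ar br (2 * k) 1 (- mu) n,
     bessel_operator_coef ai bi (2 * k) 1 (- mu) n) = RtoC 0 /\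
    (bessel_operator_coef br ar (-2 * k) (-1) (1 - mu) n,
     bessel_operator_coef bi ai (-2 * k) (-1) (1 - mu) n) = RtoC 0).
  { apply Hind; [split|split|exact Hrel].
    - refine (expands_ext _ _ _ _ (Hcomb ar br _ _ _ _ (2 * k) 1 (- mu) HAr HA1r HA2r HB1r)).
      exists 0. intros x Hx. unfold w, kc, Re, Im; simpl. field. lra.
    - refine (expands_ext _ _ _ _ (Hcomb ai bi _ _ _ _ (2 * k) 1 (- mu) HAi HA1i HA2i HB1i)).
      exists 0. intros x Hx. unfold w, kc, Re, Im; simpl. field. lra.
    - refine (expands_ext _ _ _ _ (Hcomb br ar _ _ _ _ (-2 * k) (-1) (1 - mu) HBr HB1r HB2r HA1r)).
      exists 0. intros x Hx. unfold w, kc, Re, Im; simpl. field. lra.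
    - refine (expands_ext _ _ _ _ (Hcomb bi ai _ _ _ _ (-2 * k) (-1) (1 - mu) HBi HB1i HB2i HA1i)).
      exists 0. intros x Hx. unfold w, kc, Re, Im; simpl. field. lra. }
  intros n. destruct (Hzero (S (S n))) as [E1 E2].
  injection E1; intros E1i E1r. injection E2; intros E2i E2r.
  unfold bessel_operator_coef in E1r, E1i, E2r, E2i.
  cbn [deriv_coef PS_incr_1] in E1r, E1i, E2r, E2i.
  rewrite !S_INR in E1r, E1i, E2r, E2i.
  unfold ar, ai, br, bi in *. repeat split; lra.
Qed.

(** * Termwise integration *)

Definition is_CRInt (g : R -> C) (a b : R) (l : C) : Prop :=
  is_RInt (fun t => Re (g t)) a b (Re l) /\ is_RInt (fun t => Im (g t)) a b (Im l).

Lemma is_CRInt_plus (g h : R -> C) (a b : R) (l m : C) :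
  is_CRInt g a b l -> is_CRInt h a b m ->
  is_CRInt (fun t => g t + h t)%C a b (l + m)%C.
Proof.
  intros [H1 H2] [H3 H4]. split.
  - exact (is_RInt_plus _ _ _ _ _ _ H1 H3).
  - exact (is_RInt_plus _ _ _ _ _ _ H2 H4).
Qed.

Lemma is_CRInt_scal (k : C) (g : R -> C) (a b : R) (l : C) :
  is_CRInt g a b l -> is_CRInt (fun t => k * g t)%C a b (k * l)%C.
Proof.
  intros [H1 H2]. split.
  - exact (is_RInt_minus _ _ _ _ _ _ (is_RInt_scal _ _ _ (Re k) _ H1)
             (is_RInt_scal _ _ _ (Im k) _ H2)).
  - exact (is_RInt_plus _ _ _ _ _ _ (is_RInt_scal _ _ _ (Re k) _ H2)
             (is_RInt_scal _ _ _ (Im k) _ H1)).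
Qed.

Lemma is_CRInt_sum_n (g : nat -> R -> C) (a b : R) (l : nat -> C) (n : nat) :
  (forall j, is_CRInt (g j) a b (l j)) ->
  is_CRInt (fun t => sum_n (fun j => g j t) n) a b (sum_n l n).
Proof.
  intros H. induction n as [|n IH].
  - rewrite sum_O. destruct (H 0%nat) as [H1 H2]. split.
    + apply is_RInt_ext with (2 := H1). intros t _. now rewrite sum_O.
    + apply is_RInt_ext with (2 := H2). intros t _. now rewrite sum_O.
  - rewrite sum_Sn. destruct (is_CRInt_plus _ _ _ _ _ _ IH (H (S n))) as [H1 H2]. split.
    + apply is_RInt_ext with (2 := H1). intros t _. now rewrite sum_Sn.
    + apply is_RInt_ext with (2 := H2). intros t _. now rewrite sum_Sn.
Qed.

Lemma is_CRInt_bound (g : R -> C) (a b B : R) (l : C) :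
  a <= b -> (forall t, Cmod (g t) <= B) -> is_CRInt g a b l -> Cmod l <= 2 * (b - a) * B.
Proof.
  intros Hab HB [H1 H2].
  assert (Hreal : forall (f : R -> R) v, (forall t, Rabs (f t) <= B) -> is_RInt f a b v ->
    Rabs v <= (b - a) * B).
  { intros f v Hf Hv.
    apply (norm_RInt_le_const (V := R_NormedModule) f a b v B Hab); [|exact Hv].
    intros t _. apply Hf. }
  apply Rle_trans with (1 := Cmod_le_sum _).
  assert (E1 := Hreal _ _ (fun t => Rle_trans _ _ _ (re_le_Cmod _) (HB t)) H1).
  assert (E2 := Hreal _ _ (fun t => Rle_trans _ _ _ (Rabs_Im_le _) (HB t)) H2).
  lra.
Qed.

Definition Ccontinuous (g : R -> C) : Prop :=
  forall t, continuous (fun s => Re (g s)) t /\ continuous (fun s => Im (g s)) t.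

Definition weighted_integral (g : R -> C) (e : R -> R) (a b : R) : C :=
  (RInt (fun t => Re (g t) * e t) a b, RInt (fun t => Im (g t) * e t) a b).

Lemma weighted_integral_correct (g : R -> C) (e : R -> R) (a b : R) :
  Ccontinuous g -> (forall t, continuous e t) ->
  is_CRInt (fun t => g t * RtoC (e t))%C a b (weighted_integral g e a b).
Proof.
  intros Hg He. split.
  - apply is_RInt_ext with (fun t => Re (g t) * e t).
    { intros t _. unfold Re, Im; simpl. ring. }
    apply (RInt_correct (V := R_CompleteNormedModule)), ex_RInt_of_continuous.
    intros t. apply continuous_Rmult; [apply Hg|apply He].
  - apply is_RInt_ext with (fun t => Im (g t) * e t).
    { intros t _. unfold Re, Im; simpl. ring. }
    apply (RInt_correct (V := R_CompleteNormedModule)), ex_RInt_of_continuous.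
    intros t. apply continuous_Rmult; [apply Hg|apply He].
Qed.

Lemma weighted_integral_bound (g : R -> C) (e : R -> R) (a b B : R) :
  a <= b -> Ccontinuous g -> (forall t, continuous e t) -> (forall t, Rabs (e t) <= 1) ->
  (forall t, Cmod (g t) <= B) ->
  Cmod (weighted_integral g e a b) <= 2 * (b - a) * B.
Proof.
  intros Hab Hg He He1 HB.
  apply (is_CRInt_bound (fun t => g t * RtoC (e t))%C); [exact Hab| |now apply weighted_integral_correct].
  intros t. rewrite Cmod_mult, Cmod_R.
  assert (H0 := Cmod_ge_0 (g t)). specialize (HB t). specialize (He1 t).
  assert (H1 := Rabs_pos (e t)). nra.
Qed.

(** Both sides differ by at most the integrated tails of the series, which tend to 0
    geometrically. *)
Lemma weighted_integral_expansion (p0 p1 : C) (g : R -> C) (F G : nat -> R -> C)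
    (e : R -> R) (a b K M r : R) :
  a <= b -> 0 < M -> 2 * M <= r ->
  Ccontinuous g -> (forall j, Ccontinuous (F j)) -> (forall j, Ccontinuous (G j)) ->
  (forall t, continuous e t) -> (forall t, Rabs (e t) <= 1) ->
  (forall j t, Cmod (F j t) <= K * M ^ j) -> (forall j t, Cmod (G j t) <= K * M ^ j) ->
  (forall t, g t = (p0 * inv_series (fun j => F j t) r + p1 * inv_series (fun j => G j t) r)%C) ->
  weighted_integral g e a b =
  (p0 * inv_series (fun j => weighted_integral (F j) e a b) r +
   p1 * inv_series (fun j => weighted_integral (G j) e a b) r)%C.
Proof.
  intros Hab HM Hr Hg HF HG He He1 BF BG Hexp.
  set (aF := fun j => weighted_integral (F j) e a b).
  set (aG := fun j => weighted_integral (G j) e a b).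
  set (K' := 2 * (b - a) * K).
  assert (BaF : forall j, Cmod (aF j) <= K' * M ^ j).
  { intros j. unfold K'. rewrite Rmult_assoc. apply weighted_integral_bound; auto. }
  assert (BaG : forall j, Cmod (aG j) <= K' * M ^ j).
  { intros j. unfold K'. rewrite Rmult_assoc. apply weighted_integral_bound; auto. }
  set (I := weighted_integral g e a b).
  set (J := (p0 * inv_series aF r + p1 * inv_series aG r)%C).
  set (W := (Cmod p0 + Cmod p1) * (2 * K)).
  assert (Hsmall : forall n, Cmod (I - J) <= (4 * (b - a) * W) * (1 / 2) ^ n).
  { intros n.
    set (sF := fun t => sum_n (fun j => F j t / RtoC (r ^ j))%C n).
    set (sG := fun t => sum_n (fun j => G j t / RtoC (r ^ j))%C n).
    assert (IF : forall H : nat -> R -> C, (forall j, Ccontinuous (H j)) ->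
      is_CRInt (fun t => sum_n (fun j => (/ RtoC (r ^ j) * (H j t * RtoC (e t)))%C) n) a b
        (sum_n (fun j => / RtoC (r ^ j) * weighted_integral (H j) e a b)%C n)).
    { intros H HH. apply (is_CRInt_sum_n (fun j t => / RtoC (r ^ j) * (H j t * RtoC (e t)))%C).
      intros j. apply is_CRInt_scal. now apply weighted_integral_correct. }
    assert (L := is_CRInt_plus _ _ _ _ _ _ (weighted_integral_correct g e a b Hg He)
      (is_CRInt_plus _ _ _ _ _ _ (is_CRInt_scal (- p0)%C _ _ _ _ (IF F HF))
                                 (is_CRInt_scal (- p1)%C _ _ _ _ (IF G HG)))).
    assert (Hsum : forall (H : nat -> R -> C) t,
      sum_n (fun j => (/ RtoC (r ^ j) * (H j t * RtoC (e t)))%C) n =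
      (RtoC (e t) * sum_n (fun j => H j t / RtoC (r ^ j))%C n)%C).
    { intros H t. rewrite <- (sum_n_mult_l (K := C_Ring)). apply sum_n_ext. intros j.
      change (/ RtoC (r ^ j) * (H j t * RtoC (e t)) = RtoC (e t) * (H j t * / RtoC (r ^ j)))%C.
      ring. }
    apply is_CRInt_bound with (B := W * (1 / 2) ^ n) in L; [|exact Hab|].
    2:{ intros t. rewrite !Hsum, Hexp.
      assert (T1 := inv_series_tail (fun j => F j t) K M r n HM Hr (fun j => BF j t)).
      assert (T2 := inv_series_tail (fun j => G j t) K M r n HM Hr (fun j => BG j t)).
      set (X := inv_series (fun j => F j t) r) in *. set (Y := inv_series (fun j => G j t) r) in *.
      cbv beta in T1, T2.
      set (X' := sum_n _ _) in T1 |- *. set (Y' := sum_n _ _) in T2 |- *.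
      replace ((p0 * X + p1 * Y) * RtoC (e t) + (- p0 * (RtoC (e t) * X') + - p1 * (RtoC (e t) * Y')))%C
        with (RtoC (e t) * (p0 * (X - X') + p1 * (Y - Y')))%C by ring.
      rewrite Cmod_mult, Cmod_R.
      apply Rle_trans with (1 * (Cmod p0 * (2 * K * (1 / 2) ^ n) + Cmod p1 * (2 * K * (1 / 2) ^ n))).
      - apply Rmult_le_compat; [apply Rabs_pos|apply Cmod_ge_0|apply He1|].
        apply Rle_trans with (1 := Cmod_triangle _ _). rewrite !Cmod_mult.
        apply Rplus_le_compat; (apply Rmult_le_compat_l; [apply Cmod_ge_0|assumption]).
      - unfold W. right. ring. }
    assert (T1 := inv_series_tail aF K' M r n HM Hr BaF).
    assert (T2 := inv_series_tail aG K' M r n HM Hr BaG).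
    fold I in L.
    assert (Hs : forall H : nat -> C,
      sum_n (fun j => / RtoC (r ^ j) * H j)%C n = sum_n (fun j => H j / RtoC (r ^ j))%C n).
    { intros H. apply sum_n_ext. intros j.
      change (/ RtoC (r ^ j) * H j = H j * / RtoC (r ^ j))%C. apply Cmult_comm. }
    rewrite (Hs (fun j => weighted_integral (F j) e a b)),
            (Hs (fun j => weighted_integral (G j) e a b)) in L.
    fold aF in L. fold aG in L.
    change (fun j => weighted_integral (F j) e a b / RtoC (r ^ j))%C
      with (fun j => aF j / RtoC (r ^ j))%C in L.
    change (fun j => weighted_integral (G j) e a b / RtoC (r ^ j))%C
      with (fun j => aG j / RtoC (r ^ j))%C in L.
    set (X' := sum_n (fun j => aF j / RtoC (r ^ j))%C n) in *.
    set (Y' := sum_n (fun j => aG j / RtoC (r ^ j))%C n) in *.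
    replace (I - J)%C with ((I + (- p0 * X' + - p1 * Y')) +
      (- p0 * (inv_series aF r - X') + - p1 * (inv_series aG r - Y')))%C by (unfold J; ring).
    apply Rle_trans with (1 := Cmod_triangle _ _).
    assert (T3 := Cmod_triangle (- p0 * (inv_series aF r - X')) (- p1 * (inv_series aG r - Y'))).
    rewrite !Cmod_mult, !Cmod_opp in T3.
    assert (T4 : Cmod p0 * Cmod (inv_series aF r - X') <= Cmod p0 * (2 * K' * (1 / 2) ^ n))
      by (apply Rmult_le_compat_l; [apply Cmod_ge_0|exact T1]).
    assert (T5 : Cmod p1 * Cmod (inv_series aG r - Y') <= Cmod p1 * (2 * K' * (1 / 2) ^ n))
      by (apply Rmult_le_compat_l; [apply Cmod_ge_0|exact T2]).
    replace (4 * (b - a) * W * (1 / 2) ^ n) with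
      (2 * (b - a) * (W * (1 / 2) ^ n) +
       (Cmod p0 * (2 * K' * (1 / 2) ^ n) + Cmod p1 * (2 * K' * (1 / 2) ^ n)))
      by (unfold W, K'; ring).
    lra. }
  assert (HIJ : Cmod (I - J) = 0).
  { apply Rle_antisym; [|apply Cmod_ge_0].
    destruct (Rle_lt_dec (Cmod (I - J)) 0) as [H|H]; [exact H|exfalso].
    destruct (half_pow_small (4 * (b - a) * W) (Cmod (I - J)) H) as [n Hn].
    specialize (Hsmall n). lra. }
  apply Cmod_eq_0 in HIJ.
  replace I with (I - J + J)%C by ring. rewrite HIJ. ring.
Qed.

(** * The coefficients of the Karp expansion *)

(** Uniform convergence of the partial sums bounds the late terms uniformly in the
    angle; about the first terms it says nothing. *)
Lemma converges_tail_bound (F : nat -> R -> C) (rho1 : R) (s : R -> R -> C) :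
  0 < rho1 -> converges_abs_unif F rho1 s ->
  exists N, forall n phi, (N < n)%nat -> Cmod (F n phi) <= 2 * rho1 ^ n.
Proof.
  intros Hrho [_ Hunif]. destruct (Hunif 1 ltac:(lra)) as [N HN].
  exists N. intros [|n] phi Hn; [lia|].
  assert (H1 := HN n rho1 phi ltac:(lia) ltac:(lra)).
  assert (H2 := HN (S n) rho1 phi ltac:(lia) ltac:(lra)).
  rewrite sum_Sn in H2.
  set (x := sum_n (karp_term F rho1 phi) n) in *. set (y := s rho1 phi) in *.
  set (z := karp_term F rho1 phi (S n)) in *.
  change (plus x z) with (x + z)%C in H2.
  assert (Hz : Cmod z <= 2).
  { replace z with ((x + z - y) + - (x - y))%C by ring.
    apply Rle_trans with (1 := Cmod_triangle _ _). rewrite Cmod_opp. lra. }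
  assert (Hp : 0 < rho1 ^ S n) by now apply pow_lt.
  unfold z, karp_term in Hz.
  rewrite Cmod_div in Hz by (intros E; apply RtoC_inj in E; lra).
  rewrite Cmod_R, Rabs_pos_eq in Hz by lra.
  apply Rmult_le_compat_r with (r := rho1 ^ S n) in Hz; [|lra].
  unfold Rdiv in Hz. rewrite Rmult_assoc, Rinv_l, Rmult_1_r in Hz by lra. exact Hz.
Qed.

Lemma converges_sum_eq (F : nat -> R -> C) (rho1 r phi K M : R) (s : R -> R -> C) :
  0 < M -> 2 * M <= r -> rho1 <= r -> converges_abs_unif F rho1 s ->
  (forall j, Cmod (F j phi) <= K * M ^ j) ->
  inv_series (fun j => F j phi) r = s r phi.
Proof.
  intros HM Hr Hr1 [_ Hunif] HF.
  destruct (Ceq_dec (inv_series (fun j => F j phi) r) (s r phi)) as [e|e]; [exact e|exfalso].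
  set (d := (inv_series (fun j => F j phi) r - s r phi)%C).
  assert (Hd : 0 < Cmod d).
  { apply Cmod_gt_0. intros E. apply e.
    replace (inv_series (fun j => F j phi) r) with (d + s r phi)%C by (unfold d; ring).
    rewrite E. ring. }
  destruct (Hunif (Cmod d / 2) ltac:(lra)) as [N HN].
  assert (HK : 0 <= K).
  { specialize (HF 0%nat). simpl in HF. generalize (Cmod_ge_0 (F 0%nat phi)). lra. }
  destruct (half_pow_small (2 * K) (Cmod d / 2) ltac:(lra)) as [n Hn].
  assert (H1 := HN (N + n)%nat r phi ltac:(lia) Hr1).
  assert (H2 := inv_series_tail (fun j => F j phi) K M r (N + n) HM Hr HF).
  set (x := sum_n (karp_term F r phi) (N + n)) in *.
  change (Cmod (inv_series (fun j => F j phi) r - x)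
          <= 2 * K * (1 / 2) ^ (N + n)) in H2.
  assert (H3 : 2 * K * (1 / 2) ^ (N + n) <= 2 * K * (1 / 2) ^ n).
  { apply Rmult_le_compat_l; [lra|]. rewrite pow_add.
    assert (0 < (1 / 2) ^ n) by (apply pow_lt; lra).
    assert ((1 / 2) ^ N <= 1 ^ N) by (apply pow_incr; lra). rewrite pow1 in H0. nra. }
  assert (H4 := Cmod_triangle (inv_series (fun j => F j phi) r - x) (x - s r phi)).
  replace (inv_series (fun j => F j phi) r - x + (x - s r phi))%C with d in H4
    by (unfold d; ring).
  lra.
Qed.

Lemma periodic_reduce (g : R -> C) :
  (forall t, g (t + 2 * PI) = g t) ->
  forall t, exists t', 0 <= t' <= 2 * PI /\ g t = g t'.
Proof.
  intros Hper t. assert (HP := PI_RGT_0).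
  assert (Hnat : forall n s, g (s + INR n * (2 * PI)) = g s).
  { induction n as [|n IH]; intros s.
    - simpl. now rewrite Rmult_0_l, Rplus_0_r.
    - rewrite S_INR. replace (s + (INR n + 1) * (2 * PI)) with (s + INR n * (2 * PI) + 2 * PI) by ring.
      now rewrite Hper. }
  assert (HZ : forall z s, g (s + IZR z * (2 * PI)) = g s).
  { intros z s. destruct z as [|p|p].
    - now rewrite Rmult_0_l, Rplus_0_r.
    - rewrite <- (positive_nat_Z p), <- INR_IZR_INZ. apply Hnat.
    - rewrite <- (Hnat (Pos.to_nat p) (s + IZR (Z.neg p) * (2 * PI))).
      f_equal. rewrite INR_IZR_INZ, positive_nat_Z.
      change (Z.neg p) with (- Z.pos p)%Z. rewrite opp_IZR. ring. }
  destruct (archimed (t / (2 * PI))) as [H1 H2].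
  set (z := up (t / (2 * PI))) in *.
  exists (t + IZR (1 - z) * (2 * PI)). split; [|now rewrite HZ].
  rewrite minus_IZR.
  assert (E : t = t / (2 * PI) * (2 * PI)) by (field; lra).
  set (q := t / (2 * PI)) in *. rewrite E. simpl. nra.
Qed.

Lemma periodic_bounded (g : R -> C) :
  Ccontinuous g -> (forall t, g (t + 2 * PI) = g t) ->
  exists B, forall t, Cmod (g t) <= B.
Proof.
  intros Hc Hper. assert (HP := PI_RGT_0).
  assert (Hmaj : forall f : R -> R, (forall t, continuous f t) ->
    exists B, forall t, 0 <= t <= 2 * PI -> Rabs (f t) <= B).
  { intros f Hf. destruct (continuity_ab_maj (fun t => Rabs (f t)) 0 (2 * PI)) as [tM [HM _]].
    - lra.
    - intros t _. apply continuity_pt_filterlim.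
      apply (continuous_comp f Rabs); [apply Hf|apply continuous_Rabs].
    - now exists (Rabs (f tM)). }
  destruct (Hmaj _ (fun t => proj1 (Hc t))) as [B1 H1].
  destruct (Hmaj _ (fun t => proj2 (Hc t))) as [B2 H2].
  exists (B1 + B2). intros t. destruct (periodic_reduce g Hper t) as (t' & Ht & ->).
  apply Rle_trans with (1 := Cmod_le_sum _). specialize (H1 t' Ht). specialize (H2 t' Ht). lra.
Qed.

Lemma inv_series_scal (k : R) (c : nat -> C) (r : R) :
  inv_series (fun j => RtoC k * c j)%C r = (RtoC k * inv_series c r)%C.
Proof.
  unfold inv_series. apply injective_projections; simpl.
  - rewrite (PSeries_ext _ (PS_scal k (fun j => Re (c j)))).
    + rewrite PSeries_scal. ring.
    + intros j. unfold PS_scal, scal, Re, Im; simpl; unfold mult; simpl. ring.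
  - rewrite (PSeries_ext _ (PS_scal k (fun j => Im (c j)))).
    + rewrite PSeries_scal. ring.
    + intros j. unfold PS_scal, scal, Re, Im; simpl; unfold mult; simpl. ring.
Qed.

Lemma inv_series_zero (r : R) : inv_series (fun _ => RtoC 0) r = RtoC 0.
Proof. unfold inv_series; simpl. now rewrite PSeries_const_0. Qed.

(** Suppose that the size [S] of the first coefficients is unbounded.  Divided by [S],
    the coefficients are uniformly bounded while the expanded function tends to 0
    along the points where [S] is large; hence the divided coefficients tend to 0.
    But the first of them have total size [(S - 1) / S], which tends to 1. *)
Lemma cylinder_coefficients_bounded (k : R) (h0 h1 : R -> C) {T : Type}
    (F G : nat -> T -> C) (N : nat) (M : R) :
  0 < k -> cylinder_pair k h0 h1 -> 1 <= M ->
  (forall n x, (N < n)%nat -> Cmod (F n x) <= 2 * M ^ n) ->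
  (forall n x, (N < n)%nat -> Cmod (G n x) <= 2 * M ^ n) ->
  (forall r, 2 * M <= r -> exists B, forall x,
     Cmod (h0 r * inv_series (fun j => F j x) r + h1 r * inv_series (fun j => G j x) r) <= B) ->
  exists K, forall n x, Cmod (F n x) <= K * M ^ n /\ Cmod (G n x) <= K * M ^ n.
Proof.
  intros Hk Hcyl HM HF HG Hbound.
  set (S := fun x => 1 + sum_f_R0 (fun j => Cmod (F j x) + Cmod (G j x)) N).
  assert (Hterm : forall n x, (n <= N)%nat -> Cmod (F n x) + Cmod (G n x) <= S x - 1).
  { intros n x. unfold S. generalize N. induction N0 as [|m IH]; intros Hn.
    - replace n with 0%nat by lia. simpl. lra.
    - rewrite tech5. assert (H0 := Cmod_ge_0 (F (Datatypes.S m) x)).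
      assert (H1 := Cmod_ge_0 (G (Datatypes.S m) x)).
      destruct (Nat.eq_dec n (Datatypes.S m)) as [->|Hne].
      + assert (0 <= sum_f_R0 (fun j => Cmod (F j x) + Cmod (G j x)) m).
        { apply cond_pos_sum. intros j. generalize (Cmod_ge_0 (F j x)) (Cmod_ge_0 (G j x)). lra. }
        lra.
      + specialize (IH ltac:(lia)). lra. }
  assert (HS1 : forall x, 1 <= S x).
  { intros x. assert (H := Hterm 0%nat x ltac:(lia)).
    generalize (Cmod_ge_0 (F 0%nat x)) (Cmod_ge_0 (G 0%nat x)). lra. }
  assert (HM1 : forall n, 1 <= M ^ n) by (intros n; now apply pow_R1_Rle).
  assert (Hall : forall n x, Cmod (F n x) <= 2 * S x * M ^ n /\ Cmod (G n x) <= 2 * S x * M ^ n).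
  { intros n x. specialize (HM1 n). specialize (HS1 x).
    destruct (Nat.le_gt_cases n N) as [Hn|Hn].
    - assert (H := Hterm n x Hn).
      assert (H0 := Cmod_ge_0 (F n x)). assert (H1 := Cmod_ge_0 (G n x)). split; nra.
    - assert (H0 := HF n x Hn). assert (H1 := HG n x Hn). split; nra. }
  destruct (Classical_Prop.classic (exists B, forall x, S x <= B)) as [[B HB]|Hunb].
  { exists (2 * B). intros n x. destruct (Hall n x) as [H1 H2].
    specialize (HB x). specialize (HM1 n).
    split; (eapply Rle_trans; [eassumption|]); apply Rmult_le_compat_r; lra. }
  exfalso.
  (* After division by [S] the coefficients stay bounded while the expanded
     function tends to 0 where [S] is large. *)
  set (Fl := fun P : T -> Prop => exists B, forall x, B < S x -> P x).
  assert (HFl : ProperFilter Fl).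
  { constructor.
    - intros P [B HP]. apply Classical_Prop.NNPP. intros Hn. apply Hunb.
      exists B. intros x. destruct (Rle_lt_dec (S x) B) as [H|H]; [exact H|].
      exfalso. apply Hn. exists x. now apply HP.
    - constructor.
      + exists 0. auto.
      + intros P Q [B1 H1] [B2 H2]. exists (Rmax B1 B2). intros x Hx.
        split; [apply H1|apply H2];
          (eapply Rle_lt_trans; [|exact Hx]); [apply Rmax_l|apply Rmax_r].
      + intros P Q HPQ [B1 H1]. exists B1. auto. }
  assert (Hnorm : forall n x, Cmod (RtoC (/ S x) * F n x) <= 2 * M ^ n /\
                              Cmod (RtoC (/ S x) * G n x) <= 2 * M ^ n).
  { intros n x. destruct (Hall n x) as [H1 H2]. specialize (HS1 x).
    assert (Hi : 0 < / S x) by (apply Rinv_0_lt_compat; lra).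
    rewrite !Cmod_mult, Cmod_R, (Rabs_pos_eq (/ S x)) by lra.
    split; (apply Rmult_le_reg_l with (S x); [lra|]);
      rewrite <- Rmult_assoc, Rinv_r, Rmult_1_l by lra; lra. }
  assert (Hlim := cylinder_coefficients_continuous k h0 h1 Fl HFl
    (fun x j => RtoC (/ S x) * F j x)%C (fun x j => RtoC (/ S x) * G j x)%C
    (fun _ => RtoC 0) (fun _ => RtoC 0) 2 M (2 * M) Hk Hcyl ltac:(lra)
    (fun x j => proj1 (Hnorm j x)) (fun x j => proj2 (Hnorm j x))).
  assert (Hz : forall j : nat, Cmod 0 <= 2 * M ^ j).
  { intros j. rewrite Cmod_0. specialize (HM1 j). lra. }
  specialize (Hlim Hz Hz).
  assert (Hcoef : forall j, Cconverges Fl (fun x => RtoC (/ S x) * F j x)%C 0 /\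
                            Cconverges Fl (fun x => RtoC (/ S x) * G j x)%C 0).
  { apply Hlim. intros r Hr eps Heps.
    destruct (Hbound r ltac:(lra)) as [B HB].
    exists (B / eps). intros x Hx. specialize (HB x). specialize (HS1 x).
    rewrite !inv_series_zero, !inv_series_scal.
    replace (h0 r * (RtoC (/ S x) * inv_series (fun j => F j x) r) +
      h1 r * (RtoC (/ S x) * inv_series (fun j => G j x) r) - (h0 r * 0 + h1 r * 0))%C
      with (RtoC (/ S x) * (h0 r * inv_series (fun j => F j x) r +
                            h1 r * inv_series (fun j => G j x) r))%C by ring.
    assert (Hi : 0 < / S x) by (apply Rinv_0_lt_compat; lra).
    rewrite Cmod_mult, Cmod_R, (Rabs_pos_eq (/ S x)) by lra.
    apply Rmult_lt_reg_l with (S x); [lra|].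
    rewrite <- Rmult_assoc, Rinv_r, Rmult_1_l by lra.
    apply Rle_lt_trans with (1 := HB).
    apply Rmult_lt_compat_r with (r := eps) in Hx; [|exact Heps].
    unfold Rdiv in Hx. rewrite Rmult_assoc, Rinv_l, Rmult_1_r in Hx by lra. lra. }
  assert (Hsum : forall n eps, 0 < eps ->
    Fl (fun x => sum_f_R0 (fun j => Cmod (F j x) + Cmod (G j x)) n < eps * S x)).
  { assert (Hone : forall j eps, 0 < eps ->
      Fl (fun x => Cmod (F j x) + Cmod (G j x) < eps * S x)).
    { intros j eps Heps. destruct (Hcoef j) as [H1 H2].
      assert (Heps2 : 0 < eps / 2) by lra.
      generalize (filter_and _ _ (H1 _ Heps2) (H2 _ Heps2)).
      apply filter_imp. intros x [E1 E2]. specialize (HS1 x).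
      assert (Hi : 0 < / S x) by (apply Rinv_0_lt_compat; lra).
      replace (RtoC (/ S x) * F j x - 0)%C with (RtoC (/ S x) * F j x)%C in E1 by ring.
      replace (RtoC (/ S x) * G j x - 0)%C with (RtoC (/ S x) * G j x)%C in E2 by ring.
      rewrite Cmod_mult, Cmod_R, (Rabs_pos_eq (/ S x)) in E1, E2 by lra.
      apply Rmult_lt_compat_l with (r := S x) in E1; [|lra].
      apply Rmult_lt_compat_l with (r := S x) in E2; [|lra].
      rewrite <- Rmult_assoc, Rinv_r, Rmult_1_l in E1 by lra.
      rewrite <- Rmult_assoc, Rinv_r, Rmult_1_l in E2 by lra. lra. }
    induction n as [|n IH]; intros eps Heps; [now apply Hone|].
    assert (Heps2 : 0 < eps / 2) by lra.
    generalize (filter_and _ _ (IH _ Heps2) (Hone (Datatypes.S n) _ Heps2)).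
    apply filter_imp. intros x [E1 E2]. rewrite tech5. lra. }
  assert (Hbig : Fl (fun x => 2 < S x)) by (exists 2; auto).
  assert (Hhalf : 0 < 1 / 2) by lra.
  destruct (filter_ex _ (filter_and _ _ Hbig (Hsum N _ Hhalf))) as [x [E1 E2]].
  unfold S in E1, E2. lra.
Qed.

Lemma norm_polar (r phi : R) : 0 <= r -> norm (polar r phi) = r.
Proof.
  intros Hr. unfold norm; simpl. unfold prod_norm, polar; simpl.
  unfold norm; simpl. unfold abs; simpl.
  replace (Rabs (r * cos phi) * (Rabs (r * cos phi) * 1) +
           Rabs (r * sin phi) * (Rabs (r * sin phi) * 1)) with (r * r).
  - now apply sqrt_square.
  - replace (Rabs (r * cos phi) * (Rabs (r * cos phi) * 1)) with ((Rabs (r * cos phi)) ^ 2) by ring.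
    replace (Rabs (r * sin phi) * (Rabs (r * sin phi) * 1)) with ((Rabs (r * sin phi)) ^ 2) by ring.
    rewrite !pow2_abs.
    replace ((r * cos phi) ^ 2 + (r * sin phi) ^ 2) with (r * r * ((sin phi)² + (cos phi)²))
      by (unfold Rsqr; ring).
    rewrite sin2_cos2. ring.
Qed.

Lemma Cconverges_locally_Ccontinuous (g : R -> C) :
  (forall t, Cconverges (locally t) g (g t)) -> Ccontinuous g.
Proof.
  intros H t. split; intros P [eps HP].
  - change (locally t (fun s => P (Re (g s)))). generalize (H t eps (cond_pos eps)). apply filter_imp. intros s Hs. apply HP.
    apply Rle_lt_trans with (2 := Hs). apply (re_le_Cmod (g s - g t)%C).
  - change (locally t (fun s => P (Im (g s)))). generalize (H t eps (cond_pos eps)). apply filter_imp. intros s Hs. apply HP.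
    apply Rle_lt_trans with (2 := Hs). apply (Rabs_Im_le (g s - g t)%C).
Qed.

Lemma Ccontinuous_Cconverges_locally (g : R -> C) (t : R) :
  Ccontinuous g -> Cconverges (locally t) g (g t).
Proof.
  intros H eps Heps. destruct (H t) as [H1 H2].
  assert (He : 0 < eps / 2) by lra.
  assert (E1 := H1 _ (locally_ball _ (mkposreal _ He))).
  assert (E2 := H2 _ (locally_ball _ (mkposreal _ He))).
  change (locally t (fun s => Rabs (Re (g s) - Re (g t)) < eps / 2)) in E1.
  change (locally t (fun s => Rabs (Im (g s) - Im (g t)) < eps / 2)) in E2.
  generalize (filter_and _ _ E1 E2). apply filter_imp. intros s [B1 B2].
  apply Rle_lt_trans with (1 := Cmod_le_sum _).
  unfold Re, Im in *. simpl. unfold Rminus in *. lra.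
Qed.

Section KarpExpansion.

Variables (U : R * R -> Prop) (kappa rho : R) (psi : R * R -> C) (F G : nat -> R -> C).
Hypotheses (HU : open U) (Hk : 0 < kappa) (HC2 : class_C2 U psi)
  (Hhelm : helmholtz kappa U psi) (Hrho : 0 < rho)
  (Hout : forall x : R * R, rho <= norm x -> U x)
  (Hkarp : karp_expansion kappa rho psi F G).

Let h0 r := hankel1 0 (kappa * r).
Let h1 r := hankel1 1 (kappa * r).
Let M := rho + 1.

Lemma polar_in_region (r t : R) : rho < r -> U (r * cos t, r * sin t).
Proof.
  intros Hr. apply Hout. change (rho <= norm (polar r t)).
  rewrite norm_polar by lra. lra.
Qed.

Lemma Ccontinuous_on_circle (r : R) :
  rho < r -> Ccontinuous (fun t => psi (polar r t)).
Proof.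
  intros Hr t. destruct (HC2 _ _ (polar_in_region r t Hr)) as [[H1 _] [H2 _]]. split.
  - exact (continuity_2d_pt_slice _ r t (continuity_2d_pt_polar _ r t H1)).
  - exact (continuity_2d_pt_slice _ r t (continuity_2d_pt_polar _ r t H2)).
Qed.

Lemma karp_representation (r t : R) :
  2 * M <= r ->
  psi (polar r t) = (h0 r * inv_series (fun j => F j t) r
                     + h1 r * inv_series (fun j => G j t) r)%C.
Proof.
  intros Hr. assert (HM : 1 <= M) by (unfold M; lra).
  assert (HM0 : 0 < M) by lra. assert (HrM : M <= r) by lra.
  destruct Hkarp as [_ (A & B & Hexp & Hunif)].
  destruct (Hunif M ltac:(unfold M; lra)) as [UF UG].
  (* At a fixed angle the finitely many coefficients outside the tail bound
     are absorbed in the constant. *)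
  assert (Hpoint : forall H s, converges_abs_unif H M s ->
    inv_series (fun j => H j t) r = s r t).
  { intros H s HH. destruct (converges_tail_bound H M s HM0 HH) as [N HN].
    set (K := 2 + sum_f_R0 (fun j => Cmod (H j t)) N).
    apply (converges_sum_eq H M r t K M s HM0 Hr HrM HH).
    assert (Hnn : forall m, 0 <= sum_f_R0 (fun j => Cmod (H j t)) m).
    { intros m. apply cond_pos_sum. intros i. apply Cmod_ge_0. }
    intros j. assert (HMj : 1 <= M ^ j) by now apply pow_R1_Rle.
    specialize (Hnn N) as HnnN. unfold K.
    destruct (Nat.le_gt_cases j N) as [Hj|Hj].
    - assert (Hle : Cmod (H j t) <= sum_f_R0 (fun j => Cmod (H j t)) N).
      { clear K HnnN HN. induction N as [|m IH].
        - replace j with 0%nat by lia. simpl. lra.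
        - rewrite tech5. assert (H0 := Cmod_ge_0 (H (Datatypes.S m) t)).
          destruct (Nat.eq_dec j (Datatypes.S m)) as [->|Hne].
          + specialize (Hnn m). lra.
          + specialize (IH ltac:(lia)). lra. }
      nra.
    - specialize (HN j t Hj). nra. }
  rewrite (Hpoint F A UF), (Hpoint G B UG).
  apply Hexp. unfold M in Hr. lra.
Qed.

Lemma karp_coefficients_bounded :
  exists K, forall n t, Cmod (F n t) <= K * M ^ n /\ Cmod (G n t) <= K * M ^ n.
Proof.
  assert (HM : 1 <= M) by (unfold M; lra). assert (HM0 : 0 < M) by lra.
  destruct Hkarp as [_ (A & B & _ & Hunif)].
  destruct (Hunif M ltac:(unfold M; lra)) as [UF UG].
  destruct (converges_tail_bound F M A HM0 UF) as [N1 HN1].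
  destruct (converges_tail_bound G M B HM0 UG) as [N2 HN2].
  apply (cylinder_coefficients_bounded kappa h0 h1 F G (Nat.max N1 N2) M Hk
           (hankel_cylinder_pair kappa Hk) HM).
  - intros n x Hn. apply HN1. lia.
  - intros n x Hn. apply HN2. lia.
  - intros r Hr.
    destruct (periodic_bounded (fun t => psi (polar r t))) as [b Hb].
    + apply Ccontinuous_on_circle. unfold M in Hr. lra.
    + intros t. unfold polar.
      replace (t + 2 * PI) with (t + 2 * INR 1 * PI) by (simpl; ring).
      now rewrite cos_period, sin_period.
    + exists b. intros t. rewrite <- karp_representation by exact Hr. apply Hb.
Qed.

Lemma karp_coefficients_Ccontinuous (n : nat) : Ccontinuous (F n) /\ Ccontinuous (G n).
Proof.
  destruct karp_coefficients_bounded as [K HK].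
  assert (HM0 : 0 < M) by (unfold M; lra).
  assert (Hconv : forall j t, Cconverges (locally t) (F j) (F j t) /\
                              Cconverges (locally t) (G j) (G j t)).
  { intros j t.
    apply (cylinder_coefficients_continuous kappa h0 h1 (locally t) _
      (fun x j => F j x) (fun x j => G j x) (fun j => F j t) (fun j => G j t)
      K M (2 * M) Hk (hankel_cylinder_pair kappa Hk) HM0
      (fun x i => proj1 (HK i x)) (fun x i => proj2 (HK i x))
      (fun i => proj1 (HK i t)) (fun i => proj2 (HK i t))).
    intros r Hr. rewrite <- karp_representation by lra. intros eps Heps.
    assert (Hr' : rho < r) by (unfold M in Hr; lra).
    generalize (Ccontinuous_Cconverges_locally _ t (Ccontinuous_on_circle r Hr') eps Heps).
    apply filter_imp. intros s Hs. rewrite <- karp_representation by lra. exact Hs. }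
  split; apply Cconverges_locally_Ccontinuous; intros t.
  - exact (proj1 (Hconv n t)).
  - exact (proj2 (Hconv n t)).
Qed.

(** The mode of the solution about [c] has the expansion whose coefficients are the
    modes of [F] and [G], and it solves Bessel's equation; the recurrences then apply
    to the real and the imaginary parts. *)
Lemma wrong_parity_modes_vanish (c : R) (m n : nat) :
  (Nat.Odd (n + m) ->
     weighted_integral (F n) (fun t => cos (INR m * (t - c))) (c - PI) (c + PI) = 0) /\
  (Nat.Even (n + m) ->
     weighted_integral (G n) (fun t => cos (INR m * (t - c))) (c - PI) (c + PI) = 0).
Proof.
  assert (HP := PI_RGT_0).
  assert (Hcyl : cylinder_pair kappa h0 h1) by now apply hankel_cylinder_pair.
  destruct karp_coefficients_bounded as [K HK].
  assert (HM0 : 0 < M) by (unfold M; lra).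
  assert (Hint : c - PI <= c + PI) by lra.
  set (e := fun t => cos (INR m * (t - c))).
  assert (He : forall t, continuous e t).
  { intros t. apply continuous_of_ex_derive. unfold e. now auto_derive. }
  assert (He1 : forall t, Rabs (e t) <= 1).
  { intros t. apply Rabs_le. unfold e. apply COS_bound. }
  assert (HcF : forall j, Ccontinuous (F j)) by (intros j; apply (karp_coefficients_Ccontinuous j)).
  assert (HcG : forall j, Ccontinuous (G j)) by (intros j; apply (karp_coefficients_Ccontinuous j)).
  set (a := fun j => weighted_integral (F j) e (c - PI) (c + PI)).
  set (b := fun j => weighted_integral (G j) e (c - PI) (c + PI)).
  set (K' := 2 * (c + PI - (c - PI)) * K).
  assert (Ba : forall j, Cmod (a j) <= K' * M ^ j).
  { intros j. unfold K'. rewrite Rmult_assoc.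
    exact (weighted_integral_bound (F j) e _ _ _ Hint (HcF j) He He1 (fun t => proj1 (HK j t))). }
  assert (Bb : forall j, Cmod (b j) <= K' * M ^ j).
  { intros j. unfold K'. rewrite Rmult_assoc.
    exact (weighted_integral_bound (G j) e _ _ _ Hint (HcG j) He He1 (fun t => proj2 (HK j t))). }
  assert (Ea := inv_series_cexpands a K' M HM0 Ba).
  assert (Eb := inv_series_cexpands b K' M HM0 Bb).
  set (f := fun r => weighted_integral (fun t => psi (polar r t)) e (c - PI) (c + PI)).
  assert (Hf : Rbar_locally p_infty
    (fun r => f r = (h0 r * inv_series a r + h1 r * inv_series b r)%C)).
  { exists (2 * M). intros r Hr.
    assert (Hr' : rho < r) by (unfold M in Hr; lra).
    assert (HMr : 2 * M <= r) by lra.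
    exact (weighted_integral_expansion (h0 r) (h1 r) _ F G e _ _ K M r Hint HM0 HMr
      (Ccontinuous_on_circle r Hr') HcF HcG He He1
      (fun j t => proj1 (HK j t)) (fun j t => proj2 (HK j t))
      (fun t => karp_representation r t HMr)). }
  assert (Hrho0 : 0 <= rho) by lra.
  destruct (angular_mode_bessel U (Re2 psi) kappa rho c m HU
    (fun x y H => proj1 (HC2 x y H))) as (r1 & r2 & Hr).
  { intros x y Hxy. assert (H := f_equal Re (Hhelm (x, y) Hxy)).
    change (partial_derive 2 0 (Re2 psi) x y + partial_derive 0 2 (Re2 psi) x y
            + (kappa ^ 2 * Re (psi (x, y)) - 0 * Im (psi (x, y))) = 0) in H.
    change (Re2 psi x y) with (Re (psi (x, y))). lra. }
  { exact Hrho0. }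
  { exact polar_in_region. }
  destruct (angular_mode_bessel U (Im2 psi) kappa rho c m HU
    (fun x y H => proj2 (HC2 x y H))) as (i1 & i2 & Hi).
  { intros x y Hxy. assert (H := f_equal Im (Hhelm (x, y) Hxy)).
    change (partial_derive 2 0 (Im2 psi) x y + partial_derive 0 2 (Im2 psi) x y
            + (kappa ^ 2 * Im (psi (x, y)) + 0 * Re (psi (x, y))) = 0) in H.
    change (Im2 psi x y) with (Im (psi (x, y))). lra. }
  { exact Hrho0. }
  { exact polar_in_region. }
  assert (Hode : Rbar_locally p_infty (fun r =>
    is_cderive f r (r1 r, i1 r) /\ is_cderive (fun r => (r1 r, i1 r)) r (r2 r, i2 r) /\
    ((r2 r, i2 r) + (r1 r, i1 r) * RtoC (/ r)
     + (RtoC (kappa * kappa) - RtoC (INR m ^ 2) * RtoC (/ r) * RtoC (/ r)) * f r = 0)%C)).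
  { exists rho. intros r Hrr. destruct (Hr r Hrr) as (Dr1 & Dr2 & Er).
    destruct (Hi r Hrr) as (Di1 & Di2 & Ei).
    split; [split; assumption|split; [split; assumption|]].
    apply injective_projections.
    - apply eq_trans with (2 := Er). destruct (f r) as [p q] eqn:Ef.
      apply (f_equal fst) in Ef.
      replace (RInt (fun t => Re2 psi (r * cos t) (r * sin t) * cos (INR m * (t - c)))
                 (c - PI) (c + PI)) with p by (symmetry; exact Ef).
      simpl. field. lra.
    - apply eq_trans with (2 := Ei). destruct (f r) as [p q] eqn:Ef.
      apply (f_equal snd) in Ef.
      replace (RInt (fun t => Im2 psi (r * cos t) (r * sin t) * cos (INR m * (t - c)))
                 (c - PI) (c + PI)) with q by (symmetry; exact Ef).
      simpl. field. lra. }
  assert (Hrec := cylinder_bessel_recurrence kappa (INR m ^ 2) h0 h1 a b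
    (inv_series a) (inv_series b) f (fun r => (r1 r, i1 r)) (fun r => (r2 r, i2 r))
    Hk Hcyl Ea Eb Hf Hode).
  assert (Hgeo : forall d, (forall j, Cmod (d j) <= K' * M ^ j) ->
    geometric (fun j => Re (d j)) /\ geometric (fun j => Im (d j))).
  { intros d Hd. split; exists K', M; (split; [exact HM0|]); intros j;
      (eapply Rle_trans; [|apply Hd]); [apply re_le_Cmod|apply Rabs_Im_le]. }
  destruct (Hgeo a Ba) as [Ga1 Ga2]. destruct (Hgeo b Bb) as [Gb1 Gb2].
  destruct (recurrence_parity kappa m _ _ Hk Ga1 Gb1
    (fun n => proj1 (proj1 (Hrec n))) (fun n => proj1 (proj2 (Hrec n))) n) as [Pr1 Pr2].
  destruct (recurrence_parity kappa m _ _ Hk Ga2 Gb2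
    (fun n => proj2 (proj1 (Hrec n))) (fun n => proj2 (proj2 (Hrec n))) n) as [Pi1 Pi2].
  split; intros Hn; apply injective_projections.
  - exact (Pr1 Hn).
  - exact (Pi1 Hn).
  - exact (Pr2 Hn).
  - exact (Pi2 Hn).
Qed.

End KarpExpansion.

Lemma Chalf_turn_symmetry (H : R -> C) (s : nat) (phi : R) :
  Ccontinuous H -> (forall t, H (t + 2 * PI) = H t) ->
  (forall m, Nat.Odd (s + m) ->
     weighted_integral H (fun t => cos (INR m * (t - phi))) (phi - PI) (phi + PI) = 0) ->
  H phi = (RtoC ((-1) ^ s) * H (phi + PI)%R)%C.
Proof.
  intros Hc Hp Hodd. apply injective_projections; simpl.
  - assert (E : Re (H phi) = (-1) ^ s * Re (H (phi + PI))).
    { apply (half_turn_symmetry (fun t => Re (H t)) phi s (fun t => proj1 (Hc t))).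
      - intros t. now rewrite Hp.
      - intros m Hm. exact (f_equal Re (Hodd m Hm)). }
    unfold Re in E. rewrite E. ring.
  - assert (E : Im (H phi) = (-1) ^ s * Im (H (phi + PI))).
    { apply (half_turn_symmetry (fun t => Im (H t)) phi s (fun t => proj2 (Hc t))).
      - intros t. now rewrite Hp.
      - intros m Hm. exact (f_equal Im (Hodd m Hm)). }
    unfold Im in E. rewrite E. ring.
Qed.

Theorem lemma3 :
  forall (S U : R * R -> Prop) (kappa rho : R) (psi1 : R * R -> C)
         (F G : nat -> R -> C),
    closed_regular_curve S ->
    exterior_region S U ->
    0 < kappa ->
    radiation_solution kappa U psi1 ->
    0 < rho ->
    (forall x : R * R, rho <= norm x -> U x) ->
    karp_expansion kappa rho psi1 F G ->
    forall (n : nat) (phi : R),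
      F n phi = (RtoC ((-1) ^ n) * F n (phi + PI)%R)%C /\
      G n phi = (RtoC ((-1) ^ (n + 1)) * G n (phi + PI)%R)%C.
Proof.
  intros S U kappa rho psi1 F G _ [HU _] Hk [HC2 [Hhelm _]] Hrho Hout Hkarp n phi.
  assert (Hper := proj1 Hkarp).
  destruct (karp_coefficients_Ccontinuous U kappa rho psi1 F G Hk HC2 Hrho Hout Hkarp n)
    as [HcF HcG].
  assert (Hmodes := wrong_parity_modes_vanish U kappa rho psi1 F G HU Hk HC2 Hhelm
                      Hrho Hout Hkarp phi).
  split; apply Chalf_turn_symmetry.
  - exact HcF.
  - intros t. apply Hper.
  - intros m Hm. exact (proj1 (Hmodes m n) Hm).
  - exact HcG.
  - intros t. apply Hper.
  - intros m Hm. apply (proj2 (Hmodes m n)).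
    destruct Hm as [j Hj]. exists j. lia.
Qed.
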